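(* Let $N$ be a $4$-dimensional Lorentzian space form with constant sectional curvature $L_0$, $M$ a Riemann surface and $F:M\to N$ a space-like and conformal immersion satisfying $K\equiv L_0$, $R^{\perp}\equiv0$ and $k\neq0,\pm1$. Let $\lambda,\gamma,X,Y,k,\psi,f$ be the functions attached to $F$ as in the context, and put $$A:=2\,\mathrm{Re}(f_u\overline f_v),\quad A':=2\,\mathrm{Im}(f_u\overline f_v),\quad B:=|f_u|^2-|f_v|^2 .$$ Then $F$ satisfies $X^2\overline Y^2-\overline X^2Y^2\neq0$ if and only if $\lambda$ with (i) $\lambda_{uu}+\lambda_{vv}+L_0e^{2\lambda}=0$, and $\gamma,k,\psi,f$ satisfy (ii) $\mathrm{Re}f_u\,\mathrm{Im}f_u+\mathrm{Re}f_v\,\mathrm{Im}f_v=0$; (iii) $\mathrm{Re}(f_u\overline f_v)\,\mathrm{Im}(f_u\overline f_v)\neq0$; (iv) $Ak+iB\neq0$ and $\overline k=\dfrac{iBk+A}{Ak+iB}$; (v) $$\begin{bmatrix}\overline f_u\\ \overline f_v\end{bmatrix}=\begin{bmatrix}\cos\psi&-\sin\psi\\ \sin\psi&\cos\psi\end{bmatrix}\begin{bmatrix}f_v\\ f_u\end{bmatrix};$$ (vi) $$\begin{bmatrix}\gamma_u\\ \gamma_v\end{bmatrix}=\frac1{k^2-1}\begin{bmatrix}k_u\\ k_v\end{bmatrix}-i\,\frac{\frac{\partial(\overline f,\psi)}{\partial(u,v)}}{\frac{\partial(f,\overline f)}{\partial(u,v)}}\begin{bmatrix}f_u\\ f_v\end{bmatrix}-\frac1{A'}\begin{bmatrix}2|f_u|^2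 & A\\ A & 2|f_v|^2\end{bmatrix}\begin{bmatrix}\lambda_u\\ \lambda_v\end{bmatrix}.$$ In addition, for functions $\lambda,\gamma,k,\psi,f$ as above (real-valued $\lambda,\gamma,\psi$ and complex-valued $k,f$ with $k\neq0,\pm1$ satisfying (i)–(vi)) defined on a simply connected open set $O$ of the $uv$-plane, there exists a space-like and conformal immersion $F$ of $O$ into $N$ with $K\equiv L_0$, $R^{\perp}\equiv0$ such that the second fundamental form does not satisfy the linearly dependent condition, and which is unique up to an isometry of $N$.
   Context: $i$ is the imaginary unit and $\overline f_u$ is the $u$-derivative of $\overline f$. $E^n_k$ is $\mathbb R^n$ with the flat metric with $k$ minus signs. $N$ is taken to be $E^4_1$ if $L_0=0$, $\{x\in E^5_1:\langle x,x\rangle=1/L_0\}$ if $L_0>0$, $\{x\in E^5_2:\langle x,x\rangle=1/L_0\}$ if $L_0<0$; $h$ is its metric and $\nabla$ its Levi-Civita connection. $K$ is the curvature of the induced metric $g$ and $R^{\perp}$ the curvature tensor of the normal connection $\nabla^{\perp}$. Everything is expressed in local isothermal coordinates $(u,v)$ compatible with the complex structure, with $g=e^{2\lambda}(du^2+dv^2)$; $T_1=dF(\partial_u)$, $T_2=dF(\partial_v)$; $N_1,N_2$ are normal vector fields with $h(N_1,N_1)=-h(N_2,N_2)=e^{2\lambda}$, $h(N_1,N_2)=0$. The real functions $\alpha_j,\beta_j$ ($j=1,2,3$), $\mu_l$ ($l=1,2$) are defined by: the normal components of $\nabla_{T_1}T_1$, $\nabla_{T_1}T_2$, $\nabla_{T_2}T_2$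 are $\alpha_1N_1+\beta_1N_2$, $\alpha_2N_1+\beta_2N_2$, $\alpha_3N_1+\beta_3N_2$; and $\nabla^{\perp}_{T_1}N_1=\lambda_uN_1+\mu_1N_2$, $\nabla^{\perp}_{T_1}N_2=\mu_1N_1+\lambda_uN_2$, $\nabla^{\perp}_{T_2}N_1=\lambda_vN_1+\mu_2N_2$, $\nabla^{\perp}_{T_2}N_2=\mu_2N_1+\lambda_vN_2$. Since $R^{\perp}\equiv0$, there is a real-valued function $\gamma$ with $\gamma_u=\mu_1$, $\gamma_v=\mu_2$. Put $W=\alpha_2-i\beta_1$, $X=\alpha_2+i\beta_3$, $Y=\beta_2-i\alpha_1$, $Z=\beta_2+i\alpha_3$. For $F$ with $K\equiv L_0$, $R^\perp\equiv0$ one has $WX-YZ=0$, and it is supposed that there exists a complex-valued function $k$ with $(W,Z)=k(Y,X)$; this is the $k$ in the hypothesis $k\neq0,\pm1$. The function $f$ is a complex-valued function with $X=\frac{if_v}{\sqrt{k^2-1}}$, $Y=\frac{f_u}{\sqrt{k^2-1}}$ (for a local branch of $\sqrt{k^2-1}$), and $\psi$ is the real-valued function defined by relation (v). With $\alpha=(\alpha_1,\alpha_2,\alpha_3)$, $\beta=(\beta_1,\beta_2,\beta_3)$, the second fundamental form satisfies the linearly dependent condition if one of the following holds: $\cosh t\,\alpha+\sinh t\,\beta=0$ for a function $t$ of $(u,v)$; $\sinh t\,\alpha+\cosh t\,\beta=0$ for a function $t$ of $(u,v)$; $\alpha+\varepsilon\beta=0$ for some $\varepsilon\in\{1,-1\}$.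 $\partial(p,q)/\partial(u,v)=p_uq_v-p_vq_u$. In the last assertion, the immersion $F$ is the one obtained from the given functions by putting $\mu_1:=\gamma_u$, $\mu_2:=\gamma_v$ and defining $X,Y,W,Z$ and from them $\alpha_j,\beta_j$ by the formulas above; uniqueness refers to the immersion with these data.
   Formalization: In the last assertion, (i)–(vi) allow f for which the formulas for X, Y, W, Z give no real α_j, β_j (a sign gap); the immersion then has data λ, γ, k, if instead of f, and data λ, γ, k, f whenever the formulas are consistent. *)

(* Defs.v *)
(* Stdlib real numbers with Coquelicot; only the finite types 'I_n and \big
   come from MathComp. *)
From Stdlib Require Import Reals.
From Coquelicot Require Import Coquelicot.
From mathcomp Require Import ssreflect ssrbool ssrnat eqtype fintype bigop.

Set Implicit Arguments.
Unset Strict Implicit.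
Unset Printing Implicit Defensive.

Open Scope R_scope.

(** * Functions of (u, v) *)

Definition du (f : R -> R -> R) (u v : R) : R := Derive (fun x => f x v) u.
Definition dv (f : R -> R -> R) (u v : R) : R := Derive (fun y => f u y) v.

Definition Cdu (f : R -> R -> C) (u v : R) : C :=
  (du (fun x y => Re (f x y)) u v, du (fun x y => Im (f x y)) u v).
Definition Cdv (f : R -> R -> C) (u v : R) : C :=
  (dv (fun x y => Re (f x y)) u v, dv (fun x y => Im (f x y)) u v).

Definition conjf (f : R -> R -> C) (u v : R) : C := Cconj (f u v).

Definition jac (p q : R -> R -> C) (u v : R) : C :=
  (Cdu p u v * Cdv q u v - Cdv p u v * Cdu q u v)%C.

(* C^infinity on the open set O *)
Definition smooth (O : R * R -> Prop) (f : R -> R -> R) : Prop :=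
  forall (n : nat) (u v : R), O (u, v) -> ex_diff_n f n u v.

Definition Csmooth (O : R * R -> Prop) (f : R -> R -> C) : Prop :=
  smooth O (fun u v => Re (f u v)) /\ smooth O (fun u v => Im (f u v)).

Definition unit_interval (t : R) : Prop := 0 <= t <= 1.
Definition unit_square (p : R * R) : Prop :=
  unit_interval (fst p) /\ unit_interval (snd p).

(* Nonempty, path-connected, and every loop contracts to its base point. *)
Definition simply_connected (O : R * R -> Prop) : Prop :=
  (exists p, O p) /\
  (forall p q, O p -> O q ->
     exists c : R -> R * R,
       continuous_on unit_interval c /\ c 0 = p /\ c 1 = q /\
       forall t, unit_interval t -> O (c t)) /\
  (forall c : R -> R * R,
     continuous_on unit_interval c -> c 0 = c 1 ->
     (forall t, unit_interval t -> O (c t)) ->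
     exists H : R * R -> R * R,
       continuous_on unit_square H /\
       (forall p, unit_square p -> O (H p)) /\
       (forall t, unit_interval t -> H (0, t) = c t /\ H (1, t) = c 0) /\
       (forall s, unit_interval s -> H (s, 0) = c 0 /\ H (s, 1) = c 0)).

(** * Curvature of a metric on a plane domain *)

(* The index [false] stands for u, [true] for v. *)
Definition pd (i : bool) (f : R -> R -> R) : R -> R -> R :=
  if i then dv f else du f.

Definition metric := bool -> bool -> R -> R -> R.

Definition bsum (a : bool -> R) : R := a false + a true.

Definition mdet (g : metric) (u v : R) : R :=
  g false false u v * g true true u v - g false true u v * g true false u v.

Definition minv (g : metric) (i j : bool) (u v : R) : R :=
  (if i == j then g (~~ i) (~~ j) u v else - g i j u v) / mdet g u v.

(* Gamma g m i j is the Christoffel symbol with upper index m. *)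
Definition Gamma (g : metric) (m i j : bool) (u v : R) : R :=
  bsum (fun l => minv g m l u v *
    ((pd i (g j l) u v + pd j (g i l) u v - pd l (g i j) u v) / 2)).

(* m-th component of R(d_u, d_v) d_v
   = nabla_u nabla_v d_v - nabla_v nabla_u d_v *)
Definition Riem (g : metric) (m : bool) (u v : R) : R :=
  du (Gamma g m true true) u v - dv (Gamma g m false true) u v +
  bsum (fun l => Gamma g l true true u v * Gamma g m false l u v -
                 Gamma g l false true u v * Gamma g m true l u v).

Definition gauss_curvature (g : metric) (u v : R) : R :=
  bsum (fun m => g m false u v * Riem g m u v) / mdet g u v.

(** * The space forms *)

Definition vec (n : nat) := 'I_n -> R.

(* Scalar product of E^n_k; the last k coordinates carry the minus signs. *)
Definition eform (n k : nat) (x y : vec n) : R :=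
  \big[Rplus/0]_(i < n)
    ((if (i < n - k)%N then 1 else -1) * (x i * y i)).

(* N lies in E^(adim L0)_(aind L0). *)
Definition adim (L0 : R) : nat := if Req_EM_T L0 0 then 4%N else 5%N.
Definition aind (L0 : R) : nat := if Rlt_dec L0 0 then 2%N else 1%N.

Definition avec (L0 : R) := vec (adim L0).

Definition sp (L0 : R) (x y : avec L0) : R := eform (aind L0) x y.

Definition in_N (L0 : R) (x : avec L0) : Prop := L0 <> 0 -> sp x x = 1 / L0.

(* Isometries of N, as restrictions of the affine isometries of the ambient
   space that preserve N. *)
Definition isometry_N (L0 : R) (Phi : avec L0 -> avec L0) : Prop :=
  exists (A : 'I_(adim L0) -> 'I_(adim L0) -> R) (b : avec L0),
    let lin (x : avec L0) : avec L0 :=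
      fun i => \big[Rplus/0]_(j < adim L0) (A i j * x j) in
    (forall x i, Phi x i = lin x i + b i) /\
    (forall x y, sp (lin x) (lin y) = sp x y) /\
    (forall x, in_N (Phi x) <-> in_N x).

(** * Surfaces in N *)

Definition vfield (L0 : R) := R -> R -> avec L0.

Definition vdu (L0 : R) (V : vfield L0) : vfield L0 :=
  fun u v i => du (fun x y => V x y i) u v.
Definition vdv (L0 : R) (V : vfield L0) : vfield L0 :=
  fun u v i => dv (fun x y => V x y i) u v.

Definition vsmooth (L0 : R) (O : R * R -> Prop) (V : vfield L0) : Prop :=
  forall i, smooth O (fun u v => V u v i).

(* The Levi-Civita connection of N along F is the flat derivative followed by
   the orthogonal projection onto the tangent space of N: for L0 <> 0 the
   normal line of N at x is spanned by x, and <x, x> = 1 / L0. *)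
Definition nabla_u (L0 : R) (F V : vfield L0) : vfield L0 :=
  fun u v i => vdu V u v i - L0 * sp (vdu V u v) (F u v) * F u v i.
Definition nabla_v (L0 : R) (F V : vfield L0) : vfield L0 :=
  fun u v i => vdv V u v i - L0 * sp (vdv V u v) (F u v) * F u v i.

Definition T1 (L0 : R) (F : vfield L0) : vfield L0 := vdu F.
Definition T2 (L0 : R) (F : vfield L0) : vfield L0 := vdv F.

Definition induced_metric (L0 : R) (F : vfield L0) : metric :=
  fun i j u v =>
    sp (if i then T2 F u v else T1 F u v) (if j then T2 F u v else T1 F u v).

Record spacelike_conformal_immersion
    (L0 : R) (O : R * R -> Prop) (F : vfield L0) : Prop := {
  imm_smooth : vsmooth O F;
  imm_in_N : forall u v, O (u, v) -> in_N (F u v);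
  imm_spacelike : forall u v, O (u, v) -> 0 < sp (T1 F u v) (T1 F u v);
  imm_conformal : forall u v, O (u, v) ->
    sp (T1 F u v) (T1 F u v) = sp (T2 F u v) (T2 F u v) /\
    sp (T1 F u v) (T2 F u v) = 0 }.

(* Normal component of a vector field V tangent to N; here T1 and T2 are
   orthogonal. *)
Definition normal_part (L0 : R) (F V : vfield L0) : vfield L0 :=
  fun u v i =>
    V u v i
    - sp (V u v) (T1 F u v) / sp (T1 F u v) (T1 F u v) * T1 F u v i
    - sp (V u v) (T2 F u v) / sp (T2 F u v) (T2 F u v) * T2 F u v i.

(* Smooth section of the normal bundle of F in N; for L0 <> 0 the last
   condition says that xi is tangent to N. *)
Definition normal_field
    (L0 : R) (O : R * R -> Prop) (F xi : vfield L0) : Prop :=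
  vsmooth O xi /\
  forall u v, O (u, v) ->
    sp (xi u v) (T1 F u v) = 0 /\ sp (xi u v) (T2 F u v) = 0 /\
    (L0 <> 0 -> sp (xi u v) (F u v) = 0).

Definition nperp_u (L0 : R) (F xi : vfield L0) : vfield L0 :=
  normal_part F (nabla_u F xi).
Definition nperp_v (L0 : R) (F xi : vfield L0) : vfield L0 :=
  normal_part F (nabla_v F xi).

(* R^perp(d_u, d_v) xi, the fields d_u and d_v commuting *)
Definition Rperp (L0 : R) (F xi : vfield L0) : vfield L0 :=
  fun u v i =>
    nperp_u F (nperp_v F xi) u v i - nperp_v F (nperp_u F xi) u v i.

Definition K_equals (L0 : R) (O : R * R -> Prop) (F : vfield L0) : Prop :=
  forall u v, O (u, v) -> gauss_curvature (induced_metric F) u v = L0.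

Definition Rperp_zero (L0 : R) (O : R * R -> Prop) (F : vfield L0) : Prop :=
  forall xi, normal_field O F xi ->
  forall u v, O (u, v) -> forall i, Rperp F xi u v i = 0.

(** * Functions attached to a surface *)

Record coeffs := Coeffs {
  al1 : R -> R -> R; al2 : R -> R -> R; al3 : R -> R -> R;
  be1 : R -> R -> R; be2 : R -> R -> R; be3 : R -> R -> R;
  mu1 : R -> R -> R; mu2 : R -> R -> R }.

Definition fW (c : coeffs) (u v : R) : C := (al2 c u v, - be1 c u v).
Definition fX (c : coeffs) (u v : R) : C := (al2 c u v, be3 c u v).
Definition fY (c : coeffs) (u v : R) : C := (be2 c u v, - al1 c u v).
Definition fZ (c : coeffs) (u v : R) : C := (be2 c u v, al3 c u v).

Definition comb (L0 : R) (a b : R) (x y : avec L0) : avec L0 :=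
  fun i => a * x i + b * y i.

Record adapted (L0 : R) (O : R * R -> Prop) (F N1 N2 : vfield L0)
    (lam : R -> R -> R) (c : coeffs) : Prop := {
  ad_lam : smooth O lam;
  ad_metric : forall u v, O (u, v) ->
    sp (T1 F u v) (T1 F u v) = exp (2 * lam u v);
  ad_N1 : normal_field O F N1;
  ad_N2 : normal_field O F N2;
  ad_norm : forall u v, O (u, v) ->
    sp (N1 u v) (N1 u v) = exp (2 * lam u v) /\
    sp (N2 u v) (N2 u v) = - exp (2 * lam u v) /\
    sp (N1 u v) (N2 u v) = 0;
  ad_sff : forall u v, O (u, v) -> forall i,
    normal_part F (nabla_u F (T1 F)) u v i
      = comb (al1 c u v) (be1 c u v) (N1 u v) (N2 u v) i /\
    normal_part F (nabla_u F (T2 F)) u v i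
      = comb (al2 c u v) (be2 c u v) (N1 u v) (N2 u v) i /\
    normal_part F (nabla_v F (T2 F)) u v i
      = comb (al3 c u v) (be3 c u v) (N1 u v) (N2 u v) i;
  ad_nperp : forall u v, O (u, v) -> forall i,
    nperp_u F N1 u v i = comb (du lam u v) (mu1 c u v) (N1 u v) (N2 u v) i /\
    nperp_u F N2 u v i = comb (mu1 c u v) (du lam u v) (N1 u v) (N2 u v) i /\
    nperp_v F N1 u v i = comb (dv lam u v) (mu2 c u v) (N1 u v) (N2 u v) i /\
    nperp_v F N2 u v i = comb (mu2 c u v) (dv lam u v) (N1 u v) (N2 u v) i }.

(* A smooth branch s of sqrt (k^2 - 1) on O *)
Definition sqrt_branch (O : R * R -> Prop) (k s : R -> R -> C) : Prop :=
  Csmooth O s /\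
  forall u v, O (u, v) -> (s u v * s u v = k u v * k u v - 1)%C.

Record potentials (O : R * R -> Prop) (c : coeffs)
    (gam : R -> R -> R) (k f : R -> R -> C) : Prop := {
  po_gam : smooth O gam;
  po_mu : forall u v, O (u, v) ->
    du gam u v = mu1 c u v /\ dv gam u v = mu2 c u v;
  po_k : Csmooth O k;
  po_k_value : forall u v, O (u, v) ->
    k u v <> 0%C /\ k u v <> 1%C /\ k u v <> (-1)%C;
  po_WZ : forall u v, O (u, v) ->
    fW c u v = (k u v * fY c u v)%C /\ fZ c u v = (k u v * fX c u v)%C;
  po_f : Csmooth O f;
  po_XY : exists s, sqrt_branch O k s /\
    forall u v, O (u, v) ->
      fX c u v = (Ci * Cdv f u v / s u v)%C /\
      fY c u v = (Cdu f u v / s u v)%C }.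

Definition linearly_dependent_condition
    (O : R * R -> Prop) (c : coeffs) : Prop :=
  let dep (a b : R -> R -> R) :=
    forall u v, O (u, v) ->
      a u v * al1 c u v + b u v * be1 c u v = 0 /\
      a u v * al2 c u v + b u v * be2 c u v = 0 /\
      a u v * al3 c u v + b u v * be3 c u v = 0 in
  (exists t : R -> R -> R,
     dep (fun u v => cosh (t u v)) (fun u v => sinh (t u v))) \/
  (exists t : R -> R -> R,
     dep (fun u v => sinh (t u v)) (fun u v => cosh (t u v))) \/
  (exists eps : R, (eps = 1 \/ eps = -1) /\
     dep (fun _ _ => 1) (fun _ _ => eps)).

(** * The conditions (i)-(vi) *)

(* f_u times the conjugate of f_v *)
Definition fufv (f : R -> R -> C) (u v : R) : C :=
  (Cdu f u v * Cconj (Cdv f u v))%C.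

Definition fA (f : R -> R -> C) (u v : R) : R := 2 * Re (fufv f u v).
Definition fA' (f : R -> R -> C) (u v : R) : R := 2 * Im (fufv f u v).
Definition fB (f : R -> R -> C) (u v : R) : R :=
  Cmod (Cdu f u v) ^ 2 - Cmod (Cdv f u v) ^ 2.

Definition cond_i (L0 : R) (lam : R -> R -> R) (u v : R) : Prop :=
  du (du lam) u v + dv (dv lam) u v + L0 * exp (2 * lam u v) = 0.

Definition cond_ii (f : R -> R -> C) (u v : R) : Prop :=
  Re (Cdu f u v) * Im (Cdu f u v) + Re (Cdv f u v) * Im (Cdv f u v) = 0.

Definition cond_iii (f : R -> R -> C) (u v : R) : Prop :=
  Re (fufv f u v) * Im (fufv f u v) <> 0.

Definition cond_iv (k f : R -> R -> C) (u v : R) : Prop :=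
  (fA f u v * k u v + Ci * fB f u v <> 0)%C /\
  (Cconj (k u v)
   = (Ci * fB f u v * k u v + fA f u v) / (fA f u v * k u v + Ci * fB f u v))%C.

Definition cond_v (psi : R -> R -> R) (f : R -> R -> C) (u v : R) : Prop :=
  (Cdu (conjf f) u v
   = cos (psi u v) * Cdv f u v - sin (psi u v) * Cdu f u v)%C /\
  (Cdv (conjf f) u v
   = sin (psi u v) * Cdv f u v + cos (psi u v) * Cdu f u v)%C.

Definition cond_vi (lam gam : R -> R -> R) (k : R -> R -> C)
    (psi : R -> R -> R) (f : R -> R -> C) (u v : R) : Prop :=
  let q : C :=
    (jac (conjf f) (fun x y => RtoC (psi x y)) u v / jac f (conjf f) u v)%C in
  let k21 : C := (k u v * k u v - 1)%C in
  (RtoC (du gam u v)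
   = 1 / k21 * Cdu k u v - Ci * q * Cdu f u v
     - RtoC (1 / fA' f u v *
             (2 * Cmod (Cdu f u v) ^ 2 * du lam u v + fA f u v * dv lam u v))
  )%C /\
  (RtoC (dv gam u v)
   = 1 / k21 * Cdv k u v - Ci * q * Cdv f u v
     - RtoC (1 / fA' f u v *
             (fA f u v * du lam u v + 2 * Cmod (Cdv f u v) ^ 2 * dv lam u v))
  )%C.

Definition conditions (L0 : R) (O : R * R -> Prop) (lam gam : R -> R -> R)
    (k : R -> R -> C) (psi : R -> R -> R) (f : R -> R -> C) : Prop :=
  forall u v, O (u, v) ->
    cond_i L0 lam u v /\ cond_ii f u v /\ cond_iii f u v /\
    cond_iv k f u v /\ cond_v psi f u v /\ cond_vi lam gam k psi f u v.

(** * Surfaces obtained from given functions *)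

(* F is an immersion as in the theorem whose data, for some normal frame and
   some branch of sqrt (k^2 - 1), are lam, gam, k, f; its second fundamental
   form does not satisfy the linearly dependent condition. *)
Definition realizes (L0 : R) (O : R * R -> Prop) (lam gam : R -> R -> R)
    (k f : R -> R -> C) (F : vfield L0) : Prop :=
  spacelike_conformal_immersion O F /\ K_equals O F /\ Rperp_zero O F /\
  exists (N1 N2 : vfield L0) (c : coeffs),
    adapted O F N1 N2 lam c /\ potentials O c gam k f /\
    ~ linearly_dependent_condition O c.

(* The formulas X = i f_v / s, Y = f_u / s, W = k Y, Z = k X define real
   functions al_j, be_j exactly when Re W = Re X (both are al_2) and
   Re Y = Re Z (both are be_2).  Conditions (i)-(vi) are unchanged under
   (psi, f) |-> (psi + PI, i f), while this property is not. *)
Definition formulas_consistent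
    (O : R * R -> Prop) (k f : R -> R -> C) : Prop :=
  exists s, sqrt_branch O k s /\
    forall u v, O (u, v) ->
      (Re (k u v * (Cdu f u v / s u v)) = Re (Ci * Cdv f u v / s u v))%C /\
      (Re (k u v * (Ci * Cdv f u v / s u v)) = Re (Cdu f u v / s u v))%C.

(* Main.v *)
Require Import Defs.
From HB Require Import structures.
From mathcomp Require Import ssreflect ssrbool ssrfun eqtype fintype bigop.
From mathcomp Require ssrnat.
From Stdlib Require Import Reals Lra Lia Classical ClassicalEpsilon FunctionalExtensionality.
From Coquelicot Require Import Coquelicot.

Open Scope R_scope.

(** Write [X], [Y], [W], [Z] in terms of the second fundamental form as in the
    definitions.  The equations of Gauss and Ricci for [K = L0] and flat normal
    bundle say that [WX = YZ], which is built into [(W, Z) = k (Y, X)], and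
    [K = L0] itself is (i).  The four real equations of Codazzi are two complex
    ones, and after the substitution [X = i f_v / s], [Y = f_u / s],
    [s^2 = k^2 - 1], both become the same single equation ([codazzi_curv]).

    What is left of the reality of the [alpha_j] and [beta_j] are two real
    conditions: [W] and [X] have the same real part [alpha_2], [Y] and [Z] have
    the same real part [beta_2].  They are linear in [k] and its conjugate.
    Solving them for [k] ([cons_solved]) and comparing with [s^2 = k^2 - 1]
    ([solved_cr_real]) gives that [r = f_u^2 + f_v^2] is real, which is (ii),
    and then (iv).  Since [A^2 + B^2] is the square of the modulus of [r], there
    is an angle [psi] with [A = r cos psi] and [B = - r sin psi]; relation (v) is
    then an identity, and differentiating (iv) shows that the imaginary part of
    [k_u / (k^2 - 1)] is [- psi_u / 2] ([log_derivative_imag]).  With this, the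
    equation of Codazzi and its conjugate form a linear system for [gamma_u]
    and [gamma_v] whose solution is (vi) ([codazzi_vi], [vi_codazzi]).  Finally
    [X^2] times the square of the conjugate of [Y], minus its conjugate, is a
    nonzero multiple of [A A'], so its vanishing is the failure of (iii)
    ([nonreal_iff]).

    Conversely, (ii) and (iv) give the two real conditions up to one sign
    ([iv_sign]), constant because the domain is connected; replacing [f] by [i f]
    changes the sign of [r] and corrects it ([factor_choice]).  Then (i), (vi)
    and the identities above say that the linear system satisfied by the moving
    frame F, T1, T2, N1, N2 is flat ([frame_flat]).  On a simply connected
    domain a flat system has a solution with any prescribed value at a point:
    locally by Picard iteration ([flat_local_existence]), globally because the
    continuations along two paths agree ([reach_unique],
    [flat_global_existence]).  The system preserves the inverse of the Gram
    matrix of the frame ([pairing_constant]); starting from an orthogonal frame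
    of the ambient space, one obtains the frame of an immersion.  Two immersions
    with the same data have frames solving the same system, after a change of
    sign of the normal frame of one of them, and the affine isometry taking one
    initial frame to the other takes one surface to the other
    ([construct_rigid]). *)

(** * Smooth functions on a plane domain *)

Section Smooth.

Variable O : R * R -> Prop.
Hypothesis oO : open O.

Lemma open_locally_2d u v : O (u, v) -> locally_2d (fun x y => O (x, y)) u v.
Proof.
move=> h; apply/locally_2d_locally.
apply: filter_imp (oO (u, v) h); by case.
Qed.

Definition agree (f g : R -> R -> R) := forall u v, O (u, v) -> f u v = g u v.

Lemma agree_locally f g u v : agree f g -> O (u, v) ->
  locally_2d (fun x y => f x y = g x y) u v.
Proof.
move=> e h; apply: locally_2d_impl (open_locally_2d _ _ h).
apply: locally_2d_forall => x y; exact: e.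
Qed.

Lemma agree_du f g u v : agree f g -> O (u, v) -> du f u v = du g u v.
Proof.
move=> e h; apply: Derive_ext_loc.
exact: (locally_2d_1d_const_y _ _ _ (agree_locally _ _ _ _ e h)).
Qed.

Lemma agree_dv f g u v : agree f g -> O (u, v) -> dv f u v = dv g u v.
Proof.
move=> e h; apply: Derive_ext_loc.
exact: (locally_2d_1d_const_x _ _ _ (agree_locally _ _ _ _ e h)).
Qed.

Lemma agree_sym f g : agree f g -> agree g f.
Proof. by move=> e u v h; rewrite e. Qed.

Lemma smooth_agree f g : agree f g -> smooth O f -> smooth O g.
Proof.
move=> e Hf n u v h.
exact: ex_diff_n_ext_loc (agree_locally _ _ _ _ e h) (Hf n u v h).
Qed.

Lemma smooth_cont f u v : smooth O f -> O (u, v) -> continuity_2d_pt f u v.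
Proof. by move=> Hf h; case: (Hf 0%nat u v h). Qed.

Lemma smooth_ex_u f u v : smooth O f -> O (u, v) -> ex_derive (fun x => f x v) u.
Proof. by move=> Hf h; move: (Hf 1%nat u v h) => /= [_ []]. Qed.

Lemma smooth_ex_v f u v : smooth O f -> O (u, v) -> ex_derive (fun y => f u y) v.
Proof. by move=> Hf h; move: (Hf 1%nat u v h) => /= [_ [_ []]]. Qed.

Lemma smooth_du f : smooth O f -> smooth O (du f).
Proof. by move=> Hf n u v h; move: (Hf (S n) u v h) => /= [_ [_ [_ []]]]. Qed.

Lemma smooth_dv f : smooth O f -> smooth O (dv f).
Proof. by move=> Hf n u v h; move: (Hf (S n) u v h) => /= [_ [_ [_ []]]]. Qed.

Lemma du_dv f u v : smooth O f -> O (u, v) -> du (dv f) u v = dv (du f) u v.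
Proof.
move=> Hf h; apply: Schwarz.
- apply: locally_2d_impl (open_locally_2d _ _ h).
  apply: locally_2d_forall => x y hxy.
  split; first exact: smooth_ex_u.
  split; first exact: smooth_ex_v.
  split; first exact: (smooth_ex_u (dv f) _ _ (smooth_dv _ Hf)).
  exact: (smooth_ex_v (du f) _ _ (smooth_du _ Hf)).
- exact: (smooth_cont (du (dv f)) _ _ (smooth_du _ (smooth_dv _ Hf))).
- exact: (smooth_cont (dv (du f)) _ _ (smooth_dv _ (smooth_du _ Hf))).
Qed.

(** Closing a family under ring operations with smooth functions is what allows
    [smooth_coind] to be applied to families whose derivatives are only
    polynomial in the family. *)
Inductive alg (B : (R -> R -> R) -> Prop) : (R -> R -> R) -> Prop :=
| alg_gen f : B f -> alg B f
| alg_smooth f : smooth O f -> alg B f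
| alg_plus f g : alg B f -> alg B g -> alg B (fun u v => f u v + g u v)
| alg_mult f g : alg B f -> alg B g -> alg B (fun u v => f u v * g u v).

Definition C1_in (B : (R -> R -> R) -> Prop) (f : R -> R -> R) :=
  (forall u v, O (u, v) -> continuity_2d_pt f u v /\
     ex_derive (fun x => f x v) u /\ ex_derive (fun y => f u y) v) /\
  (exists g, alg B g /\ agree (du f) g) /\
  (exists g, alg B g /\ agree (dv f) g).

Lemma alg_C1 (B : (R -> R -> R) -> Prop) :
  (forall f, B f -> C1_in B f) -> forall f, alg B f -> C1_in B f.
Proof.
move=> HB f.
elim=> {f} [f /HB//|f Hf|f g af0 Hf ag0 Hg|f g af0 Hf ag0 Hg].
- split; first by move=> u v h; split; [exact: smooth_cont|
    split; [exact: smooth_ex_u|exact: smooth_ex_v]].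
  by split; [exists (du f)|exists (dv f)]; split=> //; apply: alg_smooth;
    [exact: smooth_du|exact: smooth_dv].
- move: Hf Hg => [Hf [[fu [af ef]] [fv [af' ef']]]] [Hg [[gu [ag eg]] [gv [ag' eg']]]].
  split.
    move=> u v h; have [cf [uf vf]] := Hf u v h; have [cg [ug vg]] := Hg u v h.
    split; first exact: continuity_2d_pt_plus.
    by split; apply: @ex_derive_plus.
  split.
    exists (fun u v => fu u v + gu u v); split; first exact: alg_plus.
    move=> u v h; have [cf [uf vf]] := Hf u v h; have [cg [ug vg]] := Hg u v h.
    by rewrite -ef // -eg // /du Derive_plus.
  exists (fun u v => fv u v + gv u v); split; first exact: alg_plus.
  move=> u v h; have [cf [uf vf]] := Hf u v h; have [cg [ug vg]] := Hg u v h.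
  by rewrite -ef' // -eg' // /dv Derive_plus.
- move: Hf Hg => [Hf [[fu [af ef]] [fv [af' ef']]]] [Hg [[gu [ag eg]] [gv [ag' eg']]]].
  split.
    move=> u v h; have [cf [uf vf]] := Hf u v h; have [cg [ug vg]] := Hg u v h.
    split; first exact: continuity_2d_pt_mult.
    by split; apply: ex_derive_mult.
  split.
    exists (fun u v => fu u v * g u v + f u v * gu u v); split.
      by apply: alg_plus; apply: alg_mult.
    move=> u v h; have [cf [uf vf]] := Hf u v h; have [cg [ug vg]] := Hg u v h.
    by rewrite -ef // -eg // /du Derive_mult.
  exists (fun u v => fv u v * g u v + f u v * gv u v); split.
    by apply: alg_plus; apply: alg_mult.
  move=> u v h; have [cf [uf vf]] := Hf u v h; have [cg [ug vg]] := Hg u v h.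
  by rewrite -ef' // -eg' // /dv Derive_mult.
Qed.

(** Smoothness is a greatest fixed point: a family of functions is smooth as
    soon as its members are C1 and their partial derivatives are again
    expressible by sums and products of members and of known smooth
    functions. *)
Lemma smooth_coind (B : (R -> R -> R) -> Prop) :
  (forall f, B f -> C1_in B f) -> forall f, alg B f -> smooth O f.
Proof.
move=> HB; have C1 := alg_C1 B HB.
move=> f af n; elim: n f af => [|n IH] f af u v h.
  by have [Hf _] := C1 f af; split=> //; case: (Hf u v h).
have [Hf [[g [ag eg]] [g' [ag' eg']]]] := C1 f af.
have [c [e1 e2]] := Hf u v h.
split=> //; split=> //; split=> //; split.
- exact: ex_diff_n_ext_loc (agree_locally _ _ _ _ (agree_sym _ _ eg) h) (IH g ag u v h).
- exact: ex_diff_n_ext_loc (agree_locally _ _ _ _ (agree_sym _ _ eg') h) (IH g' ag' u v h).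
Qed.

Lemma smooth_plus f g : smooth O f -> smooth O g ->
  smooth O (fun u v => f u v + g u v).
Proof.
move=> Hf Hg; apply: (smooth_coind (fun _ => False)) => //.
by apply: alg_plus; apply: alg_smooth.
Qed.

Lemma smooth_mult f g : smooth O f -> smooth O g ->
  smooth O (fun u v => f u v * g u v).
Proof.
move=> Hf Hg; apply: (smooth_coind (fun _ => False)) => //.
by apply: alg_mult; apply: alg_smooth.
Qed.

Lemma smooth_const c : smooth O (fun _ _ => c).
Proof.
have H n : forall c u v, ex_diff_n (fun _ _ => c) n u v.
  elim: n => [|n IH] {}c u v; split=> //; try exact: continuity_2d_pt_const.
  split; first exact: ex_derive_const.
  split; first exact: ex_derive_const.
  split; apply: (ex_diff_n_ext_loc (fun _ _ => 0)) => //;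
    by apply: locally_2d_forall => x y; rewrite Derive_const.
by move=> n u v _; exact: H.
Qed.

Lemma smooth_opp f : smooth O f -> smooth O (fun u v => - f u v).
Proof.
move=> Hf; apply: (smooth_agree (fun u v => -1 * f u v)) => [u v _|]; first by ring.
exact: smooth_mult (smooth_const _) Hf.
Qed.

Lemma smooth_minus f g : smooth O f -> smooth O g ->
  smooth O (fun u v => f u v - g u v).
Proof. move=> Hf Hg; exact: smooth_plus Hf (smooth_opp _ Hg). Qed.

Lemma du_const c u v : du (fun _ _ => c) u v = 0.
Proof. exact: Derive_const. Qed.

Lemma dv_const c u v : dv (fun _ _ => c) u v = 0.
Proof. exact: Derive_const. Qed.

Lemma du_opp f u v : du (fun x y => - f x y) u v = - du f u v.
Proof. exact: Derive_opp. Qed.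

Lemma dv_opp f u v : dv (fun x y => - f x y) u v = - dv f u v.
Proof. exact: Derive_opp. Qed.

Lemma du_plus f g u v : smooth O f -> smooth O g -> O (u, v) ->
  du (fun x y => f x y + g x y) u v = du f u v + du g u v.
Proof. by move=> Hf Hg h; apply: Derive_plus; exact: smooth_ex_u. Qed.

Lemma dv_plus f g u v : smooth O f -> smooth O g -> O (u, v) ->
  dv (fun x y => f x y + g x y) u v = dv f u v + dv g u v.
Proof. by move=> Hf Hg h; apply: Derive_plus; exact: smooth_ex_v. Qed.

Lemma du_minus f g u v : smooth O f -> smooth O g -> O (u, v) ->
  du (fun x y => f x y - g x y) u v = du f u v - du g u v.
Proof. by move=> Hf Hg h; apply: Derive_minus; exact: smooth_ex_u. Qed.

Lemma dv_minus f g u v : smooth O f -> smooth O g -> O (u, v) ->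
  dv (fun x y => f x y - g x y) u v = dv f u v - dv g u v.
Proof. by move=> Hf Hg h; apply: Derive_minus; exact: smooth_ex_v. Qed.

Lemma du_mult f g u v : smooth O f -> smooth O g -> O (u, v) ->
  du (fun x y => f x y * g x y) u v = du f u v * g u v + f u v * du g u v.
Proof. by move=> Hf Hg h; apply: Derive_mult; exact: smooth_ex_u. Qed.

Lemma dv_mult f g u v : smooth O f -> smooth O g -> O (u, v) ->
  dv (fun x y => f x y * g x y) u v = dv f u v * g u v + f u v * dv g u v.
Proof. by move=> Hf Hg h; apply: Derive_mult; exact: smooth_ex_v. Qed.

Lemma du_comp (h : R -> R) l f u v : smooth O f -> O (u, v) ->
  is_derive h (f u v) l -> du (fun x y => h (f x y)) u v = l * du f u v.
Proof.
move=> Hf o D; rewrite Rmult_comm; apply: is_derive_unique.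
apply: (is_derive_comp h (fun x => f x v)) => //.
exact: Derive_correct (smooth_ex_u _ _ _ Hf o).
Qed.

Lemma dv_comp (h : R -> R) l f u v : smooth O f -> O (u, v) ->
  is_derive h (f u v) l -> dv (fun x y => h (f x y)) u v = l * dv f u v.
Proof.
move=> Hf o D; rewrite Rmult_comm; apply: is_derive_unique.
apply: (is_derive_comp h (fun y => f u y)) => //.
exact: Derive_correct (smooth_ex_v _ _ _ Hf o).
Qed.

(** A family of outer functions whose derivatives are polynomials in the family
    composes with a smooth function to smooth functions; [exp], [cos] with
    [sin], and the inverse are all of this kind. *)
Lemma smooth_comp (H : (R -> R) -> Prop) f : smooth O f ->
  (forall h, H h -> exists h',
     (forall u v, O (u, v) -> is_derive h (f u v) (h' (f u v))) /\
     alg (fun g => exists k, H k /\ g = fun u v => k (f u v))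
       (fun u v => h' (f u v))) ->
  forall h, H h -> smooth O (fun u v => h (f u v)).
Proof.
move=> Hf HH h Hh.
apply: (smooth_coind (fun g => exists k, H k /\ g = fun u v => k (f u v)));
  last by apply: alg_gen; exists h.
move=> _ [k [Hk ->]]; have [k' [Dk ak]] := HH k Hk.
split; [|split].
- move=> u v o; split.
    apply: continuity_1d_2d_pt_comp; last exact: smooth_cont.
    apply/continuity_pt_filterlim; apply: ex_derive_continuous.
    by exists (k' (f u v)); exact: Dk.
  split; apply: ex_derive_comp.
  + by exists (k' (f u v)); exact: Dk.
  + exact: smooth_ex_u.
  + by exists (k' (f u v)); exact: Dk.
  + exact: smooth_ex_v.
- exists (fun u v => k' (f u v) * du f u v); split.
    by apply: alg_mult => //; apply: alg_smooth; exact: smooth_du.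
  by move=> u v o; apply: du_comp => //; exact: Dk.
- exists (fun u v => k' (f u v) * dv f u v); split.
    by apply: alg_mult => //; apply: alg_smooth; exact: smooth_dv.
  by move=> u v o; apply: dv_comp => //; exact: Dk.
Qed.

Lemma smooth_exp f : smooth O f -> smooth O (fun u v => exp (f u v)).
Proof.
move=> Hf; apply: (smooth_comp (eq exp) _ Hf) => // _ <-.
exists exp; split=> [u v _|]; first exact: is_derive_exp.
by apply: alg_gen; exists exp.
Qed.

Lemma smooth_inv f : smooth O f -> (forall u v, O (u, v) -> f u v <> 0) ->
  smooth O (fun u v => / f u v).
Proof.
move=> Hf nz; apply: (smooth_comp (eq Rinv) _ Hf) => // _ <-.
exists (fun x => -1 * (/ x * / x)); split=> [u v o|].
  move: (nz u v o) => n; auto_derive => //; by field.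
apply: (alg_mult _ (fun _ _ => -1)); first by apply: alg_smooth; exact: smooth_const.
by apply: alg_mult; apply: alg_gen; exists Rinv.
Qed.

Lemma du_inv f u v : smooth O f -> O (u, v) -> f u v <> 0 ->
  du (fun x y => / f x y) u v = - du f u v / (f u v * f u v).
Proof.
move=> Hf o nz; rewrite (du_comp Rinv (- / (f u v * f u v))) //; first by field.
by auto_derive => //; field.
Qed.

Lemma dv_inv f u v : smooth O f -> O (u, v) -> f u v <> 0 ->
  dv (fun x y => / f x y) u v = - dv f u v / (f u v * f u v).
Proof.
move=> Hf o nz; rewrite (dv_comp Rinv (- / (f u v * f u v))) //; first by field.
by auto_derive => //; field.
Qed.

(** * Smooth complex functions *)

Lemma Csmooth_plus f g : Csmooth O f -> Csmooth O g ->
  Csmooth O (fun u v => f u v + g u v)%C.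
Proof. by move=> [f1 f2] [g1 g2]; split; apply: smooth_plus. Qed.

Lemma Csmooth_opp f : Csmooth O f -> Csmooth O (fun u v => - f u v)%C.
Proof. by move=> [f1 f2]; split; apply: smooth_opp. Qed.

Lemma Csmooth_minus f g : Csmooth O f -> Csmooth O g ->
  Csmooth O (fun u v => f u v - g u v)%C.
Proof. by move=> hf hg; apply: Csmooth_plus => //; exact: Csmooth_opp. Qed.

Lemma Csmooth_mult f g : Csmooth O f -> Csmooth O g ->
  Csmooth O (fun u v => f u v * g u v)%C.
Proof.
move=> [f1 f2] [g1 g2]; split.
- by apply: smooth_minus; apply: smooth_mult.
- by apply: smooth_plus; apply: smooth_mult.
Qed.

Lemma Csmooth_const c : Csmooth O (fun _ _ => c).
Proof. by split; exact: smooth_const. Qed.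

Lemma Csmooth_RtoC f : smooth O f -> Csmooth O (fun u v => RtoC (f u v)).
Proof. by move=> Hf; split=> //; exact: smooth_const. Qed.

Lemma Csmooth_conj f : Csmooth O f -> Csmooth O (fun u v => Cconj (f u v)).
Proof. by move=> [f1 f2]; split=> //; exact: smooth_opp. Qed.

Lemma Csmooth_Cdu f : Csmooth O f -> Csmooth O (Cdu f).
Proof. by move=> [f1 f2]; split; exact: smooth_du. Qed.

Lemma Csmooth_Cdv f : Csmooth O f -> Csmooth O (Cdv f).
Proof. by move=> [f1 f2]; split; exact: smooth_dv. Qed.

Lemma norm2_neq0 (z : C) : z <> 0%C -> Re z * Re z + Im z * Im z <> 0.
Proof.
move: z => [a b] /= nz e; apply: nz.
have [-> ->] : a = 0 /\ b = 0 by nra.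
by [].
Qed.

Lemma Csmooth_inv f : Csmooth O f -> (forall u v, O (u, v) -> f u v <> 0%C) ->
  Csmooth O (fun u v => / f u v)%C.
Proof.
move=> [f1 f2] nz.
have H : smooth O (fun u v => / (Re (f u v) * Re (f u v) + Im (f u v) * Im (f u v))).
  apply: smooth_inv; first by apply: smooth_plus; apply: smooth_mult.
  by move=> u v o; apply: norm2_neq0; exact: nz.
split.
- apply: (smooth_agree _ _ _ (smooth_mult _ _ f1 H)) => u v o.
  by rewrite /Cinv /= /Rdiv !Rmult_1_r.
- apply: (smooth_agree _ _ _ (smooth_mult _ _ (smooth_opp _ f2) H)) => u v o.
  by rewrite /Cinv /= /Rdiv !Rmult_1_r.
Qed.

Lemma Csmooth_agree f g : (forall u v, O (u, v) -> f u v = g u v) ->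
  Csmooth O f -> Csmooth O g.
Proof.
by move=> e [h1 h2]; split; [apply: (smooth_agree _ _ _ h1)|
  apply: (smooth_agree _ _ _ h2)] => u v o; rewrite e.
Qed.

Lemma Cdu_agree f g u v : (forall u v, O (u, v) -> f u v = g u v) -> O (u, v) ->
  Cdu f u v = Cdu g u v.
Proof. by move=> e o; congr pair; apply: agree_du => // x y h; rewrite e. Qed.

Lemma Cdv_agree f g u v : (forall u v, O (u, v) -> f u v = g u v) -> O (u, v) ->
  Cdv f u v = Cdv g u v.
Proof. by move=> e o; congr pair; apply: agree_dv => // x y h; rewrite e. Qed.

Lemma Cdu_Cdv f u v : Csmooth O f -> O (u, v) -> Cdu (Cdv f) u v = Cdv (Cdu f) u v.
Proof. by move=> [h1 h2] o; congr pair; exact: du_dv. Qed.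

Lemma Cdu_const c u v : Cdu (fun _ _ => c) u v = 0%C.
Proof. by congr pair; exact: du_const. Qed.

Lemma Cdv_const c u v : Cdv (fun _ _ => c) u v = 0%C.
Proof. by congr pair; exact: dv_const. Qed.

Lemma Cdu_conj f u v : Cdu (fun x y => Cconj (f x y)) u v = Cconj (Cdu f u v).
Proof. by congr pair; exact: du_opp. Qed.

Lemma Cdv_conj f u v : Cdv (fun x y => Cconj (f x y)) u v = Cconj (Cdv f u v).
Proof. by congr pair; exact: dv_opp. Qed.

Lemma Cdu_RtoC f u v : Cdu (fun x y => RtoC (f x y)) u v = RtoC (du f u v).
Proof. by congr pair; exact: du_const. Qed.

Lemma Cdv_RtoC f u v : Cdv (fun x y => RtoC (f x y)) u v = RtoC (dv f u v).
Proof. by congr pair; exact: dv_const. Qed.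

Lemma Cdu_minus f g u v : Csmooth O f -> Csmooth O g -> O (u, v) ->
  Cdu (fun x y => f x y - g x y)%C u v = (Cdu f u v - Cdu g u v)%C.
Proof. by move=> [? ?] [? ?] o; congr pair; exact: du_minus. Qed.

Lemma Cdv_minus f g u v : Csmooth O f -> Csmooth O g -> O (u, v) ->
  Cdv (fun x y => f x y - g x y)%C u v = (Cdv f u v - Cdv g u v)%C.
Proof. by move=> [? ?] [? ?] o; congr pair; exact: dv_minus. Qed.

Lemma Cdu_mult f g u v : Csmooth O f -> Csmooth O g -> O (u, v) ->
  Cdu (fun x y => f x y * g x y)%C u v = (Cdu f u v * g u v + f u v * Cdu g u v)%C.
Proof.
move=> [? ?] [? ?] o; congr pair; rewrite /= ?du_minus ?du_plus ?du_mult //;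
  try exact: smooth_mult; rewrite /Re /Im; ring.
Qed.

Lemma Cdv_mult f g u v : Csmooth O f -> Csmooth O g -> O (u, v) ->
  Cdv (fun x y => f x y * g x y)%C u v = (Cdv f u v * g u v + f u v * Cdv g u v)%C.
Proof.
move=> [? ?] [? ?] o; congr pair; rewrite /= ?dv_minus ?dv_plus ?dv_mult //;
  try exact: smooth_mult; rewrite /Re /Im; ring.
Qed.

End Smooth.

(** * Finite sums *)

Lemma sum_f_R0_ext N f g : (forall j, (j <= N)%nat -> f j = g j) ->
  sum_f_R0 f N = sum_f_R0 g N.
Proof. by move=> e; apply: sum_eq. Qed.

Lemma sum_f_R0_mult_l N f a : a * sum_f_R0 f N = sum_f_R0 (fun j => a * f j) N.
Proof. by rewrite scal_sum; apply: sum_f_R0_ext => j _; rewrite Rmult_comm. Qed.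

Lemma sum_f_R0_swap N M (f : nat -> nat -> R) :
  sum_f_R0 (fun i => sum_f_R0 (f i) M) N =
  sum_f_R0 (fun j => sum_f_R0 (fun i => f i j) N) M.
Proof.
elim: N => [|N IH] //=.
by rewrite IH -sum_plus.
Qed.

Lemma sum_f_R0_0 N f : (forall j, (j <= N)%nat -> f j = 0) -> sum_f_R0 f N = 0.
Proof.
move=> e; rewrite (sum_f_R0_ext N f (fun _ => 0)) //.
by elim: N {e} => //= N ->; rewrite Rplus_0_l.
Qed.

Lemma sum_f_R0_single N i f : (i <= N)%nat ->
  sum_f_R0 (fun j => if Nat.eqb j i then f j else 0) N = f i.
Proof.
elim: N => [|N IH] hi; first by have -> : i = 0%nat by lia.
rewrite tech5; case: Nat.eqb_spec => [<-|hn].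
  rewrite sum_f_R0_0; first by ring.
  by move=> j hj; case: Nat.eqb_spec => // ?; lia.
by rewrite IH; [ring|lia].
Qed.

Lemma sum_f_R0_bound N f M : (forall j, (j <= N)%nat -> Rabs (f j) <= M) ->
  Rabs (sum_f_R0 f N) <= INR (S N) * M.
Proof.
elim: N => [|N IH] H; first by rewrite /= Rmult_1_l; exact: H.
rewrite tech5 S_INR Rmult_plus_distr_r Rmult_1_l.
apply: Rle_trans (Rabs_triang _ _) _; apply: Rplus_le_compat; last exact: H.
by apply: IH => j hj; apply: H; lia.
Qed.

Lemma sum_f_R0_dot_bound N a b C M : 0 <= C ->
  (forall j, (j <= N)%nat -> Rabs (a j) <= C) ->
  (forall j, (j <= N)%nat -> Rabs (b j) <= M) ->
  Rabs (sum_f_R0 (fun j => a j * b j) N) <= INR (S N) * C * M.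
Proof.
move=> hC ha hb; rewrite Rmult_assoc; apply: sum_f_R0_bound => j hj.
rewrite Rabs_mult; apply: Rmult_le_compat; try exact: Rabs_pos; auto.
Qed.

Lemma is_derive_sum N (f : nat -> R -> R) (d : nat -> R) x :
  (forall j, (j <= N)%nat -> is_derive (f j) x (d j)) ->
  is_derive (fun y => sum_f_R0 (fun j => f j y) N) x (sum_f_R0 d N).
Proof.
elim: N => [|N IH] H /=; first exact: H.
apply: @is_derive_plus; last exact: H.
by apply: IH => j hj; apply: H; lia.
Qed.

Lemma continuity_2d_pt_sum N (f : nat -> R -> R -> R) u v :
  (forall j, (j <= N)%nat -> continuity_2d_pt (f j) u v) ->
  continuity_2d_pt (fun x y => sum_f_R0 (fun j => f j x y) N) u v.
Proof.
elim: N => [|N IH] H /=; first exact: H.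
apply: (continuity_2d_pt_plus (fun x y => sum_f_R0 (fun j => f j x y) N)); last exact: H.
by apply: IH => j hj; apply: H; lia.
Qed.

(** * Integrals depending on a parameter *)

Lemma continuity_2d_slice_u f u v : continuity_2d_pt f u v ->
  continuous (fun x => f x v) u.
Proof.
move=> c; apply/continuity_pt_filterlim/continuity_pt_locally => eps.
exact: (locally_2d_1d_const_y _ _ _ (c eps)).
Qed.

Lemma continuity_2d_slice_v f u v : continuity_2d_pt f u v ->
  continuous (fun y => f u y) v.
Proof.
move=> c; apply/continuity_pt_filterlim/continuity_pt_locally => eps.
exact: (locally_2d_1d_const_x _ _ _ (c eps)).
Qed.

Lemma RInt_bound f a b M : ex_RInt f a b ->
  (forall t, Rmin a b <= t <= Rmax a b -> Rabs (f t) <= M) ->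
  Rabs (RInt f a b) <= Rabs (b - a) * M.
Proof.
move=> ef H; have [l|l] := Rle_or_lt a b.
  rewrite (Rabs_pos_eq (b - a)); last lra.
  apply: abs_RInt_le_const => // t ht; apply: H.
  by rewrite Rmin_left ?Rmax_right.
rewrite -opp_RInt_swap; last exact: ex_RInt_swap.
rewrite /opp /= Rabs_Ropp (Rabs_left (b - a)); last lra.
replace (- (b - a)) with (a - b) by ring.
apply: abs_RInt_le_const; [lra|exact: ex_RInt_swap|] => t ht; apply: H.
by rewrite Rmin_right ?Rmax_left; lra.
Qed.

Definition box (u0 v0 r : R) (p : R * R) : Prop :=
  Rabs (fst p - u0) < r /\ Rabs (snd p - v0) < r.

Section Box.

Variables (u0 v0 r : R).
Let B := box u0 v0 r.

Definition cont_on (D : R * R -> Prop) (g : R -> R -> R) :=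
  forall u v, D (u, v) -> continuity_2d_pt g u v.

Lemma box_open : open B.
Proof.
case=> u v [/= hu hv].
apply/(locally_2d_locally (fun x y => B (x, y))).
have hd : 0 < Rmin (r - Rabs (u - u0)) (r - Rabs (v - v0)).
  by apply: Rmin_pos; lra.
exists (mkposreal _ hd) => x y /= hx hy.
move: (Rmin_l (r - Rabs (u - u0)) (r - Rabs (v - v0)))
  (Rmin_r (r - Rabs (u - u0)) (r - Rabs (v - v0))) => l1 l2.
split=> /=; [move: (Rabs_triang (x - u) (u - u0))|move: (Rabs_triang (y - v) (v - v0))].
  replace (x - u + (u - u0)) with (x - u0) by ring; lra.
replace (y - v + (v - v0)) with (y - v0) by ring; lra.
Qed.

Lemma between_in x a b : Rabs (a - u0) < r -> Rabs (b - u0) < r ->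
  Rmin a b <= x <= Rmax a b -> Rabs (x - u0) < r.
Proof.
move=> /Rabs_def2 ha /Rabs_def2 hb; rewrite /Rmin /Rmax.
case: Rle_dec => _ hx; apply: Rabs_def1; lra.
Qed.

End Box.

Section Param.

Variables (u0 v0 r vb : R).
Let B := box u0 v0 r.
Hypothesis hvb : Rabs (vb - v0) < r.

Variable g : R -> R -> R.
Hypothesis cg : cont_on B g.

Lemma ex_RInt_slice u a b : Rabs (u - u0) < r -> Rabs (a - v0) < r ->
  Rabs (b - v0) < r -> ex_RInt (fun t => g u t) a b.
Proof.
move=> hu ha hb; apply: ex_RInt_continuous => t ht.
by apply: continuity_2d_slice_v; apply: cg; split=> //=; exact: between_in ht.
Qed.

Lemma RInt_param_dv u v : B (u, v) ->
  is_derive (fun y => RInt (fun t => g u t) vb y) v (g u v).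
Proof.
move=> [/= hu hv]; apply: is_derive_RInt.
- have [d Hd] := box_open u0 v0 r (u, v) (conj hu hv).
  exists d => y hy; apply: RInt_correct; apply: ex_RInt_slice => //.
  by case: (Hd (u, y)) => //; split=> //=; exact: ball_center.
- by apply: continuity_2d_slice_v; apply: cg.
Qed.

Lemma RInt_param_cont : cont_on B (fun u v => RInt (fun t => g u t) vb v).
Proof.
move=> u v [/= hu hv] eps.
have hM : 0 < Rabs (g u v) + 1 by have := Rabs_pos (g u v); lra.
have hL : 0 < Rabs (v - vb) + 1 by have := Rabs_pos (v - vb); lra.
have he : 0 < eps / 2 / (Rabs (v - vb) + 1).
  by apply: Rdiv_lt_0_compat => //; have := cond_pos eps; lra.
have he' : 0 < eps / 2 / (Rabs (g u v) + 1).
  by apply: Rdiv_lt_0_compat => //; have := cond_pos eps; lra.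
have [d1 H1] := uniform_continuity_2d_1d' g (Rmin vb v) (Rmax vb v) u
  (fun t ht => cg u t (conj hu (between_in _ _ _ _ _ hvb hv ht))) (mkposreal _ he).
have [d2 H2] := cg u v (conj hu hv) (mkposreal 1 Rlt_0_1).
have oB := box_open u0 v0 r (u, v) (conj hu hv).
have [d3 H3] : locally_2d (fun x y => B (x, y)) u v by apply/locally_2d_locally;
  apply: filter_imp oB; case.
have hd : 0 < Rmin (Rmin d1 d2) (Rmin d3 (eps / 2 / (Rabs (g u v) + 1))).
  by apply: Rmin_pos; apply: Rmin_pos => //; exact: cond_pos.
exists (mkposreal _ hd) => x y /= hx hy.
move: (Rmin_l (Rmin d1 d2) (Rmin d3 (eps / 2 / (Rabs (g u v) + 1))))
  (Rmin_r (Rmin d1 d2) (Rmin d3 (eps / 2 / (Rabs (g u v) + 1))))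
  (Rmin_l d1 d2) (Rmin_r d1 d2)
  (Rmin_l d3 (eps / 2 / (Rabs (g u v) + 1)))
  (Rmin_r d3 (eps / 2 / (Rabs (g u v) + 1))) => l1 l2 l3 l4 l5 l6.
have [/= bx by_] : B (x, y) by apply: H3; lra.
rewrite -(RInt_Chasles (fun t => g x t) vb v y); try exact: ex_RInt_slice.
rewrite /plus /=.
replace (_ + _ - _) with (minus (RInt (fun t => g x t) vb v) (RInt (fun t => g u t) vb v)
  + RInt (fun t => g x t) v y) by (rewrite /minus /plus /opp /=; ring).
rewrite -RInt_minus; try exact: ex_RInt_slice.
apply: Rle_lt_trans (Rabs_triang _ _) _.
have b1 : Rabs (RInt (fun t => minus (g x t) (g u t)) vb v)
    <= Rabs (v - vb) * (eps / 2 / (Rabs (v - vb) + 1)).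
  apply: RInt_bound.
    by apply: @ex_RInt_minus; exact: ex_RInt_slice.
  move=> t ht; apply: Rlt_le; apply: (H1 t u t x) => //.
  - by have := cond_pos d1; lra.
  - by move/Rabs_def2: hx; lra.
  - by rewrite Rminus_diag Rabs_R0; exact: cond_pos.
have b2 : Rabs (RInt (fun t => g x t) v y) <= Rabs (y - v) * (Rabs (g u v) + 1).
  apply: RInt_bound; first exact: ex_RInt_slice.
  move=> t ht.
  have tv : Rabs (t - v) < d2.
    apply: (between_in v d2 t v y) => //.
    - by rewrite Rminus_diag Rabs_R0; exact: cond_pos.
    - lra.
  have /= h2 := H2 x t ltac:(lra) tv.
  move: (Rabs_triang (g x t - g u v) (g u v)).
  by replace (g x t - g u v + g u v) with (g x t) by ring; lra.
have b3 : Rabs (v - vb) * (eps / 2 / (Rabs (v - vb) + 1)) < eps / 2.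
  apply: (Rmult_lt_reg_r (Rabs (v - vb) + 1)) => //.
  field_simplify; last lra.
  have := cond_pos eps; have := Rabs_pos (v - vb); nra.
have b4 : Rabs (y - v) * (Rabs (g u v) + 1) <= eps / 2.
  apply: (Rle_trans _ (eps / 2 / (Rabs (g u v) + 1) * (Rabs (g u v) + 1))).
    by apply: Rmult_le_compat_r; lra.
  by right; field; lra.
apply: Rle_lt_trans (Rplus_le_compat _ _ _ _ b1 b2) _; lra.
Qed.

Hypothesis dg : forall u v, B (u, v) -> ex_derive (fun x => g x v) u.
Hypothesis cdg : cont_on B (du g).

Lemma RInt_param_du u v : B (u, v) ->
  is_derive (fun x => RInt (fun t => g x t) vb v) u
    (RInt (fun t => du g u t) vb v).
Proof.
move=> [/= hu hv].
have loc : locally u (fun x => Rabs (x - u0) < r).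
  have [d Hd] := box_open u0 v0 r (u, v) (conj hu hv).
  exists d => y hy; case: (Hd (y, v)) => //; split=> //=; exact: ball_center.
apply: (is_derive_RInt_param g vb v u).
- apply: filter_imp loc => x hx t ht; apply: dg; split=> //=; exact: between_in ht.
- move=> t ht; apply: cdg; split=> //=; exact: between_in ht.
- by apply: filter_imp loc => x hx; exact: ex_RInt_slice.
Qed.

End Param.

(** * Local solutions of flat linear systems *)

Definition act (N : nat) (P : nat -> nat -> R -> R -> R) (y : nat -> R -> R -> R)
    (i : nat) (u v : R) : R :=
  sum_f_R0 (fun j => P i j u v * y j u v) N.

Definition is_sol (N : nat) (P Q : nat -> nat -> R -> R -> R)
    (D : R * R -> Prop) (y : nat -> R -> R -> R) : Prop :=
  forall u v, D (u, v) -> forall i, (i <= N)%nat ->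
    continuity_2d_pt (y i) u v /\
    is_derive (fun x => y i x v) u (act N P y i u v) /\
    is_derive (fun t => y i u t) v (act N Q y i u v).

Definition smooth_matrix (N : nat) (D : R * R -> Prop)
    (P : nat -> nat -> R -> R -> R) : Prop :=
  forall i j, (i <= N)%nat -> (j <= N)%nat -> smooth D (P i j).

(** Curvature of the connection [d - P du - Q dv]. *)
Definition curv (N : nat) (P Q : nat -> nat -> R -> R -> R) (i j : nat) (u v : R) : R :=
  dv (P i j) u v - du (Q i j) u v +
  sum_f_R0 (fun k => P i k u v * Q k j u v - Q i k u v * P k j u v) N.

Definition flat (N : nat) (D : R * R -> Prop) (P Q : nat -> nat -> R -> R -> R) : Prop :=
  forall u v, D (u, v) -> forall i j, (i <= N)%nat -> (j <= N)%nat ->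
    curv N P Q i j u v = 0.

Lemma geometric_limit (a : nat -> R) m :
  (forall n, Rabs (a (S n) - a n) <= m * (/ 2) ^ n) ->
  exists l, is_lim_seq a l /\ forall n, Rabs (a n - l) <= 2 * m * (/ 2) ^ n.
Proof.
move=> H.
have h2 : Rabs (/ 2) < 1 by rewrite Rabs_pos_eq; lra.
have sb n : is_series (fun k => m * (/ 2) ^ (n + k)) (2 * m * (/ 2) ^ n).
  replace (2 * m * (/ 2) ^ n) with (scal (m * (/ 2) ^ n) (/ (1 - / 2)))
    by (rewrite /scal /= /mult /=; field).
  apply: is_series_ext (is_series_scal (m * (/ 2) ^ n) _ _ (is_series_geom _ h2)) => k.
  by rewrite /scal /= /mult /= pow_add; ring.
have ex n : ex_series (fun k => a (S (n + k)) - a (n + k)%nat).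
  apply: (ex_series_le (V := R_CompleteNormedModule) _ (fun k => m * (/ 2) ^ (n + k))).
    by move=> k; exact: H.
  by exists (2 * m * (/ 2) ^ n).
have tel n k : sum_n (fun k => a (S (n + k)) - a (n + k)%nat) k = a (S (n + k)) - a n.
  elim: k => [|k IH]; first by rewrite sum_O Nat.add_0_r.
  by rewrite sum_Sn IH /plus /= Nat.add_succ_r; ring.
have lim n : is_lim_seq a (Series (fun k => a (S (n + k)) - a (n + k)%nat) + a n).
  have h := Series_correct _ (ex n).
  apply/(is_lim_seq_incr_n a (S n)).
  apply: is_lim_seq_ext (is_lim_seq_plus' _ _ _ _ h (is_lim_seq_const (a n))) => k.
  by rewrite tel; replace (k + S n)%nat with (S (n + k)) by lia; ring.
exists (Series (fun k => a (S (0 + k)) - a (0 + k)%nat) + a 0%nat); split; first exact: lim.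
move=> n.
have /Rbar_finite_eq -> : Finite (Series (fun k => a (S (0 + k)) - a (0 + k)%nat) + a 0%nat) =
    Finite (Series (fun k => a (S (n + k)) - a (n + k)%nat) + a n).
  by rewrite -(is_lim_seq_unique _ _ (lim 0%nat)) -(is_lim_seq_unique _ _ (lim n)).
rewrite Rabs_minus_sym.
rewrite (_ : forall x, x + a n - a n = x); last by move=> x; ring.
apply: (Rle_trans _ (Series (fun k => Rabs (a (S (n + k)) - a (n + k)%nat)))).
  apply: Series_Rabs.
  apply: (ex_series_le (V := R_CompleteNormedModule) _ (fun k => m * (/ 2) ^ (n + k))).
    by move=> k; rewrite /norm /= /abs /= Rabs_Rabsolu; exact: H.
  by exists (2 * m * (/ 2) ^ n).
rewrite -(is_series_unique _ _ (sb n)).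
apply: Series_le => [k|]; last by exists (2 * m * (/ 2) ^ n).
by split; [exact: Rabs_pos|exact: H].
Qed.

Lemma half_pow_small (e m : R) : 0 < e ->
  exists n0, forall n, (n0 <= n)%nat -> m * (/ 2) ^ n < e.
Proof.
move=> he.
have h2 : Rabs (/ 2) < 1 by rewrite Rabs_pos_eq; lra.
have := is_lim_seq_scal_l _ m _ (is_lim_seq_geom _ h2).
rewrite /Rbar_mult /= Rmult_0_r => /is_lim_seq_spec L.
have [n0 H] := L (mkposreal e he).
exists n0 => n hn; have /= := H n hn; rewrite Rminus_0_r.
by move/Rabs_def2; lra.
Qed.

(** The two second-order expressions obtained by differentiating [y_u = P y] and
    [y_v = Q y] crosswise differ by the curvature. *)
Lemma curv_act N P Q i y u v :
  sum_f_R0 (fun j => (dv (P i j) u v - du (Q i j) u v) * y j u v) N +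
  sum_f_R0 (fun j => P i j u v * act N Q y j u v) N -
  sum_f_R0 (fun j => Q i j u v * act N P y j u v) N =
  sum_f_R0 (fun j => curv N P Q i j u v * y j u v) N.
Proof.
have E T U : sum_f_R0 (fun j => T i j u v * act N U y j u v) N =
    sum_f_R0 (fun k => sum_f_R0 (fun j => T i j u v * U j k u v) N * y k u v) N.
  rewrite (sum_f_R0_ext N _ (fun j => sum_f_R0 (fun k => T i j u v * U j k u v * y k u v) N)).
    rewrite sum_f_R0_swap; apply: sum_f_R0_ext => k _.
    by rewrite Rmult_comm sum_f_R0_mult_l; apply: sum_f_R0_ext => j _; ring.
  by move=> j _; rewrite sum_f_R0_mult_l; apply: sum_f_R0_ext => k _; ring.
rewrite !E -sum_plus -minus_sum; apply: sum_f_R0_ext => j _.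
by rewrite /curv minus_sum; ring.
Qed.

Lemma is_derive_geometric_limit (fn : nat -> R -> R) (f d : R -> R) a r M :
  (forall n x, Rabs (x - a) < r -> ex_derive (fn n) x) ->
  (forall n x, Rabs (x - a) < r -> continuous (Derive (fn n)) x) ->
  (forall n x, Rabs (x - a) < r -> Rabs (fn n x - f x) <= M * (/ 2) ^ n) ->
  (forall n x, Rabs (x - a) < r -> Rabs (Derive (fn n) x - d x) <= M * (/ 2) ^ n) ->
  forall x, Rabs (x - a) < r -> is_derive f x (d x).
Proof.
move=> H1 H2 H3 H4 x hx.
have lim (g : nat -> R) l : (forall n, Rabs (g n - l) <= M * (/ 2) ^ n) -> Lim_seq g = l.
  move=> H; apply: is_lim_seq_unique; apply/is_lim_seq_spec => eps.
  have [n0 Hn] := half_pow_small eps M (cond_pos eps).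
  exists n0 => n hn; exact: Rle_lt_trans (H n) (Hn n hn).
have oD : open (fun x => Rabs (x - a) < r).
  move=> y hy; have h : 0 < r - Rabs (y - a) by lra.
  exists (mkposreal _ h) => z; rewrite /ball /= /AbsRing_ball /abs /minus /plus /opp /= => hz.
  have := Rabs_triang (z - y) (y - a).
  replace (z - y + (y - a)) with (z - a) by ring; rewrite /Rminus; rewrite /Rminus in h hz; lra.
have cvu (g : nat -> R -> R) (l : R -> R) :
    (forall n x, Rabs (x - a) < r -> Rabs (g n x - l x) <= M * (/ 2) ^ n) ->
    CVU_dom g (fun x => Rabs (x - a) < r).
  move=> H eps; have [n0 Hn] := half_pow_small eps M (cond_pos eps).
  exists n0 => n hn y hy; rewrite (lim (fun n => g n y) (l y)); last by move=> k; exact: H.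
  exact: Rle_lt_trans (H n y hy) (Hn n hn).
have := CVU_Derive fn _ oD.
move=> /(_ _ (cvu fn f H3) H1 _ (cvu (fun n => Derive (fn n)) d H4) x hx).
have -> : Lim_seq (fun n => Derive (fn n) x) = d x by apply: lim => n; exact: H4.
move=> H; apply: is_derive_ext_loc (H _ _).
- apply: filter_imp (oD x hx) => y hy; rewrite (lim (fun n => fn n y) (f y)) // => n.
  exact: H3.
- move=> y z t hy hz ht; move/Rabs_def2: hy => hy; move/Rabs_def2: hz => hz.
  by apply: Rabs_def1; lra.
- by move=> n y hy; apply/continuity_pt_filterlim; exact: H2.
Qed.

Section Picard.

Variables (N : nat) (u0 v0 r : R) (P Q : nat -> nat -> R -> R -> R).
Let B := box u0 v0 r.
Hypothesis sP : smooth_matrix N B P.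
Hypothesis sQ : smooth_matrix N B Q.
Hypothesis fl : flat N B P Q.
Variables (ub vb : R) (w : nat -> R).
Hypothesis hb : B (ub, vb).

Let oB : open B := box_open u0 v0 r.
Let hub : Rabs (ub - u0) < r := proj1 hb.
Let hvb : Rabs (vb - v0) < r := proj2 hb.

(** The integrals run along the horizontal line through the base point and then
    vertically.  Hence each iterate has the [v]-derivative prescribed by its
    predecessor exactly, and only the equation in the direction of [u] needs
    the flatness of the system. *)
Fixpoint picard (n i : nat) (u v : R) : R :=
  match n with
  | O => w i
  | S n => w i + RInt (fun x => act N P (picard n) i x vb) ub u
               + RInt (fun t => act N Q (picard n) i u t) vb v
  end.

Definition C1u (g : R -> R -> R) :=
  cont_on B g /\ (forall u v, B (u, v) -> ex_derive (fun x => g x v) u) /\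
  cont_on B (du g).

Lemma smooth_C1u g : smooth B g -> C1u g.
Proof.
move=> Hg; split; [|split] => u v h.
- exact: smooth_cont h.
- exact: smooth_ex_u h.
- by apply: (smooth_cont B) => //; exact: smooth_du.
Qed.

Lemma C1u_mult f g : C1u f -> C1u g -> C1u (fun u v => f u v * g u v).
Proof.
move=> [cf [df cdf]] [cg [dg cdg]]; split; [|split] => u v h.
- by apply: continuity_2d_pt_mult; auto.
- by apply: ex_derive_mult; auto.
- apply: (continuity_2d_pt_ext_loc (fun x y => du f x y * g x y + f x y * du g x y)).
    apply: (agree_locally B oB) h => x y hx.
    by rewrite /du Derive_mult; auto.
  by apply: continuity_2d_pt_plus; apply: continuity_2d_pt_mult; auto.
Qed.

Lemma C1u_plus f g : C1u f -> C1u g -> C1u (fun u v => f u v + g u v).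
Proof.
move=> [cf [df cdf]] [cg [dg cdg]]; split; [|split] => u v h.
- by apply: continuity_2d_pt_plus; auto.
- by apply: @ex_derive_plus; [exact: df|exact: dg].
- apply: (continuity_2d_pt_ext_loc (fun x y => du f x y + du g x y)).
    apply: (agree_locally B oB) h => x y hx.
    by rewrite /du Derive_plus; auto.
  by apply: continuity_2d_pt_plus; auto.
Qed.

Lemma C1u_sum M f : (forall j, (j <= M)%nat -> C1u (f j)) ->
  C1u (fun u v => sum_f_R0 (fun j => f j u v) M).
Proof.
elim: M => [|M IH] H /=; first exact: H.
apply: (C1u_plus (fun u v => sum_f_R0 (fun j => f j u v) M)); last exact: H.
by apply: IH => j hj; apply: H; lia.
Qed.

Lemma C1u_act T y i : smooth_matrix N B T -> (i <= N)%nat ->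
  (forall j, (j <= N)%nat -> C1u (y j)) -> C1u (act N T y i).
Proof.
move=> sT hi hy; apply: C1u_sum => j hj.
by apply: C1u_mult; [apply: smooth_C1u; exact: sT|exact: hy].
Qed.

Lemma axis_integral g u : cont_on B g -> Rabs (u - u0) < r ->
  is_derive (fun x => RInt (fun s => g s vb) ub x) u (g u vb).
Proof.
move=> cg hu.
apply: (RInt_param_dv v0 u0 r ub hub (fun y x => g x y)) => //.
move=> x y [/= hx hy] eps; have [d Hd] := cg y x (conj hy hx) eps.
by exists d => x' y' hx' hy'; exact: Hd.
Qed.

Lemma picard_dv n i u v : (forall j, (j <= N)%nat -> C1u (picard n j)) ->
  (i <= N)%nat -> B (u, v) ->
  is_derive (fun t => picard (S n) i u t) v (act N Q (picard n) i u v).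
Proof.
move=> H hi h; have [c _] := C1u_act Q _ _ sQ hi H.
rewrite -[X in is_derive _ _ X]Rplus_0_l.
apply: @is_derive_plus; first exact: is_derive_const.
exact: (RInt_param_dv u0 v0 r vb hvb).
Qed.

Lemma picard_du n i u v : (forall j, (j <= N)%nat -> C1u (picard n j)) ->
  (i <= N)%nat -> B (u, v) ->
  is_derive (fun x => picard (S n) i x v) u
    (act N P (picard n) i u vb + RInt (fun t => du (act N Q (picard n) i) u t) vb v).
Proof.
move=> H hi h; have [c [d cd]] := C1u_act Q _ _ sQ hi H.
have [c' _] := C1u_act P _ _ sP hi H.
apply: @is_derive_plus; last exact: (RInt_param_du u0 v0 r vb hvb).
rewrite -[X in is_derive _ _ X]Rplus_0_l.
apply: @is_derive_plus; first exact: is_derive_const.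
by apply: axis_integral => //; case: h.
Qed.

Lemma picard_C1u n i : (i <= N)%nat -> C1u (picard n i).
Proof.
elim: n i => [|n IH] i hi.
  by apply: smooth_C1u; exact: smooth_const.
have [c [d cd]] := C1u_act Q _ _ sQ hi IH.
have [c' _] := C1u_act P _ _ sP hi IH.
split; [|split] => u v h.
- apply: continuity_2d_pt_plus; last exact: (RInt_param_cont u0 v0 r vb hvb).
  apply: continuity_2d_pt_plus; first exact: continuity_2d_pt_const.
  apply: (continuity_1d_2d_pt_comp (fun x => RInt (fun x0 => act N P (picard n) i x0 vb) ub x)
    (fun x _ => x)); last exact: continuity_2d_pt_id1.
  apply/continuity_pt_filterlim; apply: ex_derive_continuous.
  by exists (act N P (picard n) i u vb); apply: axis_integral => //; case: h.
- by eexists; apply: picard_du.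
- apply: (continuity_2d_pt_ext_loc (fun x y => act N P (picard n) i x vb +
      RInt (fun t => du (act N Q (picard n) i) x t) vb y)).
    apply: (agree_locally B oB) h => x y hx.
    by symmetry; apply: is_derive_unique; exact: picard_du.
  apply: continuity_2d_pt_plus; last exact: (RInt_param_cont u0 v0 r vb hvb).
  apply: (continuity_1d_2d_pt_comp (fun x => act N P (picard n) i x vb)
    (fun x _ => x)); last exact: continuity_2d_pt_id1.
  apply/continuity_pt_filterlim; apply: continuity_2d_slice_u; apply: c'.
  by split; [case: h|].
Qed.

Definition defect n i u v := du (picard n i) u v - act N P (picard n) i u v.

Lemma defect_cont n i : (i <= N)%nat -> cont_on B (defect n i).
Proof.
move=> hi u v h; apply: continuity_2d_pt_minus.
- by have [_ [_ c]] := picard_C1u n i hi; exact: c.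
- by have [c _] := C1u_act P _ _ sP hi (picard_C1u n); exact: c.
Qed.

Lemma du_act T y i u v : smooth_matrix N B T -> (i <= N)%nat -> B (u, v) ->
  (forall j, (j <= N)%nat -> ex_derive (fun x => y j x v) u) ->
  du (act N T y i) u v =
  sum_f_R0 (fun j => du (T i j) u v * y j u v + T i j u v * du (y j) u v) N.
Proof.
move=> sT hi h hy; apply: is_derive_unique.
apply: (is_derive_sum N (fun j x => T i j x v * y j x v)) => j hj.
have hT : ex_derive (fun x => T i j x v) u by apply: smooth_ex_u h; exact: sT.
have -> : du (T i j) u v * y j u v + T i j u v * du (y j) u v =
  plus (mult (Derive (fun x => T i j x v) u) (y j u v))
       (mult (T i j u v) (Derive (fun x => y j x v) u)) by [].
apply: (is_derive_mult (fun x => T i j x v) (fun x => y j x v)).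
- exact: Derive_correct.
- by apply: Derive_correct; exact: hy.
- exact: Rmult_comm.
Qed.

Lemma dv_act T y i u v : smooth_matrix N B T -> (i <= N)%nat -> B (u, v) ->
  (forall j, (j <= N)%nat -> ex_derive (fun x => y j u x) v) ->
  dv (act N T y i) u v =
  sum_f_R0 (fun j => dv (T i j) u v * y j u v + T i j u v * dv (y j) u v) N.
Proof.
move=> sT hi h hy; apply: is_derive_unique.
apply: (is_derive_sum N (fun j x => T i j u x * y j u x)) => j hj.
have hT : ex_derive (fun x => T i j u x) v by apply: smooth_ex_v h; exact: sT.
have -> : dv (T i j) u v * y j u v + T i j u v * dv (y j) u v =
  plus (mult (Derive (fun x => T i j u x) v) (y j u v))
       (mult (T i j u v) (Derive (fun x => y j u x) v)) by [].
apply: (is_derive_mult (fun x => T i j u x) (fun x => y j u x)).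
- exact: Derive_correct.
- by apply: Derive_correct; exact: hy.
- exact: Rmult_comm.
Qed.

Lemma act_minus T y z i u v :
  act N T y i u v - act N T z i u v = act N T (fun j u v => y j u v - z j u v) i u v.
Proof. by rewrite /act -minus_sum; apply: sum_f_R0_ext => j _; ring. Qed.

(** Flatness is what makes the defect of one iterate controlled by the defect
    of the previous one and by the distance between the two iterates. *)
Lemma defect_step n i u v : (i <= N)%nat -> B (u, v) ->
  defect (S n) i u v =
  act N P (fun j u v => picard n j u v - picard (S n) j u v) i u vb +
  RInt (fun t => act N Q (defect n) i u t +
    act N (fun i j => dv (P i j)) (fun j u v => picard n j u v - picard (S n) j u v) i u t)
    vb v.
Proof.
move=> hi h; have [/= hu hv] := h.
have C1 k j : (j <= N)%nat -> C1u (picard k j) by exact: picard_C1u.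
have cdP : cont_on B (fun u v => sum_f_R0 (fun j => dv (P i j) u v * picard (S n) j u v +
    P i j u v * act N Q (picard n) j u v) N).
  move=> x y hx; apply: continuity_2d_pt_sum => j hj.
  apply: continuity_2d_pt_plus; apply: continuity_2d_pt_mult.
  + apply: (smooth_cont B) hx; apply: smooth_dv; exact: sP.
  + by have [c _] := C1 (S n) j hj; exact: c.
  + apply: (smooth_cont B) hx; exact: sP.
  + by have [c _] := C1u_act Q _ _ sQ hj (C1 n); exact: c.
have cQ : cont_on B (du (act N Q (picard n) i)).
  by have [_ [_ c]] := C1u_act Q _ _ sQ hi (C1 n).
have dP x t : B (x, t) -> dv (act N P (picard (S n)) i) x t =
    sum_f_R0 (fun j => dv (P i j) x t * picard (S n) j x t +
    P i j x t * act N Q (picard n) j x t) N.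
  move=> hx; rewrite dv_act //.
    apply: sum_f_R0_ext => j hj; congr (_ + _ * _).
    by apply: is_derive_unique; apply: picard_dv => // k; exact: C1.
  by move=> j hj; eexists; apply: picard_dv => // k; exact: C1.
have eP : RInt (fun t => sum_f_R0 (fun j => dv (P i j) u t * picard (S n) j u t +
    P i j u t * act N Q (picard n) j u t) N) vb v =
    act N P (picard (S n)) i u v - act N P (picard (S n)) i u vb.
  apply: is_RInt_unique; apply: (is_RInt_derive (fun t => act N P (picard (S n)) i u t)).
    move=> t ht; have hx : B (u, t) by split=> //=; exact: between_in ht.
    rewrite -dP //; apply: Derive_correct.
    apply: (ex_derive_ext (fun t => sum_f_R0 (fun j => P i j u t * picard (S n) j u t) N)) => //.
    eexists; apply: (is_derive_sum N (fun j t => P i j u t * picard (S n) j u t)) => j hj.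
    apply: Derive_correct; apply: ex_derive_mult.
      by apply: smooth_ex_v hx; exact: sP.
    by eexists; apply: picard_dv => // k; exact: C1.
  move=> t ht; have hx : B (u, t) by split=> //=; exact: between_in ht.
  exact: continuity_2d_slice_v (cdP _ _ hx).
rewrite /defect.
have -> : du (picard (S n) i) u v = act N P (picard n) i u vb +
    RInt (fun t => du (act N Q (picard n) i) u t) vb v.
  by apply: is_derive_unique; apply: picard_du => // k; exact: C1.
have -> : act N P (picard (S n)) i u v = act N P (picard (S n)) i u vb +
    RInt (fun t => sum_f_R0 (fun j => dv (P i j) u t * picard (S n) j u t +
    P i j u t * act N Q (picard n) j u t) N) vb v by rewrite eP; ring.
rewrite -act_minus.
rewrite (_ : forall a b c d, a + b - (c + d) = a - c + (b - d)); last by move=> *; ring.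
congr (_ + _).
rewrite -[LHS](RInt_minus (fun t => du (act N Q (picard n) i) u t)
  (fun t => sum_f_R0 (fun j => dv (P i j) u t * picard (S n) j u t +
    P i j u t * act N Q (picard n) j u t) N)); [|
  exact: (ex_RInt_slice u0 v0 r _ cQ)|exact: (ex_RInt_slice u0 v0 r _ cdP)].
apply: RInt_ext => t ht; rewrite /minus /plus /opp /=.
have hx : B (u, t).
  by split=> //=; apply: (between_in _ _ _ _ _ hvb hv); lra.
rewrite du_act //; last by move=> j hj; have [_ [d _]] := C1 n j hj; exact: d.
have := curv_act N P Q i (picard n) u t.
rewrite [X in _ = X -> _]sum_f_R0_0; last by move=> j hj; rewrite fl // Rmult_0_l.
rewrite -sum_plus -minus_sum => E.
have -> : act N Q (defect n) i u t + act N (fun i j => dv (P i j))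
      (fun j u v => picard n j u v - picard (S n) j u v) i u t =
    sum_f_R0 (fun j => Q i j u t * (du (picard n j) u t - act N P (picard n) j u t) +
      dv (P i j) u t * (picard n j u t - picard (S n) j u t)) N by rewrite sum_plus.
apply: Rminus_diag_uniq_sym.
rewrite -[RHS]E -/(Rminus _ _) -!minus_sum.
by apply: sum_f_R0_ext => j hj /=; ring.
Qed.

Variables (C m : R).
Let K := INR (S N) * C.
Hypothesis hC : 0 <= C.
Hypothesis hm : 0 <= m.
Hypothesis bP : forall u v, B (u, v) -> forall i j, (i <= N)%nat -> (j <= N)%nat ->
  Rabs (P i j u v) <= C.
Hypothesis bQ : forall u v, B (u, v) -> forall i j, (i <= N)%nat -> (j <= N)%nat ->
  Rabs (Q i j u v) <= C.
Hypothesis bdP : forall u v, B (u, v) -> forall i j, (i <= N)%nat -> (j <= N)%nat ->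
  Rabs (dv (P i j) u v) <= C.
Hypothesis bw : forall j, (j <= N)%nat -> Rabs (w j) <= m.
(* A segment in the square has length at most 2 r, so one step of the iteration
   along two segments contracts by 4 K r.  The second bound on r makes the
   integral of the term with the derivative of P at most K m / 2^n. *)
Hypothesis hr : 8 * K * r <= 1.
Hypothesis hr2 : r <= / 2.

Let hK : 0 <= K.
Proof. by apply: Rmult_le_pos => //; exact: pos_INR. Qed.

Lemma act_bound T y i u v M : (i <= N)%nat ->
  (forall j, (j <= N)%nat -> Rabs (T i j u v) <= C) ->
  (forall j, (j <= N)%nat -> Rabs (y j u v) <= M) ->
  Rabs (act N T y i u v) <= K * M.
Proof. by move=> hi h1 h2; exact: sum_f_R0_dot_bound. Qed.

Lemma dist_in_box x a c : Rabs (x - c) < r -> Rabs (a - c) < r -> Rabs (x - a) <= 2 * r.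
Proof. by move=> /Rabs_def2 h1 /Rabs_def2 h2; apply: Rabs_le; lra. Qed.

Lemma RInt_box_bound_v g u v M : cont_on B g -> B (u, v) -> 0 <= M ->
  (forall t, Rabs (t - v0) < r -> Rabs (g u t) <= M) ->
  Rabs (RInt (fun t => g u t) vb v) <= 2 * r * M.
Proof.
move=> cg [/= hu hv] hM H.
apply: Rle_trans (RInt_bound _ _ _ M _ _) _.
- exact: (ex_RInt_slice u0 v0 r g cg).
- by move=> t ht; apply: H; exact: between_in ht.
- by apply: Rmult_le_compat_r => //; exact: dist_in_box hv hvb.
Qed.

Lemma RInt_box_bound_u g u M : cont_on B g -> Rabs (u - u0) < r -> 0 <= M ->
  (forall x, Rabs (x - u0) < r -> Rabs (g x vb) <= M) ->
  Rabs (RInt (fun x => g x vb) ub u) <= 2 * r * M.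
Proof.
move=> cg hu hM H.
apply: Rle_trans (RInt_bound _ _ _ M _ _) _.
- apply: ex_RInt_continuous => x hx; apply: continuity_2d_slice_u; apply: cg.
  by split=> //=; exact: between_in hx.
- by move=> t ht; apply: H; exact: between_in ht.
- by apply: Rmult_le_compat_r => //; exact: dist_in_box hu hub.
Qed.

Lemma cont_on_act_minus T n k i : smooth_matrix N B T -> (i <= N)%nat ->
  cont_on B (act N T (fun j u v => picard n j u v - picard k j u v) i).
Proof.
move=> sT hi u v h; apply: continuity_2d_pt_sum => j hj.
apply: continuity_2d_pt_mult; first by apply: (smooth_cont B) h; exact: sT.
by apply: continuity_2d_pt_minus; [have [c _] := picard_C1u n j hj|
  have [c _] := picard_C1u k j hj]; exact: c.
Qed.

Let pow2_pos n : 0 < (/ 2) ^ n.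
Proof. by apply: pow_lt; lra. Qed.

Lemma picard_step n : forall i u v, (i <= N)%nat -> B (u, v) ->
  Rabs (picard (S n) i u v - picard n i u v) <= m * (/ 2) ^ n.
Proof.
have C1 k j : (j <= N)%nat -> C1u (picard k j) by exact: picard_C1u.
elim: n => [|n IH] i u v hi h; have [/= hu hv] := h.
  rewrite (_ : forall a b c, a + b + c - a = b + c); last by move=> *; ring.
  apply: Rle_trans (Rabs_triang _ _) _; rewrite /= Rmult_1_r.
  have b1 := RInt_box_bound_u (act N P (fun j _ _ => w j) i) u (K * m).
  have b2 := RInt_box_bound_v (act N Q (fun j _ _ => w j) i) u v (K * m).
  have c1 := C1u_act P (fun j _ _ => w j) i sP hi (C1 0%nat).
  have c2 := C1u_act Q (fun j _ _ => w j) i sQ hi (C1 0%nat).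
  apply: Rle_trans (Rplus_le_compat _ _ _ _ (b1 _ hu _ _) (b2 _ h _ _)) _.
  - by case: c1.
  - by apply: Rmult_le_pos.
  - by move=> x hx; apply: act_bound => // j hj; apply: bP.
  - by case: c2.
  - by apply: Rmult_le_pos.
  - by move=> x hx; apply: act_bound => // j hj; apply: bQ.
  - have : 8 * K * r * m <= 1 * m by exact: Rmult_le_compat_r.
    lra.
have hM : 0 <= K * (m * (/ 2) ^ n).
  by apply: Rmult_le_pos => //; apply: Rmult_le_pos => //; apply: Rlt_le.
set D := fun j u v => picard (S n) j u v - picard n j u v.
have ex_u k : ex_RInt (fun x => act N P (picard k) i x vb) ub u.
  apply: ex_RInt_continuous => x hx; apply: continuity_2d_slice_u.
  have [c _] := C1u_act P _ _ sP hi (C1 k); apply: c.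
  by split=> //=; exact: between_in hx.
have ex_v k : ex_RInt (fun t => act N Q (picard k) i u t) vb v.
  by have [c _] := C1u_act Q _ _ sQ hi (C1 k); exact: (ex_RInt_slice u0 v0 r _ c).
have -> : picard (S (S n)) i u v - picard (S n) i u v =
    RInt (fun x => act N P D i x vb) ub u + RInt (fun t => act N Q D i u t) vb v.
  have E k : picard (S k) i u v = w i + RInt (fun x => act N P (picard k) i x vb) ub u
      + RInt (fun t => act N Q (picard k) i u t) vb v by [].
  have -> : RInt (fun x => act N P D i x vb) ub u =
      RInt (fun x => act N P (picard (S n)) i x vb) ub u -
      RInt (fun x => act N P (picard n) i x vb) ub u.
    rewrite -[RHS](RInt_minus (fun x => act N P (picard (S n)) i x vb)
      (fun x => act N P (picard n) i x vb)) //.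
    by apply: RInt_ext => x _; rewrite -act_minus.
  have -> : RInt (fun t => act N Q D i u t) vb v =
      RInt (fun t => act N Q (picard (S n)) i u t) vb v -
      RInt (fun t => act N Q (picard n) i u t) vb v.
    rewrite -[RHS](RInt_minus (fun t => act N Q (picard (S n)) i u t)
      (fun t => act N Q (picard n) i u t)) //.
    by apply: RInt_ext => x _; rewrite -act_minus.
  by rewrite (E (S n)) (E n); ring.
apply: Rle_trans (Rabs_triang _ _) _.
have b1 := RInt_box_bound_u (act N P D i) u (K * (m * (/ 2) ^ n)).
have b2 := RInt_box_bound_v (act N Q D i) u v (K * (m * (/ 2) ^ n)).
apply: Rle_trans (Rplus_le_compat _ _ _ _ (b1 _ hu _ _) (b2 _ h _ _)) _ => //.
- exact: cont_on_act_minus.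
- move=> x hx; apply: act_bound => // j hj; first exact: bP.
  exact: IH.
- exact: cont_on_act_minus.
- move=> x hx; apply: act_bound => // j hj; first exact: bQ.
  exact: IH.
- have : 8 * K * r * (m * (/ 2) ^ n) <= 1 * (m * (/ 2) ^ n).
    by apply: Rmult_le_compat_r => //; apply: Rmult_le_pos => //; apply: Rlt_le.
  by move=> /=; lra.
Qed.

Lemma defect_bound n : forall i u v, (i <= N)%nat -> B (u, v) ->
  Rabs (defect n i u v) <= 8 * K * m * (/ 2) ^ n.
Proof.
have hKm : 0 <= K * m by exact: Rmult_le_pos.
have rpos : 0 <= r by have := Rabs_pos (ub - u0); lra.
elim: n => [|n IH] i u v hi h; have [/= hu hv] := h.
  rewrite /defect (du_const (w i)) Rminus_0_l Rabs_Ropp.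
  apply: Rle_trans (_ : K * m <= _); last lra.
  by apply: act_bound => // j hj; exact: bP.
have p := Rlt_le _ _ (pow2_pos n).
set q := (/ 2) ^ n in p IH *.
have hmq : 0 <= m * q by exact: Rmult_le_pos.
have hKmq : 0 <= K * (m * q) by exact: Rmult_le_pos.
have st j x y : (j <= N)%nat -> B (x, y) ->
    Rabs (picard n j x y - picard (S n) j x y) <= m * q.
  by move=> hj hx; rewrite Rabs_minus_sym; exact: picard_step.
rewrite defect_step //.
apply: Rle_trans (Rabs_triang _ _) _.
have b1 : Rabs (act N P (fun j u v => picard n j u v - picard (S n) j u v) i u vb) <= K * (m * q).
  have hx : B (u, vb) by [].
  apply: act_bound => // j hj; first exact: bP.
  exact: st.
have sdP : smooth_matrix N B (fun i j => dv (P i j)).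
  by move=> i' j hi' hj; apply: smooth_dv; exact: sP.
have b2 := RInt_box_bound_v (fun u t => act N Q (defect n) i u t +
    act N (fun i j => dv (P i j)) (fun j u v => picard n j u v - picard (S n) j u v) i u t)
    u v (K * (8 * K * m * q) + K * (m * q)).
apply: Rle_trans (Rplus_le_compat _ _ _ _ b1 (b2 _ h _ _)) _.
- move=> x y hx; apply: continuity_2d_pt_plus; last exact: cont_on_act_minus.
  apply: continuity_2d_pt_sum => j hj; apply: continuity_2d_pt_mult.
    by apply: (smooth_cont B) hx; exact: sQ.
  exact: defect_cont.
- apply: Rplus_le_le_0_compat => //; apply: Rmult_le_pos => //.
  by replace (8 * K * m * q) with (8 * (K * (m * q))) by ring; lra.
- move=> t ht; have hx : B (u, t) by [].
  apply: Rle_trans (Rabs_triang _ _) _; apply: Rplus_le_compat.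
    apply: act_bound => // j hj; first exact: bQ.
    exact: IH.
  apply: act_bound => // j hj; first exact: bdP.
  exact: st.
- have e1 : 8 * K * r * (K * (m * q)) <= 1 * (K * (m * q)) by exact: Rmult_le_compat_r.
  have e2 : r * (K * (m * q)) <= / 2 * (K * (m * q)) by exact: Rmult_le_compat_r.
  rewrite /= -/q; lra.
Qed.

(** The iterates and the terms of both equations converge geometrically and
    uniformly, the first equation because the defects tend to zero; so the limit
    may be differentiated under the limit sign. *)
Lemma picard_limit :
  exists y, is_sol N P Q B y /\ forall i, (i <= N)%nat -> y i ub vb = w i.
Proof.
have C1 k j : (j <= N)%nat -> C1u (picard k j) by exact: picard_C1u.
pose y i u v := real (Lim_seq (fun n => picard n i u v)).
have cv n i u v : (i <= N)%nat -> B (u, v) ->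
    Rabs (picard n i u v - y i u v) <= 2 * m * (/ 2) ^ n.
  move=> hi h; have [l [L H]] := geometric_limit (fun n => picard n i u v) m
    (fun n => picard_step n i u v hi h).
  by rewrite /y (is_lim_seq_unique _ _ L).
have hKm : 0 <= K * m by exact: Rmult_le_pos.
have cva T n i u v : (i <= N)%nat -> B (u, v) ->
    (forall j, (j <= N)%nat -> Rabs (T i j u v) <= C) ->
    Rabs (act N T (picard n) i u v - act N T y i u v) <= K * (2 * m * (/ 2) ^ n).
  move=> hi h hT; rewrite act_minus; apply: act_bound => // j hj.
  exact: cv.
exists y; split; last first.
  move=> i hi; rewrite /y (Lim_seq_ext _ (fun _ => w i)) ?Lim_seq_const // => n.
  case: n => [|n] //=.
  by rewrite !RInt_point /zero /= !Rplus_0_r.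
move=> u v h i hi; have [/= hu hv] := h; split; [|split].
- move=> eps; have e3 : 0 < eps / 3 by have := cond_pos eps; lra.
  have [n0 Hn] := half_pow_small (eps / 3) (2 * m) e3.
  have [c _] := C1 n0 i hi.
  apply: locally_2d_impl (c u v h (mkposreal _ e3)).
  apply: locally_2d_impl (open_locally_2d B oB u v h).
  apply: locally_2d_forall => x t hx /= hc.
  have b1 := Rle_lt_trans _ _ _ (cv n0 i u v hi h) (Hn n0 (Nat.le_refl _)).
  have b2 := Rle_lt_trans _ _ _ (cv n0 i x t hi hx) (Hn n0 (Nat.le_refl _)).
  by apply: Rabs_def1; move/Rabs_def2: hc; move/Rabs_def2: b1; move/Rabs_def2: b2; lra.
- apply: (is_derive_geometric_limit (fun n x => picard n i x v) (fun x => y i x v)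
    (fun x => act N P y i x v) u0 r (10 * (K * m) + 2 * m)) => // n x hx;
    have hB : B (x, v) by [].
  + by have [_ [d _]] := C1 n i hi; exact: d.
  + by apply: (continuity_2d_slice_u (du (picard n i))); have [_ [_ c]] := C1 n i hi; exact: c.
  + apply: Rle_trans (cv n i x v hi hB) _; apply: Rmult_le_compat_r; last lra.
    exact: Rlt_le.
  + replace (_ - _) with (defect n i x v + (act N P (picard n) i x v - act N P y i x v))
      by (rewrite /defect /du; ring).
    apply: Rle_trans (Rabs_triang _ _) _.
    have b1 := defect_bound n i x v hi hB.
    have b2 := cva P n i x v hi hB (fun j hj => bP x v hB i j hi hj).
    have : 0 <= 2 * m * (/ 2) ^ n.
      by apply: Rmult_le_pos; [lra|exact: Rlt_le].
    lra.
- apply: (is_derive_geometric_limit (fun n t => picard (S n) i u t) (fun t => y i u t)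
    (fun t => act N Q y i u t) v0 r (10 * (K * m) + 2 * m)) => // n x hx;
    have hB : B (u, x) by [].
  + by eexists; apply: picard_dv => // j; exact: C1.
  + apply: (continuous_ext_loc _ (fun t => act N Q (picard n) i u t)).
      apply: filter_imp (locally_2d_1d_const_x _ _ _ (open_locally_2d B oB u x hB)) => t ht.
      by symmetry; apply: is_derive_unique; apply: picard_dv => // j; exact: C1.
    apply: continuity_2d_slice_v.
    by have [c _] := C1u_act Q _ _ sQ hi (C1 n); exact: c.
  + apply: Rle_trans (cv (S n) i u x hi hB) _ => /=.
    have : 0 <= m * (/ 2) ^ n by apply: Rmult_le_pos => //; exact: Rlt_le.
    have : 0 <= K * m * (/ 2) ^ n by apply: Rmult_le_pos => //; exact: Rlt_le.
    lra.
  + have -> : Derive (fun t => picard (S n) i u t) x = act N Q (picard n) i u x.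
      by apply: is_derive_unique; apply: picard_dv => // j; exact: C1.
    apply: Rle_trans (cva Q n i u x hi hB (fun j hj => bQ u x hB i j hi hj)) _.
    have : 0 <= m * (/ 2) ^ n by apply: Rmult_le_pos => //; exact: Rlt_le.
    have : 0 <= K * m * (/ 2) ^ n by apply: Rmult_le_pos => //; exact: Rlt_le.
    lra.
Qed.

End Picard.

(** * Existence and uniqueness near a point *)

Lemma locally_bounded_family M (f : nat -> R -> R -> R) u v :
  (forall k, (k <= M)%nat -> exists C, locally_2d (fun x y => Rabs (f k x y) <= C) u v) ->
  exists C, locally_2d (fun x y => forall k, (k <= M)%nat -> Rabs (f k x y) <= C) u v.
Proof.
elim: M => [|M IH] H.
  have [C HC] := H 0%nat (Nat.le_refl _); exists C.
  apply: locally_2d_impl HC; apply: locally_2d_forall => x y h k hk.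
  by replace k with 0%nat by lia.
have [|C1 H1] := IH; first by move=> k hk; apply: H; lia.
have [C2 H2] := H (S M) (Nat.le_refl _).
exists (Rmax C1 C2); apply: locally_2d_impl H1; apply: locally_2d_impl H2.
apply: locally_2d_forall => x y h2 h1 k hk.
have [->|hk'] : k = S M \/ (k <= M)%nat by lia.
  exact: Rle_trans h2 (Rmax_r _ _).
exact: Rle_trans (h1 k hk') (Rmax_l _ _).
Qed.

Lemma locally_bounded_matrix N O T u v : open O -> smooth_matrix N O T -> O (u, v) ->
  exists C, locally_2d (fun x y => forall i j, (i <= N)%nat -> (j <= N)%nat ->
    Rabs (T i j x y) <= C) u v.
Proof.
move=> oO sT h.
have Hi i : (i <= N)%nat -> exists C, locally_2d (fun x y =>
    forall j, (j <= N)%nat -> Rabs (T i j x y) <= C) u v.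
  move=> hi; apply: locally_bounded_family => j hj.
  exists (Rabs (T i j u v) + 1).
  have c := smooth_cont O (T i j) u v (sT i j hi hj) h.
  apply: locally_2d_impl (c (mkposreal 1 Rlt_0_1)); apply: locally_2d_forall => x y /= hx.
  have := Rabs_triang (T i j x y - T i j u v) (T i j u v).
  by replace (T i j x y - T i j u v + T i j u v) with (T i j x y) by ring; lra.
elim: {1 3}N (Nat.le_refl N) => [|M IH] hM.
  have [C HC] := Hi 0%nat ltac:(lia); exists C.
  apply: locally_2d_impl HC; apply: locally_2d_forall => x y H i j hi hj.
  by replace i with 0%nat by lia; exact: H.
have [C1 H1] := IH ltac:(lia); have [C2 H2] := Hi (S M) hM.
exists (Rmax C1 C2); apply: locally_2d_impl H1; apply: locally_2d_impl H2.
apply: locally_2d_forall => x y h2 h1 i j hi hj.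
have [->|hi'] : i = S M \/ (i <= M)%nat by lia.
  exact: Rle_trans (h2 j hj) (Rmax_r _ _).
exact: Rle_trans (h1 i j hi' hj) (Rmax_l _ _).
Qed.

Lemma smooth_matrix_sub N (D D' : R * R -> Prop) T :
  (forall p, D' p -> D p) -> smooth_matrix N D T -> smooth_matrix N D' T.
Proof. by move=> s H i j hi hj n u v h; apply: H => //; exact: s. Qed.

(** The system is linear: the size of the square depends on bounds for the
    coefficients only, neither on the base point in the square nor on the
    prescribed value.  Continuation along paths relies on this uniformity. *)
Theorem flat_local_existence N O P Q u0 v0 : open O ->
  smooth_matrix N O P -> smooth_matrix N O Q -> flat N O P Q -> O (u0, v0) ->
  exists r, 0 < r /\ (forall p, box u0 v0 r p -> O p) /\
    forall ub vb w, box u0 v0 r (ub, vb) ->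
    exists y, is_sol N P Q (box u0 v0 r) y /\
      forall i, (i <= N)%nat -> y i ub vb = w i.
Proof.
move=> oO sP sQ fl h.
have sdP : smooth_matrix N O (fun i j => dv (P i j)).
  by move=> i j hi hj; apply: smooth_dv; exact: sP.
have [C1 H1] := locally_bounded_matrix _ _ _ _ _ oO sP h.
have [C2 H2] := locally_bounded_matrix _ _ _ _ _ oO sQ h.
have [C3 H3] := locally_bounded_matrix _ _ _ _ _ oO sdP h.
have [d Hd] := locally_2d_and _ _ _ _ (open_locally_2d O oO _ _ h)
  (locally_2d_and _ _ _ _ H1 (locally_2d_and _ _ _ _ H2 H3)).
set C := Rmax (Rmax C1 C2) (Rmax C3 0).
have [c1 [c2 [c3 c0]]] : C1 <= C /\ C2 <= C /\ C3 <= C /\ 0 <= C.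
  move: (Rmax_l (Rmax C1 C2) (Rmax C3 0)) (Rmax_r (Rmax C1 C2) (Rmax C3 0))
    (Rmax_l C1 C2) (Rmax_r C1 C2) (Rmax_l C3 0) (Rmax_r C3 0); rewrite -/C; lra.
have k0 : 0 <= INR (S N) * C by apply: Rmult_le_pos => //; exact: pos_INR.
set k := INR (S N) * C in k0 *.
pose r := Rmin d (Rmin (/ 2) (/ (8 * (k + 1)))).
have rd : r <= d by exact: Rmin_l.
have r2 : r <= / 2 by apply: Rle_trans (Rmin_r _ _) (Rmin_l _ _).
have r3 : r <= / (8 * (k + 1)) by apply: Rle_trans (Rmin_r _ _) (Rmin_r _ _).
have r0 : 0 < r.
  apply: Rmin_pos; first exact: cond_pos.
  by apply: Rmin_pos; [lra|apply: Rinv_0_lt_compat; lra].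
have r4 : 8 * k * r <= 1.
  apply: (Rle_trans _ (8 * k * / (8 * (k + 1)))).
    by apply: Rmult_le_compat_l; lra.
  apply: (Rmult_le_reg_r (k + 1)); first lra.
  by field_simplify; lra.
have sub u v : box u0 v0 r (u, v) -> O (u, v) /\
    (forall i j, (i <= N)%nat -> (j <= N)%nat -> Rabs (P i j u v) <= C) /\
    (forall i j, (i <= N)%nat -> (j <= N)%nat -> Rabs (Q i j u v) <= C) /\
    (forall i j, (i <= N)%nat -> (j <= N)%nat -> Rabs (dv (P i j) u v) <= C).
  move=> [/= hu hv]; have [hO [hP [hQ hdP]]] := Hd u v ltac:(lra) ltac:(lra).
  split=> //; split; [|split] => i j hi hj.
  - exact: Rle_trans (hP i j hi hj) c1.
  - exact: Rle_trans (hQ i j hi hj) c2.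
  - exact: Rle_trans (hdP i j hi hj) c3.
exists r; split=> //; split; first by case=> u v /sub [].
move=> ub vb w hb.
have sO p : box u0 v0 r p -> O p by case: p => u v /sub [].
have [m Hm] : exists m, forall j, (j <= N)%nat -> Rabs (w j) <= m.
  elim: (N) => [|M [m Hm]].
    by exists (Rabs (w 0%nat)) => j hj; replace j with 0%nat by lia; right.
  exists (Rmax m (Rabs (w (S M)))) => j hj.
  have [->|hj'] : j = S M \/ (j <= M)%nat by lia.
    exact: Rmax_r.
  exact: Rle_trans (Hm j hj') (Rmax_l _ _).
apply: (picard_limit N u0 v0 r P Q _ _ _ ub vb w hb C m) => //.
- exact: smooth_matrix_sub sO sP.
- exact: smooth_matrix_sub sO sQ.
- by move=> u v hu i j hi hj; apply: fl => //; exact: sO.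
- exact: Rle_trans (Rabs_pos _) (Hm 0%nat (Nat.le_0_l _)).
- by move=> u v /sub [_ []].
- by move=> u v /sub [_ [_ []]].
- by move=> u v /sub [_ [_ []]].
Qed.

Lemma is_sol_sub N P Q (D D' : R * R -> Prop) y :
  (forall p, D' p -> D p) -> is_sol N P Q D y -> is_sol N P Q D' y.
Proof. by move=> s H u v h; apply: H; exact: s. Qed.

Lemma is_sol_minus N P Q D y z : is_sol N P Q D y -> is_sol N P Q D z ->
  is_sol N P Q D (fun i u v => y i u v - z i u v).
Proof.
move=> Hy Hz u v h i hi.
have [c1 [d1 e1]] := Hy u v h i hi; have [c2 [d2 e2]] := Hz u v h i hi.
rewrite -!act_minus; split; first exact: continuity_2d_pt_minus.
by split; apply: @is_derive_minus.
Qed.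

Lemma box_constant u0 v0 r f :
  (forall u v, box u0 v0 r (u, v) ->
    is_derive (fun x => f x v) u 0 /\ is_derive (fun y => f u y) v 0) ->
  forall p q, box u0 v0 r p -> box u0 v0 r q -> f (fst p) (snd p) = f (fst q) (snd q).
Proof.
move=> H.
have line (g : R -> R) a c : (forall x, Rabs (x - c) < r -> is_derive g x 0) ->
    forall b, Rabs (a - c) < r -> Rabs (b - c) < r -> g a = g b.
  move=> Hg b ha hb.
  have E x y : x < y -> Rabs (x - c) < r -> Rabs (y - c) < r -> g x = g y.
    move=> hxy /Rabs_def2 hx /Rabs_def2 hy; apply: eq_is_derive hxy => t ht.
    by apply: Hg; apply: Rabs_def1; lra.
  have [h|[->//|h]] := Rtotal_order a b; first exact: E.
  by symmetry; apply: E.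
case=> u v [u' v'] [/= hu hv] [/= hu' hv'].
rewrite (line (fun x => f x v) u u0 _ u') //; last first.
  by move=> x hx; have [] := H x v.
by apply: (line (fun y => f u' y) v v0) => // y hy; have [] := H u' y.
Qed.

(** Minus the transposed matrix: the solutions of the dual system pair to
    constants with those of the original one. *)
Definition dual (P : nat -> nat -> R -> R -> R) (i j : nat) (u v : R) : R :=
  - P j i u v.

Lemma dual_smooth N O P : open O -> smooth_matrix N O P -> smooth_matrix N O (dual P).
Proof. by move=> oO sP i j hi hj; apply: smooth_opp => //; exact: sP. Qed.

Lemma dual_flat N O P Q : flat N O P Q -> flat N O (dual P) (dual Q).
Proof.
move=> fl u v h i j hi hj; have := fl u v h j i hj hi.
rewrite /curv /dual dv_opp du_opp !minus_sum => E.
rewrite -[RHS]Ropp_0 -E.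
rewrite (sum_f_R0_ext N _ (fun k => Q j k u v * P k i u v)); last by move=> k _; ring.
rewrite (sum_f_R0_ext N (fun k => - Q k i u v * - P j k u v)
  (fun k => P j k u v * Q k i u v)); last by move=> k _; ring.
ring.
Qed.

Lemma dual_pairing N P Q D y z : is_sol N P Q D y ->
  is_sol N (dual P) (dual Q) D z -> forall u v, D (u, v) ->
  is_derive (fun x => sum_f_R0 (fun i => z i x v * y i x v) N) u 0 /\
  is_derive (fun x => sum_f_R0 (fun i => z i u x * y i u x) N) v 0.
Proof.
have alg T (a b : nat -> R) : sum_f_R0 (fun i =>
    sum_f_R0 (fun j => - T j i * a j) N * b i + a i * sum_f_R0 (fun j => T i j * b j) N) N = 0.
  rewrite sum_plus.
  rewrite (sum_f_R0_ext N (fun i => sum_f_R0 (fun j => - T j i * a j) N * b i)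
    (fun i => sum_f_R0 (fun j => - T j i * a j * b i) N)); last first.
    by move=> i _; rewrite Rmult_comm sum_f_R0_mult_l; apply: sum_f_R0_ext => j _; ring.
  rewrite sum_f_R0_swap -sum_plus; apply: sum_f_R0_0 => i _.
  rewrite sum_f_R0_mult_l -sum_plus; apply: sum_f_R0_0 => j _; ring.
move=> Hy Hz u v h; split.
- rewrite -(alg (fun i j => P i j u v) (fun i => z i u v) (fun i => y i u v)).
  apply: (is_derive_sum N (fun i x => z i x v * y i x v)) => i hi.
  have [_ [dy _]] := Hy u v h i hi; have [_ [dz _]] := Hz u v h i hi.
  exact: (is_derive_mult (fun x => z i x v) (fun x => y i x v) _ _ _ dz dy Rmult_comm).
- rewrite -(alg (fun i j => Q i j u v) (fun i => z i u v) (fun i => y i u v)).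
  apply: (is_derive_sum N (fun i x => z i u x * y i u x)) => i hi.
  have [_ [_ dy]] := Hy u v h i hi; have [_ [_ dz]] := Hz u v h i hi.
  exact: (is_derive_mult (fun x => z i u x) (fun x => y i u x) _ _ _ dz dy Rmult_comm).
Qed.

(** Uniqueness follows from existence for the dual system: a solution vanishing
    somewhere pairs to zero with every dual solution, and the dual solutions
    take all values. *)
Theorem flat_local_uniqueness N O P Q u0 v0 : open O ->
  smooth_matrix N O P -> smooth_matrix N O Q -> flat N O P Q -> O (u0, v0) ->
  exists r, 0 < r /\ forall rho, rho <= r -> forall y z,
    is_sol N P Q (box u0 v0 rho) y -> is_sol N P Q (box u0 v0 rho) z ->
    forall p, box u0 v0 rho p ->
    (forall i, (i <= N)%nat -> y i (fst p) (snd p) = z i (fst p) (snd p)) ->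
    forall q, box u0 v0 rho q ->
    forall i, (i <= N)%nat -> y i (fst q) (snd q) = z i (fst q) (snd q).
Proof.
move=> oO sP sQ fl h.
have [r [r0 [_ E]]] := flat_local_existence N O (dual P) (dual Q) u0 v0 oO
  (dual_smooth _ _ _ oO sP) (dual_smooth _ _ _ oO sQ) (dual_flat _ _ _ _ fl) h.
exists r; split=> // rho hrho y z Hy Hz p hp e [q1 q2] hq i hi.
have sub p' : box u0 v0 rho p' -> box u0 v0 r p' by move=> [? ?]; split; lra.
have [t [Ht et]] := E q1 q2 (fun j => if Nat.eqb j i then 1 else 0) (sub _ hq).
have := box_constant u0 v0 rho
  (fun u v => sum_f_R0 (fun j => t j u v * (y j u v - z j u v)) N) _ p (q1, q2) hp hq.
move=> /(_ (dual_pairing _ _ _ _ _ _ (is_sol_minus _ _ _ _ _ _ Hy Hz)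
  (is_sol_sub _ _ _ _ _ _ sub Ht))) /=.
rewrite sum_f_R0_0; last by move=> j hj; rewrite e // Rminus_diag Rmult_0_r.
rewrite (sum_f_R0_ext N _ (fun j => if Nat.eqb j i then y j q1 q2 - z j q1 q2 else 0));
  last by move=> j hj; rewrite et //; case: Nat.eqb_spec => _; ring.
rewrite (sum_f_R0_single N i (fun j => y j q1 q2 - z j q1 q2)) //.
lra.
Qed.

(** * Monodromy *)

Definition clamp (t : R) : R := Rmax 0 (Rmin t 1).

Lemma clamp_in t : unit_interval (clamp t).
Proof.
split; first exact: Rmax_l.
by apply: Rmax_lub; [lra|exact: Rmin_r].
Qed.

Lemma clamp_id t : unit_interval t -> clamp t = t.
Proof. by move=> [h1 h2]; rewrite /clamp Rmin_left ?Rmax_right. Qed.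

Lemma clamp_0 t : t <= 0 -> clamp t = 0.
Proof. by move=> h; rewrite /clamp Rmin_left ?Rmax_left; lra. Qed.

Lemma clamp_1 t : 1 <= t -> clamp t = 1.
Proof. by move=> h; rewrite /clamp Rmin_right ?Rmax_right; lra. Qed.

Lemma clamp_lip s t : Rabs (clamp s - clamp t) <= Rabs (s - t).
Proof.
have := Rle_abs (s - t); have := Rle_abs (- (s - t)); rewrite Rabs_Ropp => h1 h2.
by apply: Rabs_le; rewrite /clamp /Rmin; repeat case: Rle_dec => ?;
  rewrite /Rmax; repeat case: Rle_dec => ?; lra.
Qed.

(** Stated as transport of an arbitrary proposition, so that it serves both for
    the agreement of two lifts and for the sign of a function. *)
Lemma locally_constant_interval (Q : R -> Prop) a b : a <= b ->
  (forall t, a <= t <= b -> exists d, 0 < d /\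
     forall t', a <= t' <= b -> Rabs (t' - t) < d -> (Q t' <-> Q t)) ->
  forall t t', a <= t <= b -> a <= t' <= b -> Q t -> Q t'.
Proof.
move=> hab H.
(* The indicator function of Q, extended by constants, has derivative zero. *)
pose cl t := Rmax a (Rmin t b).
have cl_in t : a <= cl t <= b.
  by split; [exact: Rmax_l|apply: Rmax_lub => //; exact: Rmin_r].
have cl_id t : a <= t <= b -> cl t = t.
  by move=> [h1 h2]; rewrite /cl Rmin_left ?Rmax_right.
have cl_lip s t : Rabs (cl s - cl t) <= Rabs (s - t).
  have := Rle_abs (s - t); have := Rle_abs (- (s - t)); rewrite Rabs_Ropp => h1 h2.
  by apply: Rabs_le; rewrite /cl /Rmin; repeat case: Rle_dec => ?;
    rewrite /Rmax; repeat case: Rle_dec => ?; lra.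
pose f t : R := if excluded_middle_informative (Q (cl t)) is left _
  then 1 else 0.
have D t : is_derive f t 0.
  have [d [hd Hd]] := H (cl t) (cl_in t).
  apply: (is_derive_ext_loc (fun _ => f t)); last exact: is_derive_const.
  exists (mkposreal d hd) => s hs; have e := Hd (cl s) (cl_in s).
  have {e} [e1 e2] := e (Rle_lt_trans _ _ _ (cl_lip s t) hs).
  by rewrite /f; case: excluded_middle_informative => h1;
    case: excluded_middle_informative => h2 //;
    [case: h2; exact: e2|case: h1; exact: e1].
have E s t : f s = f t.
  have [h|[->//|h]] := Rtotal_order s t; first by apply: eq_is_derive h => x _; exact: D.
  by symmetry; apply: eq_is_derive h => x _; exact: D.
move=> t t' ht ht' q; have := E t t'; rewrite /f !cl_id //.
do 2! case: excluded_middle_informative => //.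
by move=> _ _; lra.
Qed.

Section Lift.

Variables (N : nat) (O : R * R -> Prop) (P Q : nat -> nat -> R -> R -> R).
Hypothesis oO : open O.
Hypothesis sP : smooth_matrix N O P.
Hypothesis sQ : smooth_matrix N O Q.
Hypothesis fl : flat N O P Q.

Definition eqN (v w : nat -> R) := forall i, (i <= N)%nat -> v i = w i.

Definition at_pt (y : nat -> R -> R -> R) (p : R * R) (i : nat) : R := y i (fst p) (snd p).

Definition box_at (p : R * R) (r : R) : R * R -> Prop := box (fst p) (snd p) r.

Lemma box_at_center p r : 0 < r -> box_at p r p.
Proof. by move=> h; split; rewrite Rminus_diag Rabs_R0. Qed.

Lemma open_box_at (D : R * R -> Prop) q : open D -> D q ->
  exists s, 0 < s /\ forall z, box_at q s z -> D z.
Proof.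
case: q => [q1 q2] oD h; have [d Hd] := open_locally_2d D oD _ _ h.
exists d; split; first exact: cond_pos.
by case=> z1 z2 [h1 h2]; exact: Hd.
Qed.

Lemma box_at_mono p r s z : r <= s -> box_at p r z -> box_at p s z.
Proof. by move=> h [? ?]; split; lra. Qed.

(** Maps are defined on the whole plane, so that continuity has no boundary
    cases; paths and squares are extended by [clamp]. *)
Definition map_in (h : R -> R -> R * R) :=
  (forall s t r, 0 < r -> exists d, 0 < d /\
     forall s' t', Rabs (s' - s) < d -> Rabs (t' - t) < d -> box_at (h s t) r (h s' t')) /\
  (forall s t, O (h s t)).

(** [Y] is, over the rectangle, locally the composite of [h] with a solution: a
    flat section of the pulled back bundle. *)
Definition lift (h : R -> R -> R * R) (a b c d : R) (Y : R -> R -> nat -> R) :=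
  forall s t, a <= s <= b -> c <= t <= d ->
  exists e r y, 0 < e /\ 0 < r /\ is_sol N P Q (box_at (h s t) r) y /\
    forall s' t', a <= s' <= b -> c <= t' <= d ->
      Rabs (s' - s) < e -> Rabs (t' - t) < e ->
      box_at (h s t) r (h s' t') /\ eqN (Y s' t') (at_pt y (h s' t')).

Lemma lift_sub h a b c d a' b' c' d' Y : lift h a b c d Y ->
  a <= a' -> b' <= b -> c <= c' -> d' <= d -> lift h a' b' c' d' Y.
Proof.
move=> L h1 h2 h3 h4 s t hs ht.
have [e [r [y [he [hr [Hy H]]]]]] := L s t ltac:(lra) ltac:(lra).
exists e, r, y; split=> //; split=> //; split=> // s' t' hs' ht'; apply: H; lra.
Qed.

Lemma lift_ext h h' a b c d Y : lift h a b c d Y ->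
  (forall s t, a <= s <= b -> c <= t <= d -> h s t = h' s t) -> lift h' a b c d Y.
Proof.
move=> L E s t hs ht.
have [e [r [y [he [hr [Hy H]]]]]] := L s t hs ht.
exists e, r, y; rewrite -E //; split=> //; split=> //; split=> // s' t' hs' ht'.
by rewrite -E //; exact: H.
Qed.

Lemma lift_swap h a b c d Y : lift h a b c d Y ->
  lift (fun s t => h t s) c d a b (fun s t => Y t s).
Proof.
move=> L s t hs ht; have [e [r [y [he [hr [Hy H]]]]]] := L t s ht hs.
exists e, r, y; split=> //; split=> //; split=> // s' t' hs' ht' l1 l2; exact: H.
Qed.

Lemma lift_comp h a b c d Y (sg ta : R -> R -> R) a' b' c' d' :
  (forall s t e s' t', Rabs (s' - s) < e -> Rabs (t' - t) < e ->
     Rabs (sg s' t' - sg s t) < 2 * e /\ Rabs (ta s' t' - ta s t) < 2 * e) ->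
  (forall s t, a' <= s <= b' -> c' <= t <= d' -> a <= sg s t <= b /\ c <= ta s t <= d) ->
  lift h a b c d Y ->
  lift (fun s t => h (sg s t) (ta s t)) a' b' c' d' (fun s t => Y (sg s t) (ta s t)).
Proof.
move=> lip into L s t hs ht; have [i1 i2] := into s t hs ht.
have [e [r [y [he [hr [Hy H]]]]]] := L _ _ i1 i2.
exists (e / 2), r, y; split; first lra; split=> //; split=> // s' t' hs' ht' l1 l2.
have [k1 k2] := lip s t (e / 2) s' t' l1 l2; have [j1 j2] := into s' t' hs' ht'.
by apply: H => //; lra.
Qed.

Lemma lift_of_sol h a b c d D y : map_in h -> open D -> is_sol N P Q D y ->
  (forall s t, a <= s <= b -> c <= t <= d -> D (h s t)) ->
  lift h a b c d (fun s t => at_pt y (h s t)).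
Proof.
move=> [ch _] oD Hy into s t hs ht.
have [r' [hr' H']] := open_box_at _ _ oD (into s t hs ht).
have [e [he He]] := ch s t r' hr'.
exists e, r', y; split=> //; split=> //; split; first exact: is_sol_sub H' Hy.
move=> s' t' hs' ht' l1 l2; split=> //; exact: He.
Qed.

(** One radius serves for existence and for uniqueness. *)
Lemma chart p : O p -> exists r, 0 < r /\ (forall q, box_at p r q -> O q) /\
  (forall q w, box_at p r q -> exists y, is_sol N P Q (box_at p r) y /\ eqN (at_pt y q) w) /\
  (forall rho, rho <= r -> forall y z,
     is_sol N P Q (box_at p rho) y -> is_sol N P Q (box_at p rho) z ->
     forall q q', box_at p rho q -> box_at p rho q' -> eqN (at_pt y q) (at_pt z q) ->
     eqN (at_pt y q') (at_pt z q')).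
Proof.
case: p => [u v] h.
have [r1 [h1 [s1 E1]]] := flat_local_existence N O P Q u v oO sP sQ fl h.
have [r2 [h2 E2]] := flat_local_uniqueness N O P Q u v oO sP sQ fl h.
have l1 := Rmin_l r1 r2; have l2 := Rmin_r r1 r2.
have sub q : box_at (u, v) (Rmin r1 r2) q -> box u v r1 q by apply: box_at_mono.
exists (Rmin r1 r2); split; first exact: Rmin_pos.
split; first by move=> q /sub /s1.
split.
  case=> q1 q2 w /sub hq; have [y [Hy e]] := E1 q1 q2 w hq.
  by exists y; split=> //; exact: is_sol_sub sub Hy.
move=> rho hrho y z Hy Hz q q' hq hq' e.
exact: (E2 rho (Rle_trans _ _ _ hrho l2) y z Hy Hz q hq e q' hq').
Qed.

Lemma eqN_sym v w : eqN v w -> eqN w v.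
Proof. by move=> H i hi; rewrite H. Qed.

Lemma eqN_trans v w x : eqN v w -> eqN w x -> eqN v x.
Proof. by move=> H1 H2 i hi; rewrite H1 // H2. Qed.

(** Over a small square both lifts come from solutions, for which agreement at
    one point is agreement everywhere. *)
Lemma lift_locally_const h a b c d Y Z s t : map_in h ->
  lift h a b c d Y -> lift h a b c d Z -> a <= s <= b -> c <= t <= d ->
  exists e, 0 < e /\ forall s' t', a <= s' <= b -> c <= t' <= d ->
    Rabs (s' - s) < e -> Rabs (t' - t) < e ->
    (eqN (Y s' t') (Z s' t') <-> eqN (Y s t) (Z s t)).
Proof.
move=> [ch hO] LY LZ hs ht.
have [e1 [r1 [y [he1 [hr1 [Hy H1]]]]]] := LY s t hs ht.
have [e2 [r2 [z [he2 [hr2 [Hz H2]]]]]] := LZ s t hs ht.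
have [r [hr [_ [_ U]]]] := chart (h s t) (hO s t).
pose rho := Rmin r (Rmin r1 r2).
have l0 : rho <= r by exact: Rmin_l.
have l1 : rho <= r1 by apply: Rle_trans (Rmin_r _ _) (Rmin_l _ _).
have l2 : rho <= r2 by apply: Rle_trans (Rmin_r _ _) (Rmin_r _ _).
have hrho : 0 < rho by apply: Rmin_pos => //; exact: Rmin_pos.
have [e3 [he3 H3]] := ch s t rho hrho.
exists (Rmin e3 (Rmin e1 e2)); split; first by apply: Rmin_pos => //; exact: Rmin_pos.
move=> s' t' hs' ht' hds hdt.
have k := Rmin_l e3 (Rmin e1 e2); have k' := Rmin_r e3 (Rmin e1 e2).
have k1 := Rmin_l e1 e2; have k2 := Rmin_r e1 e2.
have z0 : forall x e, 0 < e -> Rabs (x - x) < e by move=> *; rewrite Rminus_diag Rabs_R0.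
have [_ f1] := H1 s' t' hs' ht' ltac:(lra) ltac:(lra).
have [_ f2] := H2 s' t' hs' ht' ltac:(lra) ltac:(lra).
have [_ g1] := H1 s t hs ht (z0 _ _ he1) (z0 _ _ he1).
have [_ g2] := H2 s t hs ht (z0 _ _ he2) (z0 _ _ he2).
have Hy' : is_sol N P Q (box_at (h s t) rho) y.
  by apply: is_sol_sub Hy => x; exact: box_at_mono.
have Hz' : is_sol N P Q (box_at (h s t) rho) z.
  by apply: is_sol_sub Hz => x; exact: box_at_mono.
have q0 : box_at (h s t) rho (h s t) by exact: box_at_center.
have q1 : box_at (h s t) rho (h s' t') by apply: H3; lra.
split=> E.
- apply: eqN_trans g1 _; apply: eqN_trans _ (eqN_sym _ _ g2).
  apply: (U rho l0 y z Hy' Hz' (h s' t')) => //.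
  by apply: eqN_trans (eqN_sym _ _ f1) _; apply: eqN_trans E f2.
- apply: eqN_trans f1 _; apply: eqN_trans _ (eqN_sym _ _ f2).
  apply: (U rho l0 y z Hy' Hz' (h s t)) => //.
  by apply: eqN_trans (eqN_sym _ _ g1) _; apply: eqN_trans E g2.
Qed.

Lemma lift_unique h a b c d Y Z s0 t0 s1 t1 : map_in h ->
  lift h a b c d Y -> lift h a b c d Z ->
  a <= s0 <= b -> c <= t0 <= d -> a <= s1 <= b -> c <= t1 <= d ->
  eqN (Y s0 t0) (Z s0 t0) -> eqN (Y s1 t1) (Z s1 t1).
Proof.
move=> mh LY LZ hs0 ht0 hs1 ht1 E0.
have z0 : forall x e, 0 < e -> Rabs (x - x) < e by move=> *; rewrite Rminus_diag Rabs_R0.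
have E1 : eqN (Y s1 t0) (Z s1 t0).
  apply: (locally_constant_interval (fun s => eqN (Y s t0) (Z s t0)) a b _ _ s0) => //; first lra.
  move=> s hs; have [e [he H]] := lift_locally_const h a b c d Y Z s t0 mh LY LZ hs ht0.
  by exists e; split=> // s' hs' l; apply: H => //; exact: z0.
apply: (locally_constant_interval (fun t => eqN (Y s1 t) (Z s1 t)) c d _ _ t0) => //; first lra.
move=> t ht; have [e [he H]] := lift_locally_const h a b c d Y Z s1 t mh LY LZ hs1 ht.
by exists e; split=> // t' ht' l; apply: H => //; exact: z0.
Qed.

(** Agreement at one corner propagates along the common edge, where the two
    local solutions then coincide. *)
Lemma lift_glue h a m b c d Y1 Y2 : map_in h -> a <= m <= b -> c <= d ->
  lift h a m c d Y1 -> lift h m b c d Y2 -> eqN (Y1 m c) (Y2 m c) ->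
  lift h a b c d (fun s t => if Rle_dec s m is left _ then Y1 s t else Y2 s t).
Proof.
move=> mh hm hcd L1 L2 E s t hs ht; have [ch hO] := mh.
have edge t' : c <= t' <= d -> eqN (Y1 m t') (Y2 m t').
  move=> ht'; apply: (lift_unique h m m c d Y1 Y2 m c m t' mh) => //; try lra.
  - by apply: lift_sub L1 _ _ _ _; lra.
  - by apply: lift_sub L2 _ _ _ _; lra.
have z0 : forall x e, 0 < e -> Rabs (x - x) < e by move=> *; rewrite Rminus_diag Rabs_R0.
have [hlt|[heq|hgt]] := Rtotal_order s m.
- have [e [r [y [he [hr [Hy H]]]]]] := L1 s t ltac:(lra) ht.
  exists (Rmin e (m - s)), r, y; split; first by apply: Rmin_pos; lra.
  split=> //; split=> // s' t' hs' ht' l1 l2.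
  have k1 := Rmin_l e (m - s); have k2 := Rmin_r e (m - s).
  case: Rle_dec => h'; first by apply: H => //; lra.
  by move/Rabs_def2: l1; lra.
- rewrite heq in hs *.
  have [e1 [r1 [y [he1 [hr1 [Hy H1]]]]]] := L1 m t ltac:(lra) ht.
  have [e2 [r2 [z [he2 [hr2 [Hz H2]]]]]] := L2 m t ltac:(lra) ht.
  have [r [hr [_ [_ U]]]] := chart (h m t) (hO m t).
  pose rho := Rmin r (Rmin r1 r2).
  have l0 : rho <= r by exact: Rmin_l.
  have l1 : rho <= r1 by apply: Rle_trans (Rmin_r _ _) (Rmin_l _ _).
  have l2 : rho <= r2 by apply: Rle_trans (Rmin_r _ _) (Rmin_r _ _).
  have hrho : 0 < rho by apply: Rmin_pos => //; exact: Rmin_pos.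
  have [e3 [he3 H3]] := ch m t rho hrho.
  have Hy' : is_sol N P Q (box_at (h m t) rho) y.
    by apply: is_sol_sub Hy => x; exact: box_at_mono.
  have Hz' : is_sol N P Q (box_at (h m t) rho) z.
    by apply: is_sol_sub Hz => x; exact: box_at_mono.
  have q0 : box_at (h m t) rho (h m t) by exact: box_at_center.
  exists (Rmin e3 (Rmin e1 e2)), rho, y.
  split; first by apply: Rmin_pos => //; exact: Rmin_pos.
  split=> //; split=> // s' t' hs' ht' hds hdt.
  have k := Rmin_l e3 (Rmin e1 e2); have k' := Rmin_r e3 (Rmin e1 e2).
  have k1 := Rmin_l e1 e2; have k2 := Rmin_r e1 e2.
  have q1 : box_at (h m t) rho (h s' t') by apply: H3; lra.
  split=> //; case: Rle_dec => h'.
    by have [_ f] := H1 s' t' ltac:(lra) ht' ltac:(lra) ltac:(lra).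
  have [_ f] := H2 s' t' ltac:(lra) ht' ltac:(lra) ltac:(lra).
  apply: eqN_trans f _; apply: (U rho l0 z y Hz' Hy' (h m t)) => //.
  have [_ g1] := H1 m t ltac:(lra) ht (z0 _ _ he1) (z0 _ _ he1).
  have [_ g2] := H2 m t ltac:(lra) ht (z0 _ _ he2) (z0 _ _ he2).
  apply: eqN_trans (eqN_sym _ _ g2) _; apply: eqN_trans _ g1.
  by apply: eqN_sym; exact: edge.
- have [e [r [y [he [hr [Hy H]]]]]] := L2 s t ltac:(lra) ht.
  exists (Rmin e (s - m)), r, y; split; first by apply: Rmin_pos; lra.
  split=> //; split=> // s' t' hs' ht' l1 l2.
  have k1 := Rmin_l e (s - m); have k2 := Rmin_r e (s - m).
  case: Rle_dec => h'; first by move/Rabs_def2: l1; lra.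
  by apply: H => //; lra.
Qed.

Definition liftable h a b c d := forall s0 t0 w, a <= s0 <= b -> c <= t0 <= d ->
  exists Y, lift h a b c d Y /\ eqN (Y s0 t0) w.

Lemma liftable_swap h a b c d : liftable h a b c d ->
  liftable (fun s t => h t s) c d a b.
Proof.
move=> H s0 t0 w hs ht; have [Y [L e]] := H t0 s0 w ht hs.
by exists (fun s t => Y t s); split=> //; exact: lift_swap.
Qed.

Lemma liftable_glue h a m b c d : map_in h -> a <= m <= b -> c <= d ->
  liftable h a m c d -> liftable h m b c d -> liftable h a b c d.
Proof.
move=> mh hm hcd H1 H2 s0 t0 w hs ht.
case: (Rle_dec s0 m) => h0.
- have [Y1 [L1 e1]] := H1 s0 t0 w ltac:(lra) ht.
  have [Y2 [L2 e2]] := H2 m c (Y1 m c) ltac:(lra) ltac:(lra).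
  exists (fun s t => if Rle_dec s m is left _ then Y1 s t else Y2 s t).
  split; first by apply: lift_glue => //; exact: eqN_sym.
  by case: Rle_dec.
- have [Y2 [L2 e2]] := H2 s0 t0 w ltac:(lra) ht.
  have [Y1 [L1 e1]] := H1 m c (Y2 m c) ltac:(lra) ltac:(lra).
  exists (fun s t => if Rle_dec s m is left _ then Y1 s t else Y2 s t).
  split; first exact: lift_glue.
  by case: Rle_dec.
Qed.

Lemma map_in_swap h : map_in h -> map_in (fun s t => h t s).
Proof.
move=> [ch hO]; split=> // s t r hr; have [d [hd H]] := ch t s r hr.
by exists d; split=> // s' t' l1 l2; exact: H.
Qed.

Lemma liftable_glue_v h a b c m d : map_in h -> c <= m <= d -> a <= b ->
  liftable h a b c m -> liftable h a b m d -> liftable h a b c d.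
Proof.
move=> mh hm hab H1 H2.
apply: (liftable_swap (fun s t => h t s)).
by apply: (liftable_glue _ _ m); [exact: map_in_swap|lra|lra|exact: liftable_swap|exact: liftable_swap].
Qed.

Lemma liftable_small h s t : map_in h -> exists e, 0 < e /\
  forall a b c d, s - e < a -> b < s + e -> t - e < c -> d < t + e -> liftable h a b c d.
Proof.
move=> mh; have [ch hO] := mh.
have [r [hr [_ [E _]]]] := chart (h s t) (hO s t).
have [e [he H]] := ch s t r hr.
exists e; split=> // a b c d h1 h2 h3 h4 s0 t0 w hs0 ht0.
have into s' t' : a <= s' <= b -> c <= t' <= d -> box_at (h s t) r (h s' t').
  by move=> hs' ht'; apply: H; apply: Rabs_def1; lra.
have [y [Hy e']] := E (h s0 t0) w (into _ _ hs0 ht0).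
exists (fun s t => at_pt y (h s t)); split=> //.
exact: lift_of_sol mh (box_open _ _ _) Hy into.
Qed.

(** A flat section over the unit square exists: small squares by local
    existence, and the side length can be doubled by gluing. *)
Lemma liftable_square h : map_in h -> liftable h 0 1 0 1.
Proof.
move=> mh.
pose ep s t := proj1_sig (constructive_indefinite_description _
  (liftable_small h s t mh)).
have hep s t : 0 < ep s t /\ forall a b c d, s - ep s t < a -> b < s + ep s t ->
    t - ep s t < c -> d < t + ep s t -> liftable h a b c d.
  by rewrite /ep; case: constructive_indefinite_description.
have hep2 s t : 0 < ep s t / 2 by have [] := hep s t; lra.
have [d Hd] := compactness_value_2d 0 1 0 1 (fun s t => mkposreal _ (hep2 s t)).
have d0 := cond_pos d.
have base a b c d' : 0 <= a -> a <= b -> b <= 1 -> 0 <= c -> c <= d' -> d' <= 1 ->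
    b - a < d -> d' - c < d -> liftable h a b c d'.
  move=> h1 h2 h3 h4 h5 h6 h7 h8.
  apply: NNPP => nl; apply: (Hd a c); [lra|lra|] => [] [s [t [hs [ht [l1 [l2 l3]]]]]].
  apply: nl; move: l1 l2 l3 => /= /Rabs_def2 l1 /Rabs_def2 l2 l3.
  by have [_ H] := hep s t; apply: H; lra.
have grow n : forall a b c d', 0 <= a -> a <= b -> b <= 1 -> 0 <= c -> c <= d' -> d' <= 1 ->
    b - a < d * 2 ^ n -> d' - c < d * 2 ^ n -> liftable h a b c d'.
  elim: n => [|n IH] a b c d' h1 h2 h3 h4 h5 h6 h7 h8.
    by apply: base; rewrite //= in h7 h8; lra.
  rewrite /= in h7 h8.
  apply: (liftable_glue _ _ ((a + b) / 2)) => //; first lra.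
  - by apply: (liftable_glue_v _ _ _ _ ((c + d') / 2)) => //; try lra; apply: IH; lra.
  - by apply: (liftable_glue_v _ _ _ _ ((c + d') / 2)) => //; try lra; apply: IH; lra.
have [n Hn] : exists n, 1 < d * 2 ^ n.
  have [n Hn] := Pow_x_infinity 2 ltac:(rewrite Rabs_pos_eq; lra) (2 / d).
  exists n; have := Hn n (Nat.le_refl _); rewrite Rabs_pos_eq; last by apply: pow_le; lra.
  move=> h1; have : d * (2 / d) <= d * 2 ^ n by apply: Rmult_le_compat_l; lra.
  have -> : d * (2 / d) = 2 by field; lra.
  lra.
by apply: (grow n); lra.
Qed.

(** Where the map is constant, so is a flat section over it. *)
Lemma lift_over_point h a b c d Y p s0 t0 s1 t1 : map_in h -> lift h a b c d Y ->
  (forall s t, a <= s <= b -> c <= t <= d -> h s t = p) ->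
  a <= s0 <= b -> c <= t0 <= d -> a <= s1 <= b -> c <= t1 <= d ->
  eqN (Y s0 t0) (Y s1 t1).
Proof.
move=> mh L hp hs0 ht0 hs1 ht1.
have pO : O p by rewrite -(hp s0 t0) //; case: mh.
have [r [hr [_ [E _]]]] := chart p pO.
have [y [Hy e]] := E p (Y s0 t0) (box_at_center _ _ hr).
have Ly : lift h a b c d (fun s t => at_pt y (h s t)).
  apply: (lift_of_sol _ _ _ _ _ _ _ mh (box_open _ _ _) Hy) => s t hs ht.
  by rewrite hp //; exact: box_at_center.
have := lift_unique h a b c d _ _ s0 t0 s1 t1 mh L Ly hs0 ht0 hs1 ht1.
rewrite !hp // => H; apply: eqN_sym; apply: eqN_trans (H (eqN_sym _ _ e)) e.
Qed.

(** ** Continuation along paths *)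

(** Paths are parametrised by the whole line and rest at their end points. *)
Definition path_from_to (p q : R * R) (c : R -> R * R) :=
  map_in (fun _ t => c t) /\ (forall t, t <= 0 -> c t = p) /\ (forall t, 1 <= t -> c t = q).

Lemma continuous_on_clamp (c : R -> R * R) : continuous_on unit_interval c ->
  (forall t, unit_interval t -> O (c t)) -> map_in (fun _ t => c (clamp t)).
Proof.
move=> cc cO; split; last by move=> s t; apply: cO; exact: clamp_in.
move=> s t r hr.
have [d Hd] := cc (clamp t) (clamp_in t) (box_at (c (clamp t)) r)
  (box_open _ _ r _ (box_at_center _ _ hr)).
exists d; split; first exact: cond_pos.
move=> s' t' _ l; apply: Hd (clamp_in t').
exact: Rle_lt_trans (clamp_lip t' t) l.
Qed.

Lemma continuous_on_clamp_square (H : R * R -> R * R) : continuous_on unit_square H ->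
  (forall p, unit_square p -> O (H p)) -> map_in (fun s t => H (clamp s, clamp t)).
Proof.
move=> cc cO; have sq s t : unit_square (clamp s, clamp t) by split; exact: clamp_in.
split; last by move=> s t; exact: cO.
move=> s t r hr.
have [d Hd] := cc (clamp s, clamp t) (sq s t) (box_at (H (clamp s, clamp t)) r)
  (box_open _ _ r _ (box_at_center _ _ hr)).
exists d; split; first exact: cond_pos.
move=> s' t' l l'; apply: Hd (sq s' t').
by split; [exact: Rle_lt_trans (clamp_lip s' s) l|exact: Rle_lt_trans (clamp_lip t' t) l'].
Qed.

Lemma map_in_continuous_on (c : R -> R * R) D :
  map_in (fun _ t => c t) -> continuous_on D c.
Proof.
move=> [ch _] t _ A [e He].
have [d [hd Hd]] := ch 0 t e (cond_pos e).
exists (mkposreal d hd) => t' l _; apply: He.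
by have [] := Hd 0 t' ltac:(rewrite Rminus_diag Rabs_R0; lra) l; split.
Qed.

Hypothesis sc : simply_connected O.

Lemma path_exists p q : O p -> O q -> exists c, path_from_to p q c.
Proof.
move=> hp hq; have [_ [pc _]] := sc; have [c [cc [c0 [c1 cO]]]] := pc p q hp hq.
exists (fun t => c (clamp t)); split; first exact: continuous_on_clamp.
by split=> t ht; [rewrite clamp_0|rewrite clamp_1].
Qed.

Lemma path_lift c w : map_in (fun _ t => c t) -> exists Y,
  lift (fun _ t => c t) 0 0 0 1 Y /\ eqN (Y 0 0) w.
Proof.
move=> mc; have [Y [L e]] := liftable_square _ mc 0 0 w ltac:(lra) ltac:(lra).
by exists Y; split=> //; apply: lift_sub L _ _ _ _; lra.
Qed.

(** Parallel transport along some path. *)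
Definition reach (p0 : R * R) (w0 : nat -> R) (p : R * R) (w : nat -> R) :=
  exists c Y, path_from_to p0 p c /\ lift (fun _ t => c t) 0 0 0 1 Y /\
    eqN (Y 0 0) w0 /\ eqN (Y 0 1) w.

Lemma reach_exists p0 w0 p : O p0 -> O p -> exists w, reach p0 w0 p w.
Proof.
move=> h0 hp; have [c pc] := path_exists p0 p h0 hp.
have [mc _] := pc; have [Y [L e]] := path_lift c w0 mc.
by exists (Y 0 1), c, Y.
Qed.

Lemma affine_lip k l (hk : Rabs k <= 2) s t e s' t' :
  Rabs (s' - s) < e -> Rabs (t' - t) < e ->
  Rabs (0 - 0) < 2 * e /\ Rabs (k * t' + l - (k * t + l)) < 2 * e.
Proof.
move=> h1 h2; have := Rabs_pos (t' - t) => h3.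
split; first by rewrite Rminus_diag Rabs_R0; lra.
replace (k * t' + l - (k * t + l)) with (k * (t' - t)) by ring.
rewrite Rabs_mult; have := Rabs_pos k; nra.
Qed.

Lemma lift_segment h a b Y k l c : a <= 0 <= b -> lift h a b 0 1 Y -> Rabs k <= 2 ->
  (forall t, 0 <= t <= 1 -> 0 <= k * t + l <= 1) ->
  (forall t, 0 <= t <= 1 -> h 0 (k * t + l) = c t) ->
  lift (fun _ t => c t) 0 0 0 1 (fun _ t => Y 0 (k * t + l)).
Proof.
move=> ha L hk into e.
apply: (lift_ext (fun s t => h 0 (k * t + l))) => [|s t _ ht]; last exact: e.
apply: (lift_comp h a b 0 1 Y (fun _ _ => 0) (fun _ t => k * t + l)) => // [s t d s' t'|s t _ ht].
- exact: affine_lip.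
- by split=> //; exact: into.
Qed.

Lemma path_unique c Y Z : map_in (fun _ t => c t) ->
  lift (fun _ t => c t) 0 0 0 1 Y -> lift (fun _ t => c t) 0 0 0 1 Z ->
  (eqN (Y 0 0) (Z 0 0) <-> eqN (Y 0 1) (Z 0 1)).
Proof.
by move=> mc LY LZ; split=> e; apply: (lift_unique _ _ _ _ _ _ _ _ _ _ _ mc LY LZ _ _ _ _ e); lra.
Qed.

(** The values at the end of two paths agree, because the loop formed by the
    paths bounds a disc over which the continuation extends. *)
Lemma reach_unique p0 w0 p w w' : reach p0 w0 p w -> reach p0 w0 p w' -> eqN w w'.
Proof.
move=> [c1 [Y1 [[m1 [b1 f1]] [L1 [s1 t1]]]]] [c2 [Y2 [[m2 [b2 f2]] [L2 [s2 t2]]]]].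
pose loop t : R * R := (fst (c1 (2 * t)) + fst (c2 (2 - 2 * t)) - fst p,
                        snd (c1 (2 * t)) + snd (c2 (2 - 2 * t)) - snd p).
have lo t : t <= / 2 -> loop t = c1 (2 * t).
  move=> ht; rewrite /loop f2; last lra.
  by case: (c1 _) (p) => x y [x' y'] /=; congr pair; ring.
have hi t : / 2 <= t -> loop t = c2 (2 - 2 * t).
  move=> ht; rewrite /loop f1; last lra.
  by case: (c2 _) (p) => x y [x' y'] /=; congr pair; ring.
have ml : map_in (fun _ t => loop t).
  split; last first.
    move=> s t; have [h|h] := Rle_or_lt t (/ 2).
      by rewrite lo //; have [_ hO] := m1; exact: (hO 0).
    by rewrite hi; [have [_ hO] := m2; exact: (hO 0)|lra].
  move=> s t r hr.
  have [d1 [h1 H1]] := proj1 m1 0 (2 * t) (r / 2) ltac:(lra).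
  have [d2 [h2 H2]] := proj1 m2 0 (2 - 2 * t) (r / 2) ltac:(lra).
  have k1 := Rmin_l d1 d2; have k2 := Rmin_r d1 d2.
  exists (Rmin d1 d2 / 2); split; first by have := Rmin_pos _ _ h1 h2; lra.
  move=> s' t' _ /Rabs_def2 l.
  have [x1 y1] := H1 0 (2 * t') ltac:(rewrite Rminus_diag Rabs_R0; lra)
    ltac:(apply: Rabs_def1; lra).
  have [x2 y2] := H2 0 (2 - 2 * t') ltac:(rewrite Rminus_diag Rabs_R0; lra)
    ltac:(apply: Rabs_def1; lra).
  move/Rabs_def2: x1 => x1; move/Rabs_def2: y1 => y1.
  move/Rabs_def2: x2 => x2; move/Rabs_def2: y2 => y2.
  by split=> /=; apply: Rabs_def1; lra.
have e0 : loop 0 = p0 by rewrite lo; [apply: b1; lra|lra].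
have e1 : loop 1 = p0 by rewrite hi; [apply: b2; lra|lra].
have [_ [_ /(_ loop)]] := sc.
move=> /(_ (map_in_continuous_on _ _ ml) (eq_trans e0 (esym e1)) (fun t _ => proj2 ml 0 t)).
move=> [H [cH [HO [Ht Hs]]]].
have mh := continuous_on_clamp_square H cH HO.
have z01 : unit_interval 0 by split; lra.
have z11 : unit_interval 1 by split; lra.
have [Z [LZ eZ]] := liftable_square _ mh 0 0 w0 ltac:(lra) ltac:(lra).
have Zloop : eqN (Z 0 1) w0.
  have q1 : eqN (Z 0 0) (Z 1 0).
    apply: (lift_over_point _ 0 1 0 0 Z p0 _ _ _ _ mh); try lra.
      by apply: lift_sub LZ _ _ _ _; lra.
    move=> s t hs ht; have -> : t = 0 by lra.
    rewrite (clamp_id 0) //; have [-> _] := Hs (clamp s) (clamp_in s); exact: e0.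
  have q2 : eqN (Z 1 0) (Z 1 1).
    apply: (lift_over_point _ 1 1 0 1 Z p0 _ _ _ _ mh); try lra.
      by apply: lift_sub LZ _ _ _ _; lra.
    move=> s t hs ht; have -> : s = 1 by lra.
    rewrite (clamp_id 1) //; have [_ ->] := Ht (clamp t) (clamp_in t); exact: e0.
  have q3 : eqN (Z 1 1) (Z 0 1).
    apply: (lift_over_point _ 0 1 1 1 Z p0 _ _ _ _ mh); try lra.
      by apply: lift_sub LZ _ _ _ _; lra.
    move=> s t hs ht; have -> : t = 1 by lra.
    rewrite (clamp_id 1) //; have [_ ->] := Hs (clamp s) (clamp_in s); exact: e0.
  apply: eqN_trans _ eZ; apply: eqN_sym.
  by apply: eqN_trans q1 _; apply: eqN_trans q2 q3.
have edge t : 0 <= t <= 1 -> H (clamp 0, clamp t) = loop t.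
  by move=> ht; rewrite !clamp_id //; have [-> _] := Ht t ht.
have S1 : lift (fun _ t => c1 t) 0 0 0 1 (fun _ t => Z 0 (/ 2 * t + 0)).
  apply: (lift_segment _ 0 1 Z _ _ _ _ LZ) => [||t ht|t ht]; try lra.
    by rewrite Rabs_pos_eq; lra.
  rewrite edge; last lra.
  by rewrite lo; [congr c1; lra|lra].
have S2 : lift (fun _ t => c2 t) 0 0 0 1 (fun _ t => Z 0 (- / 2 * t + 1)).
  apply: (lift_segment _ 0 1 Z _ _ _ _ LZ) => [||t ht|t ht]; try lra.
    by rewrite Rabs_left; lra.
  rewrite edge; last lra.
  by rewrite hi; [congr c2; lra|lra].
have [/(_ _) U1 _] := path_unique c1 _ _ m1 S1 L1.
have [/(_ _) U2 _] := path_unique c2 _ _ m2 S2 L2.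
have E0 : / 2 * 0 + 0 = 0 by lra.
have E1 : - / 2 * 0 + 1 = 1 by lra.
have E2 : / 2 * 1 + 0 = / 2 by lra.
have E3 : - / 2 * 1 + 1 = / 2 by lra.
rewrite E0 E2 in U1; rewrite E1 E3 in U2.
have V1 := U1 (eqN_trans _ _ _ eZ (eqN_sym _ _ s1)).
have V2 := U2 (eqN_trans _ _ _ Zloop (eqN_sym _ _ s2)).
apply: eqN_trans (eqN_sym _ _ t1) _; apply: eqN_trans _ t2.
exact: eqN_trans (eqN_sym _ _ V1) V2.
Qed.

Lemma box_at_segment p r q x : box_at p r q -> unit_interval x ->
  box_at p r (fst p + x * (fst q - fst p), snd p + x * (snd q - snd p)).
Proof.
have L a b : Rabs (b - a) < r -> unit_interval x -> Rabs (a + x * (b - a) - a) < r.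
  move=> h [h1 h2]; replace (a + x * (b - a) - a) with (x * (b - a)) by ring.
  rewrite Rabs_mult (Rabs_pos_eq x) //; have := Rabs_pos (b - a); nra.
by move=> [h1 h2] hx; split; exact: L.
Qed.

(** Prolong the path by the straight segment from [p] to [q], which stays in the
    square. *)
Lemma reach_extend p0 w0 p w r y q : reach p0 w0 p w ->
  (forall z, box_at p r z -> O z) -> is_sol N P Q (box_at p r) y ->
  eqN (at_pt y p) w -> box_at p r q -> reach p0 w0 q (at_pt y q).
Proof.
move=> [c [Y [[mc [b f]] [L [s0 t0]]]]] sO Hy ey hq.
pose seg x : R * R := (fst p + x * (fst q - fst p), snd p + x * (snd q - snd p)).
pose c' t : R * R := (fst (c (2 * t)) + clamp (2 * t - 1) * (fst q - fst p),
                      snd (c (2 * t)) + clamp (2 * t - 1) * (snd q - snd p)).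
have lo t : t <= / 2 -> c' t = c (2 * t).
  move=> ht; rewrite /c' clamp_0; last lra.
  by case: (c _) => x x' /=; congr pair; ring.
have hi t : / 2 <= t -> c' t = seg (clamp (2 * t - 1)).
  by move=> ht; rewrite /c' f //; lra.
have m' : map_in (fun _ t => c' t).
  split; last first.
    move=> s t; have [h|h] := Rle_or_lt t (/ 2).
      by rewrite lo //; have [_ hO] := mc; exact: (hO 0).
    by rewrite hi; [apply: sO; apply: box_at_segment => //; exact: clamp_in|lra].
  move=> s t e he.
  have [d1 [h1 H1]] := proj1 mc 0 (2 * t) (e / 2) ltac:(lra).
  set M := Rabs (fst q - fst p) + Rabs (snd q - snd p) + 1.
  have M0 : 0 < M by have := Rabs_pos (fst q - fst p); have := Rabs_pos (snd q - snd p); rewrite /M; lra.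
  have h2 : 0 < e / (2 * M) by apply: Rdiv_lt_0_compat; lra.
  have k1 := Rmin_l d1 (e / (2 * M)); have k2 := Rmin_r d1 (e / (2 * M)).
  exists (Rmin d1 (e / (2 * M)) / 2); split; first by have := Rmin_pos _ _ h1 h2; lra.
  move=> s' t' _ l; have l' := Rabs_def2 _ _ l.
  have [x1 y1] := H1 0 (2 * t') ltac:(rewrite Rminus_diag Rabs_R0; lra)
    ltac:(apply: Rabs_def1; lra).
  have cl : Rabs (clamp (2 * t' - 1) - clamp (2 * t - 1)) < e / (2 * M).
    apply: Rle_lt_trans (clamp_lip _ _) _.
    by apply: Rabs_def1; lra.
  have S z : Rabs z <= M -> Rabs ((clamp (2 * t' - 1) - clamp (2 * t - 1)) * z) <= e / 2.
    move=> hz; rewrite Rabs_mult.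
    apply: (Rle_trans _ (e / (2 * M) * M)).
      by apply: Rmult_le_compat => //; try exact: Rabs_pos; lra.
    by right; field; lra.
  have Sx := S (fst q - fst p) ltac:(rewrite /M; have := Rabs_pos (snd q - snd p); lra).
  have Sy := S (snd q - snd p) ltac:(rewrite /M; have := Rabs_pos (fst q - fst p); lra).
  rewrite /c'; split=> /=.
  + rewrite (_ : forall a a' k k' z, a' + k' * z - (a + k * z) = (a' - a) + (k' - k) * z);
      last by move=> *; ring.
    by apply: Rle_lt_trans (Rabs_triang _ _) _; simpl in x1; lra.
  + rewrite (_ : forall a a' k k' z, a' + k' * z - (a + k * z) = (a' - a) + (k' - k) * z);
      last by move=> *; ring.
    by apply: Rle_lt_trans (Rabs_triang _ _) _; simpl in y1; lra.
have [Y' [L' e']] := path_lift c' w0 m'.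
have ms : map_in (fun _ t => seg (clamp t)).
  have [ch hO] := m'; split.
    move=> s t e he; have [d [hd Hd]] := ch s (/ 2 * Rmax t 0 + / 2) e he.
    exists d; split=> // s' t' l1 l2.
    have cl x : seg (clamp x) = c' (/ 2 * Rmax x 0 + / 2).
      rewrite hi; last by have := Rmax_r x 0; lra.
      congr seg; rewrite (_ : 2 * _ - 1 = Rmax x 0); last by field.
      rewrite /Rmax; case: Rle_dec => hx //.
      by rewrite !clamp_0; lra.
    rewrite !cl; apply: (Hd s') => //.
    apply: Rle_lt_trans _ l2.
    replace (/ 2 * Rmax t' 0 + / 2 - (/ 2 * Rmax t 0 + / 2)) with (/ 2 * (Rmax t' 0 - Rmax t 0)) by ring.
    rewrite Rabs_mult (Rabs_pos_eq (/ 2)); last lra.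
    have := Rle_abs (t' - t); have := Rle_abs (- (t' - t)); rewrite Rabs_Ropp => i1 i2.
    have : Rabs (Rmax t' 0 - Rmax t 0) <= Rabs (t' - t).
      by apply: Rabs_le; rewrite /Rmax; repeat case: Rle_dec => ?; lra.
    have := Rabs_pos (Rmax t' 0 - Rmax t 0); lra.
  by move=> s t; apply: sO; apply: box_at_segment => //; exact: clamp_in.
have S1 : lift (fun _ t => c t) 0 0 0 1 (fun _ t => Y' 0 (/ 2 * t + 0)).
  apply: (lift_segment _ 0 0 Y' _ _ _ _ L') => [||t ht|t ht]; try lra.
    by rewrite Rabs_pos_eq; lra.
  by rewrite lo; [congr c; lra|lra].
have S2 : lift (fun _ t => seg (clamp t)) 0 0 0 1 (fun _ t => Y' 0 (/ 2 * t + / 2)).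
  apply: (lift_segment _ 0 0 Y' _ _ _ _ L') => [||t ht|t ht]; try lra.
    by rewrite Rabs_pos_eq; lra.
  by rewrite hi; [congr (seg (clamp _)); lra|lra].
have S3 : lift (fun _ t => seg (clamp t)) 0 0 0 1 (fun _ t => at_pt y (seg (clamp t))).
  apply: (lift_of_sol (fun _ t => seg (clamp t)) _ _ _ _ _ _ ms (box_open _ _ _) Hy) => s t _ ht.
  by apply: box_at_segment => //; exact: clamp_in.
have [/(_ _) U1 _] := path_unique c _ _ mc S1 L.
have [/(_ _) U2 _] := path_unique _ _ _ ms S2 S3.
have E0 : / 2 * 0 + 0 = 0 by lra.
have E1 : / 2 * 0 + / 2 = / 2 by lra.
have E2 : / 2 * 1 + 0 = / 2 by lra.
have E3 : / 2 * 1 + / 2 = 1 by lra.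
rewrite E0 E2 in U1; rewrite E1 E3 in U2.
have g0 : seg (clamp 0) = p.
  by rewrite clamp_0 /seg; [case: (p) => ? ? /=; congr pair; ring|lra].
have g1 : seg (clamp 1) = q.
  by rewrite clamp_1 /seg; [case: (p) (q) => ? ? [? ?] /=; congr pair; ring|lra].
rewrite g0 g1 in U2.
exists c', Y'; split; last first.
  split=> //; split=> //; apply: U2.
  apply: eqN_trans _ (eqN_sym _ _ ey); apply: eqN_trans _ t0; apply: U1.
  exact: eqN_trans e' (eqN_sym _ _ s0).
split=> //; split=> t ht; first by rewrite lo ?b //; lra.
rewrite hi; last lra.
by apply: eq_trans _ g1; rewrite !clamp_1; [|lra|lra].
Qed.

(** The value at a point is the initial value transported along any path; it is
    well defined by [reach_unique], and near each point it is a local solution by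
    [reach_extend]. *)
Theorem flat_global_existence p0 w0 : O p0 ->
  exists y, is_sol N P Q O y /\ eqN (at_pt y p0) w0.
Proof.
move=> h0.
have ex p : exists w, O p -> reach p0 w0 p w.
  case: (excluded_middle_informative (O p)) => hp.
    by have [w H] := reach_exists p0 w0 p h0 hp; exists w.
  by exists w0.
pose val p := proj1_sig (constructive_indefinite_description _ (ex p)).
have hval p : O p -> reach p0 w0 p (val p).
  by rewrite /val; case: constructive_indefinite_description.
exists (fun i u v => val (u, v) i); split; last first.
  have r0 : reach p0 w0 p0 w0.
    have mc : map_in (fun _ _ => p0).
      by split=> // s t r hr; exists 1; split; [lra|] => *; exact: box_at_center.
    have [Y [L e]] := path_lift (fun _ => p0) w0 mc.
    exists (fun _ => p0), Y; split; first by split.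
    split=> //; split=> //.
    apply: eqN_trans _ e; apply: (lift_over_point _ 0 0 0 1 Y p0 _ _ _ _ mc L); move=> *; lra || done.
  have := reach_unique _ _ _ _ _ (hval p0 h0) r0.
  by case: (p0) => a b.
move=> u v h i hi.
have [r [hr [sO [E _]]]] := chart (u, v) h.
have [y [Hy ey]] := E (u, v) (val (u, v)) (box_at_center _ _ hr).
have eq q : box_at (u, v) r q -> eqN (val q) (at_pt y q).
  move=> hq; apply: (reach_unique p0 w0 q); first by apply: hval; exact: sO.
  exact: reach_extend (hval _ h) sO Hy ey hq.
have loc : locally_2d (fun x t => forall j, (j <= N)%nat -> y j x t = val (x, t) j) u v.
  exists (mkposreal r hr) => x t hx ht j hj; symmetry.
  by apply: (eq (x, t)) => //; split.
have [cy [dy1 dy2]] := Hy u v (box_at_center _ _ hr) i hi.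
have act_eq T : act N T (fun i u v => val (u, v) i) i u v = act N T y i u v.
  apply: sum_f_R0_ext => j hj; congr (_ * _).
  by symmetry; apply: (locally_2d_singleton _ _ _ loc).
rewrite !act_eq.
have loci : locally_2d (fun x t => y i x t = val (x, t) i) u v.
  by apply: locally_2d_impl loc; apply: locally_2d_forall => x t H; exact: H.
split; first exact: continuity_2d_pt_ext_loc loci cy.
split.
- exact: is_derive_ext_loc (locally_2d_1d_const_y _ _ _ loci) dy1.
- exact: is_derive_ext_loc (locally_2d_1d_const_x _ _ _ loci) dy2.
Qed.

Theorem flat_global_uniqueness y z p0 : is_sol N P Q O y -> is_sol N P Q O z ->
  O p0 -> eqN (at_pt y p0) (at_pt z p0) -> forall p, O p -> eqN (at_pt y p) (at_pt z p).
Proof.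
move=> Hy Hz h0 e p hp; have [c [mc [b f]]] := path_exists p0 p h0 hp.
have into s t : 0 <= s <= 0 -> 0 <= t <= 1 -> O (c t) by move=> _ _; exact: (proj2 mc 0).
have Ly := lift_of_sol _ _ _ _ _ _ _ mc oO Hy into.
have Lz := lift_of_sol _ _ _ _ _ _ _ mc oO Hz into.
have [U _] := path_unique c _ _ mc Ly Lz.
rewrite (b 0) in U; last lra.
by rewrite (f 1) in U; [apply: U|lra].
Qed.

End Lift.

(** * Smoothness of solutions, closed forms, angles *)

Section Consequences.

Variable O : R * R -> Prop.
Hypothesis oO : open O.

Lemma alg_sum B N f : (forall j, (j <= N)%nat -> alg O B (f j)) ->
  alg O B (fun u v => sum_f_R0 (fun j => f j u v) N).
Proof.
elim: N => [|N IH] H /=; first exact: H.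
apply: (alg_plus O B (fun u v => sum_f_R0 (fun j => f j u v) N)); last exact: H.
by apply: IH => j hj; apply: H; lia.
Qed.

Lemma is_sol_du N P Q y i u v : is_sol N P Q O y -> (i <= N)%nat -> O (u, v) ->
  du (y i) u v = act N P y i u v.
Proof. by move=> H hi o; have [_ [d _]] := H u v o i hi; exact: is_derive_unique. Qed.

Lemma is_sol_dv N P Q y i u v : is_sol N P Q O y -> (i <= N)%nat -> O (u, v) ->
  dv (y i) u v = act N Q y i u v.
Proof. by move=> H hi o; have [_ [_ d]] := H u v o i hi; exact: is_derive_unique. Qed.

(** Bootstrapping: the derivatives of a solution are again combinations of its
    components with smooth coefficients. *)
Lemma is_sol_smooth N P Q y i : smooth_matrix N O P -> smooth_matrix N O Q ->
  is_sol N P Q O y -> (i <= N)%nat -> smooth O (y i).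
Proof.
move=> sP sQ H hi.
pose B f := exists j, (j <= N)%nat /\ f = y j.
apply: (smooth_coind O oO B); last by apply: alg_gen; exists i.
move=> _ [j [hj ->]].
have al T : smooth_matrix N O T -> alg O B (act N T y j).
  move=> sT; apply: alg_sum => k hk; apply: alg_mult.
    by apply: alg_smooth; exact: sT.
  by apply: alg_gen; exists k.
split.
  move=> u v o; have [c [d1 d2]] := H u v o j hj.
  exact: (conj c (conj (ex_intro _ _ d1) (ex_intro _ _ d2))).
split.
  by exists (act N P y j); split; [exact: al|move=> u v o; exact: (is_sol_du _ _ _ _ _ _ _ H)].
by exists (act N Q y j); split; [exact: al|move=> u v o; exact: (is_sol_dv _ _ _ _ _ _ _ H)].
Qed.

Lemma smooth_is_sol N P Q y : (forall i, (i <= N)%nat -> smooth O (y i)) ->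
  (forall u v i, O (u, v) -> (i <= N)%nat ->
     du (y i) u v = act N P y i u v /\ dv (y i) u v = act N Q y i u v) ->
  is_sol N P Q O y.
Proof.
move=> sy H u v o i hi; have [<- <-] := H u v i o hi; have s := sy i hi.
split; first exact: smooth_cont o.
by split; apply: Derive_correct; [exact: smooth_ex_u o|exact: smooth_ex_v o].
Qed.

(** A solution is annihilated by the curvature of its system, since its mixed
    second derivatives coincide. *)
Lemma is_sol_curv N P Q y i u v : smooth_matrix N O P -> smooth_matrix N O Q ->
  is_sol N P Q O y -> (i <= N)%nat -> O (u, v) ->
  sum_f_R0 (fun j => curv N P Q i j u v * y j u v) N = 0.
Proof.
move=> sP sQ H hi o.
have sy j : (j <= N)%nat -> smooth O (y j) by exact: is_sol_smooth H.
have E : dv (act N P y i) u v = du (act N Q y i) u v.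
  transitivity (dv (du (y i)) u v).
    apply: (agree_dv O oO) o => x t h; symmetry; exact: (is_sol_du _ _ _ _ _ _ _ H).
  rewrite -(du_dv O oO) //; last exact: sy.
  apply: (agree_du O oO) o => x t h; exact: (is_sol_dv _ _ _ _ _ _ _ H).
have Ev : dv (act N P y i) u v =
    sum_f_R0 (fun j => dv (P i j) u v * y j u v + P i j u v * act N Q y j u v) N.
  apply: is_derive_unique.
  apply: (is_derive_sum N (fun j x => P i j u x * y j u x)) => j hj.
  rewrite -(is_sol_dv N P Q) //.
  rewrite -(dv_mult O) //; [|exact: sP|exact: sy].
  apply: Derive_correct; apply: (smooth_ex_v O (fun x t => P i j x t * y j x t)) o.
  by apply: (smooth_mult O oO); [exact: sP|exact: sy].
have Eu : du (act N Q y i) u v =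
    sum_f_R0 (fun j => du (Q i j) u v * y j u v + Q i j u v * act N P y j u v) N.
  apply: is_derive_unique.
  apply: (is_derive_sum N (fun j x => Q i j x v * y j x v)) => j hj.
  rewrite -(is_sol_du N P Q) //.
  rewrite -(du_mult O) //; [|exact: sQ|exact: sy].
  apply: Derive_correct; apply: (smooth_ex_u O (fun x t => Q i j x t * y j x t)) o.
  by apply: (smooth_mult O oO); [exact: sQ|exact: sy].
rewrite -curv_act -sum_plus -minus_sum.
rewrite -[RHS](Rminus_diag (dv (act N P y i) u v)) [X in _ = _ - X]E Ev Eu -minus_sum.
by apply: sum_f_R0_ext => j _; ring.
Qed.

Hypothesis sc : simply_connected O.

Lemma zero_derivative_constant f : smooth O f ->
  (forall u v, O (u, v) -> du f u v = 0 /\ dv f u v = 0) ->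
  forall u v u' v', O (u, v) -> O (u', v') -> f u v = f u' v'.
Proof.
move=> sf H u v u' v' o o'.
pose Z := fun (_ _ : nat) (_ _ : R) => 0.
have sZ : smooth_matrix 0 O Z by move=> *; exact: smooth_const.
have flZ : flat 0 O Z Z.
  by move=> x y h i j _ _; rewrite /curv /= dv_const du_const /Z; ring.
have sol g : smooth O g -> (forall u v, O (u, v) -> du g u v = 0 /\ dv g u v = 0) ->
    is_sol 0 Z Z O (fun _ => g).
  move=> sg Hg; apply: smooth_is_sol => // x y i h _.
  by rewrite /act /= /Z Rmult_0_l; exact: Hg.
have := flat_global_uniqueness 0 O Z Z oO sZ sZ flZ sc (fun _ => f) (fun _ _ _ => f u' v')
  (u', v') (sol f sf H).
move=> /(_ (sol _ (smooth_const O _) (fun x y _ => conj (du_const _ x y) (dv_const _ x y)))).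
by move=> /(_ o' (fun i _ => erefl) (u, v) o 0%nat (Nat.le_refl _)).
Qed.

(** The Poincare lemma: [psi] solves a flat system together with the constant
    function one. *)
Lemma closed_form_exact w1 w2 u0 v0 a : smooth O w1 -> smooth O w2 ->
  (forall u v, O (u, v) -> dv w1 u v = du w2 u v) -> O (u0, v0) ->
  exists psi, smooth O psi /\ psi u0 v0 = a /\
    forall u v, O (u, v) -> du psi u v = w1 u v /\ dv psi u v = w2 u v.
Proof.
move=> s1 s2 cl o.
pose M (w : R -> R -> R) (i j : nat) : R -> R -> R :=
  if Nat.eqb i 0 then (if Nat.eqb j 1 then w else fun _ _ => 0) else fun _ _ => 0.
have sM w : smooth O w -> smooth_matrix 1 O (M w).
  move=> sw i j _ _; rewrite /M; case: Nat.eqb; last exact: smooth_const.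
  by case: Nat.eqb => //; exact: smooth_const.
have flM : flat 1 O (M w1) (M w2).
  move=> u v h [|[|i]] [|[|j]] hi hj; try lia; rewrite /curv /= /M /= ?dv_const ?du_const;
    try ring.
  by rewrite cl //; ring.
have [y [Hy ey]] := flat_global_existence 1 O _ _ oO (sM _ s1) (sM _ s2) flM sc (u0, v0)
  (fun i => if Nat.eqb i 0 then a else 1) o.
have sy i : (i <= 1)%nat -> smooth O (y i) by exact: is_sol_smooth (sM _ s1) (sM _ s2) Hy.
have y1 u v : O (u, v) -> y 1%nat u v = 1.
  move=> h; rewrite (zero_derivative_constant (y 1%nat) _ _ u v u0 v0) //.
  - by have := ey 1%nat (Nat.le_refl _).
  - by apply: sy.
  - move=> x t hx; rewrite (is_sol_du _ _ _ _ _ _ _ Hy) // (is_sol_dv _ _ _ _ _ _ _ Hy) //.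
    by rewrite /act /= /M /=; split; ring.
exists (y 0%nat); split; first by apply: sy; lia.
split; first by have := ey 0%nat (Nat.le_0_l _).
move=> u v h.
rewrite (is_sol_du _ _ _ _ _ _ _ Hy) //; last lia.
rewrite (is_sol_dv _ _ _ _ _ _ _ Hy) //; last lia.
by rewrite /act /= /M /= y1 //; split; ring.
Qed.

Lemma circle_angle a b : a * a + b * b = 1 -> exists t, cos t = a /\ sin t = b.
Proof.
move=> e; have ha : -1 <= a <= 1 by nra.
have e' : sin (acos a) * sin (acos a) = b * b.
  by rewrite sin_acos // sqrt_sqrt /Rsqr; nra.
have [h|h] : sin (acos a) = b \/ sin (acos a) = - b.
  have : (sin (acos a) - b) * (sin (acos a) + b) = 0 by lra.
  by case/Rmult_integral => h; [left|right]; lra.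
- by exists (acos a); rewrite cos_acos.
- by exists (- acos a); rewrite cos_neg sin_neg cos_acos // h; split; ring.
Qed.

Lemma smooth_cos_sin f : smooth O f ->
  smooth O (fun u v => cos (f u v)) /\ smooth O (fun u v => sin (f u v)).
Proof.
move=> sf; have H := smooth_comp O oO (fun h => h = cos \/ h = sin) f sf.
have {}H : forall h, h = cos \/ h = sin -> smooth O (fun u v => h (f u v)).
  apply: H => h [->|->].
  - exists (fun x => -1 * sin x); split.
      by move=> u v _; auto_derive => //; ring.
    apply: (alg_mult O _ (fun _ _ => -1)); first by apply: alg_smooth; exact: smooth_const.
    by apply: alg_gen; exists sin; split; [right|].
  - exists cos; split; first by move=> u v _; exact: is_derive_sin.
    by apply: alg_gen; exists cos; split; [left|].
by split; [apply: (H cos); left|apply: (H sin); right].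
Qed.

Lemma du_cos f u v : smooth O f -> O (u, v) ->
  du (fun x y => cos (f x y)) u v = - sin (f u v) * du f u v.
Proof. by move=> sf o; apply: (du_comp O cos) => //; exact: is_derive_cos. Qed.

Lemma dv_cos f u v : smooth O f -> O (u, v) ->
  dv (fun x y => cos (f x y)) u v = - sin (f u v) * dv f u v.
Proof. by move=> sf o; apply: (dv_comp O cos) => //; exact: is_derive_cos. Qed.

Lemma du_sin f u v : smooth O f -> O (u, v) ->
  du (fun x y => sin (f x y)) u v = cos (f u v) * du f u v.
Proof. by move=> sf o; apply: (du_comp O sin) => //; exact: is_derive_sin. Qed.

Lemma dv_sin f u v : smooth O f -> O (u, v) ->
  dv (fun x y => sin (f x y)) u v = cos (f u v) * dv f u v.
Proof. by move=> sf o; apply: (dv_comp O sin) => //; exact: is_derive_sin. Qed.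

(** A smooth map to the unit circle has a smooth angle: integrate
    [a db - b da]. *)
Lemma angle_lift a b : smooth O a -> smooth O b ->
  (forall u v, O (u, v) -> a u v * a u v + b u v * b u v = 1) ->
  exists psi, smooth O psi /\
    forall u v, O (u, v) -> cos (psi u v) = a u v /\ sin (psi u v) = b u v.
Proof.
move=> sa sb e.
have [[[u0 v0] o0] _] := sc.
have sm := smooth_mult O oO.
have s1 : smooth O (fun u v => a u v * du b u v - b u v * du a u v).
  by apply: smooth_minus => //; apply: sm => //; exact: smooth_du.
have s2 : smooth O (fun u v => a u v * dv b u v - b u v * dv a u v).
  by apply: smooth_minus => //; apply: sm => //; exact: smooth_dv.
have eu u v : O (u, v) -> a u v * du a u v + b u v * du b u v = 0.
  move=> o; have : du (fun u v => a u v * a u v + b u v * b u v) u v = 0.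
    by rewrite (agree_du O oO _ (fun _ _ => 1)) ?du_const.
  by rewrite (du_plus O) ?(du_mult O); auto; lra.
have ev u v : O (u, v) -> a u v * dv a u v + b u v * dv b u v = 0.
  move=> o; have : dv (fun u v => a u v * a u v + b u v * b u v) u v = 0.
    by rewrite (agree_dv O oO _ (fun _ _ => 1)) ?dv_const.
  by rewrite (dv_plus O) ?(dv_mult O); auto; lra.
have cl u v : O (u, v) -> dv (fun u v => a u v * du b u v - b u v * du a u v) u v =
    du (fun u v => a u v * dv b u v - b u v * dv a u v) u v.
  move=> o; have sda := smooth_du O _ sa; have sdb := smooth_du O _ sb.
  have sva := smooth_dv O _ sa; have svb := smooth_dv O _ sb.
  rewrite (dv_minus O) ?(dv_mult O) ?(du_minus O) ?(du_mult O); auto.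
  rewrite !(du_dv O oO) //.
  (* The gradients of a and b are both orthogonal to (a, b), hence parallel. *)
  have par : du a u v * dv b u v - dv a u v * du b u v = 0.
    have i1 := eu u v o; have i2 := ev u v o; have i3 := e u v o.
    have -> : du a u v * dv b u v - dv a u v * du b u v =
      (a u v * a u v + b u v * b u v) * (du a u v * dv b u v - dv a u v * du b u v).
      by rewrite i3; ring.
    have -> : (a u v * a u v + b u v * b u v) * (du a u v * dv b u v - dv a u v * du b u v)
      = (a u v * du a u v + b u v * du b u v) * (a u v * dv b u v - b u v * dv a u v)
        - (a u v * dv a u v + b u v * dv b u v) * (a u v * du b u v - b u v * du a u v) by ring.
    by rewrite i1 i2; ring.
  lra.
have [t0 [c0 d0]] := circle_angle _ _ (e _ _ o0).
have [psi [sp [p0 Hp]]] := closed_form_exact _ _ u0 v0 t0 s1 s2 cl o0.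
have [scos ssin] := smooth_cos_sin psi sp.
exists psi; split=> // u v o.
have K : cos (psi u v) * a u v + sin (psi u v) * b u v = 1.
  rewrite (zero_derivative_constant (fun u v => cos (psi u v) * a u v + sin (psi u v) * b u v)
    _ _ u v u0 v0) //.
  - by rewrite p0 c0 d0; exact: e.
  - by apply: smooth_plus => //; exact: sm.
  - move=> x y h; have [pu pv] := Hp x y h.
    have i1 := eu x y h; have i2 := ev x y h; have i3 := e x y h.
    rewrite (du_plus O) ?(du_mult O) ?(dv_plus O) ?(dv_mult O); auto.
    rewrite du_cos // du_sin // dv_cos // dv_sin // pu pv; split.
    + have -> : - sin (psi x y) * (a x y * du b x y - b x y * du a x y) * a x y +
        cos (psi x y) * du a x y +
        (cos (psi x y) * (a x y * du b x y - b x y * du a x y) * b x y +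
        sin (psi x y) * du b x y) =
        sin (psi x y) * (b x y * (a x y * du a x y + b x y * du b x y) +
          du b x y * (1 - (a x y * a x y + b x y * b x y))) +
        cos (psi x y) * (a x y * (a x y * du a x y + b x y * du b x y) +
          du a x y * (1 - (a x y * a x y + b x y * b x y))) by ring.
      by rewrite i1 i3; ring.
    + have -> : - sin (psi x y) * (a x y * dv b x y - b x y * dv a x y) * a x y +
        cos (psi x y) * dv a x y +
        (cos (psi x y) * (a x y * dv b x y - b x y * dv a x y) * b x y +
        sin (psi x y) * dv b x y) =
        sin (psi x y) * (b x y * (a x y * dv a x y + b x y * dv b x y) +
          dv b x y * (1 - (a x y * a x y + b x y * b x y))) +
        cos (psi x y) * (a x y * (a x y * dv a x y + b x y * dv b x y) +
          dv a x y * (1 - (a x y * a x y + b x y * b x y))) by ring.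
      by rewrite i2 i3; ring.
have := e u v o; have := sin2_cos2 (psi u v); rewrite /Rsqr => k1 k2.
have z : (cos (psi u v) - a u v) * (cos (psi u v) - a u v) +
  (sin (psi u v) - b u v) * (sin (psi u v) - b u v) = 0 by lra.
by have [z1 z2] := Rplus_sqr_eq_0 _ _ z; split; exact: Rminus_diag_uniq.
Qed.

Lemma nonzero_constant_sign h u0 v0 u v : smooth O h ->
  (forall u v, O (u, v) -> h u v <> 0) -> O (u0, v0) -> O (u, v) ->
  0 < h u0 v0 -> 0 < h u v.
Proof.
move=> sh nz o0 o p0.
have [c [[ch hO] [b f]]] := path_exists O sc (u0, v0) (u, v) o0 o.
have P01 := locally_constant_interval (fun t => 0 < h (fst (c t)) (snd (c t))) 0 1 Rle_0_1.
have : 0 < h (fst (c 1)) (snd (c 1)).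
  apply: (P01 _ 0 1); try lra; last by rewrite (b 0) //; lra.
  move=> t _; have oc : O (fst (c t), snd (c t)) by move: (hO 0 t); case: (c t).
  have e0 : 0 < Rabs (h (fst (c t)) (snd (c t))) by apply: Rabs_pos_lt; exact: nz.
  have [d Hd] := smooth_cont O h _ _ sh oc (mkposreal _ e0).
  have [e [he He]] := ch 0 t d (cond_pos d).
  exists e; split=> // t' _ l.
  have [l1 l2] := He 0 t' ltac:(rewrite Rminus_diag Rabs_R0; lra) l.
  have := Hd _ _ l1 l2 => /=.
  rewrite /Rabs; case: Rcase_abs => x; case: Rcase_abs => y; lra.
by rewrite (f 1) //; lra.
Qed.

End Consequences.

(** * Algebra of the potentials *)

Lemma Ci2 : (Ci * Ci = - (1))%C.
Proof. by apply: injective_projections => /=; ring. Qed.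

Lemma Cconj_Ci : Cconj Ci = (- Ci)%C.
Proof. by apply: injective_projections => /=; ring. Qed.

Lemma Cconj_RtoC (x : R) : Cconj (RtoC x) = RtoC x.
Proof. by apply: injective_projections => /=; ring. Qed.

Lemma Cconj_neq0 (z : C) : z <> 0%C -> Cconj z <> 0%C.
Proof. by move=> nz e; apply: nz; rewrite -(Cconj_conj z) e Cconj_RtoC. Qed.

Lemma RtoC_2Re (z : C) : RtoC (2 * Re z) = (z + Cconj z)%C.
Proof. by apply: injective_projections => /=; rewrite /Re; ring. Qed.

Lemma RtoC_2Im (z : C) : RtoC (2 * Im z) = (- Ci * (z - Cconj z))%C.
Proof. by apply: injective_projections => /=; rewrite /Im; ring. Qed.

Lemma Re_eq_iff (z w : C) : Re z = Re w <-> (z + Cconj z = w + Cconj w)%C.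
Proof.
rewrite -!RtoC_2Re; split=> [->//|/RtoC_inj]; lra.
Qed.

Lemma Im_eq0_iff (z : C) : Im z = 0 <-> z = Cconj z.
Proof.
case: z => a b /=; split=> [->|[= e]]; last lra.
by rewrite /Cconj /= Ropp_0.
Qed.

Lemma real_eq (z : C) : z = Cconj z -> z = RtoC (Re z).
Proof. by case: z => a b [= e]; congr pair; rewrite /=; lra. Qed.

Lemma Cmult_neq0_l (z w : C) : (z * w <> 0)%C -> z <> 0%C.
Proof. by move=> nz e; apply: nz; rewrite e; ring. Qed.

Lemma Cmult_neq0_r (z w : C) : (z * w <> 0)%C -> w <> 0%C.
Proof. by move=> nz e; apply: nz; rewrite e; ring. Qed.

Lemma Cmult_cancel (z w x : C) : z <> 0%C -> (z * w = z * x)%C -> w = x.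
Proof.
move=> nz e.
have -> : w = (/ z * (z * w))%C by field.
by rewrite e; field.
Qed.

Lemma Cmult_eq0 (z w : C) : (z * w = 0)%C -> z <> 0%C -> w = 0%C.
Proof. by move=> e nz; apply: (Cmult_cancel z) => //; rewrite e; ring. Qed.

Lemma Copp_neq0 (z : C) : z <> 0%C -> (- z)%C <> 0%C.
Proof.
move=> nz e; apply: nz; have -> : z = (- - z)%C by ring.
by rewrite e; ring.
Qed.

Ltac Cconj_push := repeat match goal with
  | |- context [Cconj (Cplus ?a ?b)] => rewrite (Cplus_conj a b)
  | |- context [Cconj (Cminus ?a ?b)] => rewrite (Cminus_conj a b)
  | |- context [Cconj (Cmult ?a ?b)] => rewrite (Cmult_conj a b)
  | |- context [Cconj (Copp ?a)] => rewrite (Copp_conj a)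
  | |- context [Cconj (Cdiv ?a ?b)] => rewrite (Cdiv_conj a b); last by []
  | |- context [Cconj (Cconj ?a)] => rewrite (Cconj_conj a)
  | |- context [Cconj (RtoC ?a)] => rewrite (Cconj_RtoC a)
  | |- context [Cconj Ci] => rewrite Cconj_Ci
  end.

Section Algebra.

(** [p] and [q] stand for the derivatives [f_u], [f_v]. *)
Variables p q : C.

(** [cA], [cB], [cJ] are the functions [A], [B], [i A'] of the conditions, and
    condition (ii) says that [cr] is real. *)
Definition cA : C := (p * Cconj q + Cconj p * q)%C.
Definition cB : C := (p * Cconj p - q * Cconj q)%C.
Definition cJ : C := (p * Cconj q - Cconj p * q)%C.
Definition cr : C := (p * p + q * q)%C.

Lemma cA_conj : Cconj cA = cA.
Proof. by rewrite /cA; Cconj_push; ring. Qed.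

Lemma cB_conj : Cconj cB = cB.
Proof. by rewrite /cB; Cconj_push; ring. Qed.

Lemma cA2_cB2 : (cA * cA + cB * cB = cr * Cconj cr)%C.
Proof. by rewrite /cA /cB /cr; Cconj_push; ring. Qed.

Variables k s : C.
Hypothesis s0 : s <> 0%C.
Hypothesis ss : (s * s = k * k - 1)%C.

Let sb0 : Cconj s <> 0%C := Cconj_neq0 _ s0.
Let ssb : (Cconj s * Cconj s = Cconj k * Cconj k - 1)%C.
Proof. by rewrite -Cmult_conj ss; Cconj_push. Qed.

(** The formulas for [W] and [X] give one value of [alpha_2], and those for [Y]
    and [Z] one value of [beta_2]. *)
Definition cons : Prop :=
  Re (k * (p / s)) = Re (Ci * q / s) /\ Re (k * (Ci * q / s)) = Re (p / s).

Lemma cons_eqs : cons <->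
  (k * (p / s) + Cconj k * (Cconj p / Cconj s) =
    Ci * q / s - Ci * Cconj q / Cconj s)%C /\
  (k * (Ci * q / s) - Cconj k * (Ci * Cconj q / Cconj s) =
    p / s + Cconj p / Cconj s)%C.
Proof.
rewrite /cons !Re_eq_iff.
have -> : Cconj (k * (p / s)) = (Cconj k * (Cconj p / Cconj s))%C.
  by rewrite Cmult_conj Cdiv_conj.
have -> : Cconj (k * (Ci * q / s)) = (- (Cconj k * (Ci * Cconj q / Cconj s)))%C.
  by rewrite Cmult_conj Cdiv_conj // Cmult_conj Cconj_Ci; field.
have -> : Cconj (Ci * q / s) = (- (Ci * Cconj q / Cconj s))%C.
  by rewrite Cdiv_conj // Cmult_conj Cconj_Ci; field.
by rewrite Cdiv_conj.
Qed.

(** The two real conditions on [k] are linear in [k] and its conjugate;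
    eliminating the conjugate solves them for [k]. *)
Lemma cons_solved : cons -> (cA * k + Ci * cB = - Ci * (Cconj cr * (s / Cconj s)))%C.
Proof.
move=> /cons_eqs [E1 E2].
have -> : (cA * k = - Ci * s * (Ci * Cconj q * (k * (p / s) + Cconj k * (Cconj p / Cconj s)) +
    Cconj p * (k * (Ci * q / s) - Cconj k * (Ci * Cconj q / Cconj s))))%C.
  by rewrite /cA; field [Ci2]; split.
by rewrite E1 E2 /cB /cr; Cconj_push; field [Ci2]; split.
Qed.

Lemma solved_cons : cA <> 0%C -> cr = Cconj cr ->
  (cA * k + Ci * cB = - Ci * (cr * (s / Cconj s)))%C -> cons.
Proof.
move=> A0 rr E; apply/cons_eqs.
have Ek : (cA * k = - Ci * cB - Ci * (cr * (s / Cconj s)))%C.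
  have -> : (cA * k = (cA * k + Ci * cB) - Ci * cB)%C by ring.
  by rewrite E; ring.
have Ekb : (cA * Cconj k = Ci * cB + Ci * (cr * (Cconj s / s)))%C.
  rewrite -{1}cA_conj -Cmult_conj Ek; Cconj_push.
  by rewrite -rr cB_conj; ring.
have rb : (cr = Cconj p * Cconj p + Cconj q * Cconj q)%C.
  by rewrite rr /cr; Cconj_push.
split; apply: (Cmult_cancel cA) => //.
- have -> : (cA * (k * (p / s) + Cconj k * (Cconj p / Cconj s)) =
    (cA * k) * (p / s) + (cA * Cconj k) * (Cconj p / Cconj s))%C by ring.
  rewrite Ek Ekb.
  have -> : ((- Ci * cB - Ci * (cr * (s / Cconj s))) * (p / s) +
      (Ci * cB + Ci * (cr * (Cconj s / s))) * (Cconj p / Cconj s) =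
    Ci * ((cr * Cconj p - cB * p) / s - (cr * p - cB * Cconj p) / Cconj s))%C
    by field.
  have -> : (cr * Cconj p - cB * p = cA * q)%C by rewrite /cr /cA /cB; ring.
  have -> : (cr * p - cB * Cconj p = cA * Cconj q)%C by rewrite rb /cA /cB; ring.
  by field.
- have -> : (cA * (k * (Ci * q / s) - Cconj k * (Ci * Cconj q / Cconj s)) =
    (cA * k) * (Ci * q / s) - (cA * Cconj k) * (Ci * Cconj q / Cconj s))%C by ring.
  rewrite Ek Ekb.
  have -> : ((- Ci * cB - Ci * (cr * (s / Cconj s))) * (Ci * q / s) -
      (Ci * cB + Ci * (cr * (Cconj s / s))) * (Ci * Cconj q / Cconj s) =
    (cB * q + cr * Cconj q) / s + (cB * Cconj q + cr * q) / Cconj s)%C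
    by field [Ci2].
  have -> : (cB * q + cr * Cconj q = cA * p)%C by rewrite /cr /cA /cB; ring.
  have -> : (cB * Cconj q + cr * q = cA * Cconj p)%C by rewrite rb /cA /cB; ring.
  by field.
Qed.

(** With [cA = cr cos psi] and [cB = - cr sin psi] these two identities are
    relation (v). *)
Lemma cr_rotation_u : (cr * Cconj p = cA * q + cB * p)%C.
Proof. by rewrite /cr /cA /cB; ring. Qed.

Lemma cr_rotation_v : (cr * Cconj q = cA * p - cB * q)%C.
Proof. by rewrite /cr /cA /cB; ring. Qed.

Lemma cr_neq0 : cA <> 0%C -> cr <> 0%C.
Proof.
move=> A0 r0; apply: A0.
have := cA2_cB2; rewrite r0 Cmult_0_l (real_eq cA (esym cA_conj)) (real_eq cB (esym cB_conj)).
rewrite -!RtoC_mult -RtoC_plus => /RtoC_inj e; congr RtoC; nra.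
Qed.

(** The value of [k] obtained by elimination satisfies [s^2 = k^2 - 1] only if
    [f_u^2 + f_v^2] is real. *)
Lemma solved_cr_real : cA <> 0%C ->
  (cA * k + Ci * cB = - Ci * (Cconj cr * (s / Cconj s)))%C -> cr = Cconj cr.
Proof.
move=> A0 E.
have Ek : (cA * k = - Ci * (cB + Cconj cr * (s / Cconj s)))%C.
  have -> : (cA * k = (cA * k + Ci * cB) - Ci * cB)%C by ring.
  by rewrite E; ring.
set T := (cr * (Cconj s / s) + Cconj cr * (s / Cconj s) + cB + cB)%C.
have K1 : (Cconj cr * T = - (cA * cA * (s * Cconj s)))%C.
  have K : (cA * cA * (s * s) + cA * cA = - ((cB + Cconj cr * (s / Cconj s)) *
      (cB + Cconj cr * (s / Cconj s))))%C.
    have -> : (cA * cA * (s * s) + cA * cA = (cA * k) * (cA * k))%C by rewrite ss; ring.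
    by rewrite Ek; ring [Ci2].
  have -> : (cA * cA * (s * Cconj s) = (Cconj s / s) * (cA * cA * (s * s) + cA * cA)
      - (Cconj s / s) * (cA * cA + cB * cB) + (Cconj s / s) * (cB * cB))%C by field.
  by rewrite K cA2_cB2 /T; field; split.
have Tc : Cconj T = T.
  by rewrite /T; Cconj_push; rewrite cB_conj; ring.
have K2 : (cr * T = - (cA * cA * (s * Cconj s)))%C.
  rewrite -{1}Tc -{1}(Cconj_conj cr) -Cmult_conj K1; Cconj_push; rewrite cA_conj; ring.
apply: (Cmult_cancel T).
  apply: (Cmult_neq0_r cr); rewrite K2; apply: Copp_neq0.
  by apply: Cmult_neq_0; apply: Cmult_neq_0.
by rewrite (Cmult_comm T cr) (Cmult_comm T (Cconj cr)) K2 K1.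
Qed.

(** The product of [cA k + i cB] with its conjugate is [cr^2 = cA^2 + cB^2], which
    is relation (iv) after division by [cA]. *)
Lemma solved_iv : cA <> 0%C -> cr = Cconj cr ->
  (cA * k + Ci * cB = - Ci * (cr * (s / Cconj s)))%C ->
  (cA * k + Ci * cB <> 0)%C /\
  (Cconj k = (Ci * cB * k + cA) / (cA * k + Ci * cB))%C.
Proof.
move=> A0 rr E.
have nz : (cA * k + Ci * cB <> 0)%C.
  rewrite E; apply: Cmult_neq_0.
    by apply: Copp_neq0; exact: Ci_nz.
  apply: Cmult_neq_0; first exact: cr_neq0.
  apply: (Cmult_neq0_l _ (Cconj s)).
  by have -> : (s / Cconj s * Cconj s = s)%C by field.
split=> //; apply: (Cmult_cancel (cA * k + Ci * cB)) => //.
have -> : ((cA * k + Ci * cB) * ((Ci * cB * k + cA) / (cA * k + Ci * cB)) =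
  Ci * cB * k + cA)%C by field.
apply: (Cmult_cancel cA) => //.
have Eb : (cA * Cconj k - Ci * cB = Ci * (cr * (Cconj s / s)))%C.
  have -> : (cA * Cconj k - Ci * cB = Cconj (cA * k + Ci * cB))%C.
    by Cconj_push; rewrite cA_conj cB_conj; ring.
  by rewrite E; Cconj_push; rewrite -rr; ring.
have -> : (cA * ((cA * k + Ci * cB) * Cconj k) = (cA * k + Ci * cB) * (cA * Cconj k - Ci * cB)
    + cA * (Ci * cB * k) + Ci * Ci * cB * cB)%C by ring.
rewrite E Eb.
have -> : (- Ci * (cr * (s / Cconj s)) * (Ci * (cr * (Cconj s / s))) = cr * cr)%C
  by field [Ci2].
rewrite {2}rr -cA2_cB2; ring [Ci2].
Qed.

(** Conversely, (ii) and (iv) determine the square of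
    [i (cA k + i cB) conj s / s]. *)
Lemma iv_sign : cA <> 0%C -> cr = Cconj cr -> (cA * k + Ci * cB <> 0)%C ->
  (Cconj k = (Ci * cB * k + cA) / (cA * k + Ci * cB))%C ->
  (Ci * (cA * k + Ci * cB) * (Cconj s / s) = cr)%C \/
  (Ci * (cA * k + Ci * cB) * (Cconj s / s) = - cr)%C.
Proof.
set G := (cA * k + Ci * cB)%C => A0 rr G0 iv.
have Gb : Cconj G = (cA * Cconj k - Ci * cB)%C.
  by rewrite /G; Cconj_push; rewrite cA_conj cB_conj; ring.
have Gk : (G * Cconj k = Ci * cB * k + cA)%C by rewrite iv; field.
have Gbk : (Cconj G * k = - (Ci * cB * Cconj k) + cA)%C.
  rewrite -{1}(Cconj_conj k) -Cmult_conj Gk; Cconj_push.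
  by rewrite cA_conj cB_conj; ring.
have GG : (G * Cconj G = cr * cr)%C.
  rewrite {2}rr -cA2_cB2 Gb.
  have -> : (G * (cA * Cconj k - Ci * cB) = cA * (G * Cconj k) - Ci * cB * G)%C by ring.
  by rewrite Gk /G; ring [Ci2].
have Gs : (G * (Cconj s * Cconj s) = - (Cconj G * (s * s)))%C.
  rewrite ssb ss.
  have -> : (G * (Cconj k * Cconj k - 1) = (G * Cconj k) * Cconj k - G)%C by ring.
  have -> : (Cconj G * (k * k - 1) = (Cconj G * k) * k - Cconj G)%C by ring.
  by rewrite Gk Gbk Gb /G; ring.
set H := (Ci * G * (Cconj s / s))%C.
have HH : (H * H = cr * cr)%C.
  rewrite -GG.
  have -> : (H * H = - (G * (G * (Cconj s * Cconj s))) / (s * s))%C.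
    by rewrite /H; field [Ci2].
  by rewrite Gs; field.
have : ((H - cr) * (H + cr) = 0)%C.
  have -> : ((H - cr) * (H + cr) = H * H - cr * cr)%C by ring.
  by rewrite HH; ring.
case: (classic (H - cr = 0)%C) => [e _|n /Cmult_eq0 e].
  left; transitivity (H - cr + cr)%C; first by ring.
  by rewrite e; ring.
right; transitivity (H + cr - cr)%C; first by ring.
by rewrite (e n); ring.
Qed.

Lemma sign_solved e : (Ci * (cA * k + Ci * cB) * (Cconj s / s) = e)%C ->
  (cA * k + Ci * cB = - Ci * (e * (s / Cconj s)))%C.
Proof. by move=> <-; field [Ci2]. Qed.

Lemma solved_sign e : (cA * k + Ci * cB = - Ci * (e * (s / Cconj s)))%C ->
  (Ci * (cA * k + Ci * cB) * (Cconj s / s) = e)%C.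
Proof. by move=> ->; field [Ci2]; split. Qed.

(** Here [ku], [kv] stand for the derivatives of [k], [lu], [lv] for those of
    [lambda], and [m1], [m2] for [mu_1], [mu_2]; below, [psu], [psv] are the
    derivatives of [psi].  Note that [ku / (k^2 - 1)] is half the logarithmic
    derivative of [(k - 1) / (k + 1)]. *)
Definition codazzi (ku kv lu lv m1 m2 : C) : Prop :=
  (p * (kv / (k * k - 1) - m2 - Ci * lu) = q * (ku / (k * k - 1) - m1 + Ci * lv))%C.

(** The conjugate of the Codazzi equation is a second linear equation for the
    same two unknowns [ku / (k^2 - 1) - m1] and [kv / (k^2 - 1) - m2], whose
    imaginary parts are known; the determinant of the system is [cJ]. *)
Lemma codazzi_vi (ku kv : C) (psu psv lu lv m1 m2 : R) : cJ <> 0%C ->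
  (ku / (k * k - 1) - Cconj (ku / (k * k - 1)) = - Ci * psu)%C ->
  (kv / (k * k - 1) - Cconj (kv / (k * k - 1)) = - Ci * psv)%C ->
  codazzi ku kv lu lv m1 m2 ->
  (RtoC m1 = ku / (k * k - 1) - Ci * ((Cconj p * psv - Cconj q * psu) / cJ) * p
    - Ci / cJ * ((1 + 1) * (p * Cconj p) * lu + cA * lv))%C /\
  (RtoC m2 = kv / (k * k - 1) - Ci * ((Cconj p * psv - Cconj q * psu) / cJ) * q
    - Ci / cJ * (cA * lu + (1 + 1) * (q * Cconj q) * lv))%C.
Proof.
rewrite /codazzi; set a0 := (ku / _)%C; set b0 := (kv / _)%C.
move=> J0 ea eb; set a := (a0 - m1)%C; set b := (b0 - m2)%C => E.
have ea' : (Cconj a = a + Ci * psu)%C.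
  rewrite /a Cminus_conj Cconj_RtoC.
  have -> : (Cconj a0 = a0 - (a0 - Cconj a0))%C by ring.
  by rewrite ea; ring.
have eb' : (Cconj b = b + Ci * psv)%C.
  rewrite /b Cminus_conj Cconj_RtoC.
  have -> : (Cconj b0 = b0 - (b0 - Cconj b0))%C by ring.
  by rewrite eb; ring.
have Eb : (Cconj p * (Cconj b + Ci * lu) = Cconj q * (Cconj a - Ci * lv))%C.
  have := f_equal Cconj E; Cconj_push => E'.
  have -> : (Cconj b + Ci * lu = Cconj b - - Ci * lu)%C by ring.
  by rewrite E'; ring.
rewrite ea' eb' in Eb.
have Ka : (cJ * a = Ci * p * (Cconj p * psv - Cconj q * psu) +
    Ci * ((1 + 1) * (p * Cconj p) * lu + cA * lv))%C.
  have -> : (cJ * a = p * (Cconj q * (a + Ci * psu - Ci * lv)) -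
      Cconj p * (q * (a + Ci * lv)) - Ci * p * Cconj q * psu + Ci * cA * lv)%C.
    by rewrite /cJ /cA; ring.
  by rewrite -Eb -E; ring.
have Kb : (cJ * b = Ci * q * (Cconj p * psv - Cconj q * psu) +
    Ci * (cA * lu + (1 + 1) * (q * Cconj q) * lv))%C.
  have -> : (cJ * b = Cconj q * (p * (b - Ci * lu)) -
      q * (Cconj p * (b + Ci * psv + Ci * lu)) + Ci * q * Cconj p * psv + Ci * cA * lu)%C.
    by rewrite /cJ /cA; ring.
  by rewrite Eb E; ring.
have -> : (RtoC m1 = a0 - cJ * a / cJ)%C by rewrite /a; field.
have -> : (RtoC m2 = b0 - cJ * b / cJ)%C by rewrite /b; field.
by rewrite Ka Kb; split; field.
Qed.

Lemma vi_codazzi (ku kv Q lu lv m1 m2 : C) : cJ <> 0%C ->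
  (m1 = ku / (k * k - 1) - Ci * Q * p
    - Ci / cJ * ((1 + 1) * (p * Cconj p) * lu + cA * lv))%C ->
  (m2 = kv / (k * k - 1) - Ci * Q * q
    - Ci / cJ * (cA * lu + (1 + 1) * (q * Cconj q) * lv))%C ->
  codazzi ku kv lu lv m1 m2.
Proof.
rewrite /codazzi; set a0 := (ku / _)%C; set b0 := (kv / _)%C.
move=> J0 -> ->; apply: (Cmult_cancel cJ) => //.
have -> : (cJ * (p * (b0 - (b0 - Ci * Q * q - Ci / cJ * (cA * lu + (1 + 1) * (q * Cconj q) * lv))
    - Ci * lu)) = p * (cJ * (Ci * Q * q) + Ci * (cA * lu + (1 + 1) * (q * Cconj q) * lv)
    - cJ * (Ci * lu)))%C by field.
have -> : (cJ * (q * (a0 - (a0 - Ci * Q * p - Ci / cJ * ((1 + 1) * (p * Cconj p) * lu + cA * lv))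
    + Ci * lv)) = q * (cJ * (Ci * Q * p) + Ci * ((1 + 1) * (p * Cconj p) * lu + cA * lv)
    + cJ * (Ci * lv)))%C by field.
by rewrite /cJ /cA; ring.
Qed.

(** Differentiating relation (iv), written as
    [cos psi (|k|^2 - 1) = 2 sin psi Im k], gives the imaginary part of
    [k_u / (k^2 - 1)]. *)
Lemma log_derivative_imag (ku : C) (c sn psu : R) :
  (c * k - Ci * sn = - Ci * (s / Cconj s))%C ->
  (c * (k * Cconj k - 1) + Ci * sn * (k - Cconj k) = 0)%C ->
  (psu * (- (sn * (k * Cconj k - 1)) + Ci * c * (k - Cconj k)) +
    c * (ku * Cconj k + k * Cconj ku) + Ci * sn * (ku - Cconj ku) = 0)%C ->
  (ku / (k * k - 1) - Cconj (ku / (k * k - 1)) = - Ci * psu)%C.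
Proof.
move=> g D E.
have gb : (c * Cconj k + Ci * sn = Ci * (Cconj s / s))%C.
  have := f_equal Cconj g; Cconj_push => g'.
  have -> : (c * Cconj k + Ci * sn = c * Cconj k - - Ci * sn)%C by ring.
  by rewrite g'; ring.
have K : (- (sn * (k * Cconj k - 1)) + Ci * c * (k - Cconj k) = - (s * Cconj s))%C.
  have e1 : (s * Cconj s = - Ci * (k * k - 1) * (c * Cconj k + Ci * sn))%C.
    by rewrite gb -ss; field [Ci2].
  have e2 : (s * Cconj s = Ci * (Cconj k * Cconj k - 1) * (c * k - Ci * sn))%C.
    by rewrite g -ssb; field [Ci2].
  have e3 : (- (sn * (k * Cconj k - 1)) + Ci * c * (k - Cconj k) +
      - (sn * (k * Cconj k - 1)) + Ci * c * (k - Cconj k) =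
      - (s * Cconj s + s * Cconj s) + Ci * (Cconj k - k) *
      (c * (k * Cconj k - 1) + Ci * sn * (k - Cconj k)))%C.
    by rewrite {1}e1 e2; ring [Ci2].
  rewrite D in e3.
  apply: (Cmult_cancel (1 + 1)).
    by rewrite -RtoC_plus => /RtoC_inj; lra.
  have -> : ((1 + 1) * - (s * Cconj s) = - (s * Cconj s + s * Cconj s) + Ci * (Cconj k - k) * 0)%C
    by ring.
  by rewrite -e3; ring.
have F : (Ci * (Cconj s * s) * (ku / (s * s) - Cconj ku / (Cconj s * Cconj s)) =
    psu * (s * Cconj s))%C.
  have -> : (Ci * (Cconj s * s) * (ku / (s * s) - Cconj ku / (Cconj s * Cconj s)) =
      ku * (Ci * (Cconj s / s)) + Cconj ku * (- Ci * (s / Cconj s)))%C by field; split.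
  rewrite -gb -g.
  have -> : (psu * (s * Cconj s) = - (psu * - (s * Cconj s)))%C by ring.
  rewrite -K.
  have -> : (ku * (c * Cconj k + Ci * sn) + Cconj ku * (c * k - Ci * sn) =
    psu * (- (sn * (k * Cconj k - 1)) + Ci * c * (k - Cconj k)) +
    c * (ku * Cconj k + k * Cconj ku) + Ci * sn * (ku - Cconj ku) -
    psu * (- (sn * (k * Cconj k - 1)) + Ci * c * (k - Cconj k)))%C by ring.
  by rewrite E; ring.
rewrite -ss Cdiv_conj; last exact: Cmult_neq_0.
rewrite Cmult_conj; apply: (Cmult_cancel (Ci * (Cconj s * s))).
  by apply: Cmult_neq_0; [exact: Ci_nz|exact: Cmult_neq_0].
by rewrite F; ring [Ci2].
Qed.

End Algebra.

(** * The scalar product *)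

Section BigR.

Variables (I : Type) (r : list I).

Lemma bigR_plus (f g : I -> R) : \big[Rplus/0]_(i <- r) (f i + g i) =
  \big[Rplus/0]_(i <- r) f i + \big[Rplus/0]_(i <- r) g i.
Proof.
elim: r => [|i l IH]; first by rewrite !big_nil; ring.
by rewrite !big_cons IH; ring.
Qed.

Lemma bigR_scal a (f : I -> R) : \big[Rplus/0]_(i <- r) (a * f i) =
  a * \big[Rplus/0]_(i <- r) f i.
Proof.
elim: r => [|i l IH]; first by rewrite !big_nil; ring.
by rewrite !big_cons IH; ring.
Qed.

Variables (O : R * R -> Prop) (oO : open O).

Lemma bigR_smooth (f : I -> R -> R -> R) : (forall i, smooth O (f i)) ->
  smooth O (fun u v => \big[Rplus/0]_(i <- r) f i u v).
Proof.
move=> sf; elim: r => [|i l IH].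
  apply: (smooth_agree O oO (fun _ _ => 0)); last exact: smooth_const.
  by move=> u v _; rewrite big_nil.
apply: (smooth_agree O oO (fun u v => f i u v + \big[Rplus/0]_(i <- l) f i u v)).
  by move=> u v _; rewrite big_cons.
exact: smooth_plus.
Qed.

End BigR.

Lemma bigR_du (I : Type) (r : list I) O (oO : open O) (f : I -> R -> R -> R) u v :
  (forall i, smooth O (f i)) -> O (u, v) ->
  du (fun u v => \big[Rplus/0]_(i <- r) f i u v) u v =
    \big[Rplus/0]_(i <- r) du (f i) u v.
Proof.
move=> sf o; elim: r => [|i l IH].
  rewrite big_nil (agree_du O oO _ (fun _ _ => 0)) // ?du_const // => x y _.
  by rewrite big_nil.
rewrite big_cons -IH.
rewrite (agree_du O oO _ (fun u v => f i u v + \big[Rplus/0]_(i <- l) f i u v)) //.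
  by rewrite (du_plus O) //; exact: bigR_smooth.
by move=> x y _; rewrite big_cons.
Qed.

Lemma bigR_dv (I : Type) (r : list I) O (oO : open O) (f : I -> R -> R -> R) u v :
  (forall i, smooth O (f i)) -> O (u, v) ->
  dv (fun u v => \big[Rplus/0]_(i <- r) f i u v) u v =
    \big[Rplus/0]_(i <- r) dv (f i) u v.
Proof.
move=> sf o; elim: r => [|i l IH].
  rewrite big_nil (agree_dv O oO _ (fun _ _ => 0)) // ?dv_const // => x y _.
  by rewrite big_nil.
rewrite big_cons -IH.
rewrite (agree_dv O oO _ (fun u v => f i u v + \big[Rplus/0]_(i <- l) f i u v)) //.
  by rewrite (dv_plus O) //; exact: bigR_smooth.
by move=> x y _; rewrite big_cons.
Qed.

Section ScalarProduct.

Variable L0 : R.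
Implicit Types (x y z : avec L0) (V W F : vfield L0).

Lemma sp_ext x x' y : (forall i, x i = x' i) -> sp x y = sp x' y.
Proof. by move=> e; congr sp; apply: functional_extensionality. Qed.

Lemma sp_sym x y : sp x y = sp y x.
Proof. by rewrite /sp /eform; apply: eq_bigr => i _; ring. Qed.

Lemma sp_plus x x' y : sp (fun i => x i + x' i) y = sp x y + sp x' y.
Proof. by rewrite /sp /eform -bigR_plus; apply: eq_bigr => i _; ring. Qed.

Lemma sp_scal a x y : sp (fun i => a * x i) y = a * sp x y.
Proof. by rewrite /sp /eform -bigR_scal; apply: eq_bigr => i _; ring. Qed.

Lemma sp_comb5 a0 a1 a2 a3 a4 x0 x1 x2 x3 x4 y :
  sp (fun i => a0 * x0 i + a1 * x1 i + a2 * x2 i + a3 * x3 i + a4 * x4 i) y =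
  a0 * sp x0 y + a1 * sp x1 y + a2 * sp x2 y + a3 * sp x3 y + a4 * sp x4 y.
Proof.
rewrite (sp_plus (fun i => a0 * x0 i + a1 * x1 i + a2 * x2 i + a3 * x3 i)) sp_scal.
rewrite (sp_plus (fun i => a0 * x0 i + a1 * x1 i + a2 * x2 i)) sp_scal.
rewrite (sp_plus (fun i => a0 * x0 i + a1 * x1 i)) sp_scal.
by rewrite (sp_plus (fun i => a0 * x0 i)) !sp_scal.
Qed.

Lemma sp_comb2 a0 a1 x0 x1 y :
  sp (fun i => a0 * x0 i + a1 * x1 i) y = a0 * sp x0 y + a1 * sp x1 y.
Proof. by rewrite (sp_plus (fun i => a0 * x0 i)) !sp_scal. Qed.

Variables (O : R * R -> Prop) (oO : open O).

Lemma smooth_sp V W : vsmooth O V -> vsmooth O W ->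
  smooth O (fun u v => sp (V u v) (W u v)).
Proof.
move=> sV sW; rewrite /sp /eform; apply: bigR_smooth => // i.
by apply: smooth_mult => //; [exact: smooth_const|apply: smooth_mult].
Qed.

Lemma vsmooth_vdu V : vsmooth O V -> vsmooth O (vdu V).
Proof. by move=> sV i; exact: (smooth_du O _ (sV i)). Qed.

Lemma vsmooth_vdv V : vsmooth O V -> vsmooth O (vdv V).
Proof. by move=> sV i; exact: (smooth_dv O _ (sV i)). Qed.

Lemma du_sp V W u v : vsmooth O V -> vsmooth O W -> O (u, v) ->
  du (fun u v => sp (V u v) (W u v)) u v =
    sp (vdu V u v) (W u v) + sp (V u v) (vdu W u v).
Proof.
move=> sV sW o; rewrite /sp /eform -bigR_plus (bigR_du _ _ O) //.
  apply: eq_bigr => i _; rewrite (du_mult O) //; first last.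
  - by apply: smooth_mult.
  - exact: smooth_const.
  by rewrite (du_mult O) // du_const /vdu; ring.
move=> i.
by apply: smooth_mult => //; [exact: smooth_const|apply: smooth_mult].
Qed.

Lemma dv_sp V W u v : vsmooth O V -> vsmooth O W -> O (u, v) ->
  dv (fun u v => sp (V u v) (W u v)) u v =
    sp (vdv V u v) (W u v) + sp (V u v) (vdv W u v).
Proof.
move=> sV sW o; rewrite /sp /eform -bigR_plus (bigR_dv _ _ O) //.
  apply: eq_bigr => i _; rewrite (dv_mult O) //; first last.
  - by apply: smooth_mult.
  - exact: smooth_const.
  by rewrite (dv_mult O) // dv_const /vdv; ring.
move=> i.
by apply: smooth_mult => //; [exact: smooth_const|apply: smooth_mult].
Qed.

End ScalarProduct.

(** * The moving frame *)

(** Rows and columns are indexed by F, T1, T2, N1, N2 in this order. *)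
Definition frame_u (L0 : R) (lam : R -> R -> R) (c : coeffs) (i j : nat) (u v : R) : R :=
  match i, j with
  | 0%nat, 1%nat => 1
  | 1%nat, 0%nat => - (L0 * exp (2 * lam u v))
  | 1%nat, 1%nat => du lam u v | 1%nat, 2%nat => - dv lam u v | 1%nat, 3%nat => al1 c u v | 1%nat, 4%nat => be1 c u v
  | 2%nat, 1%nat => dv lam u v | 2%nat, 2%nat => du lam u v | 2%nat, 3%nat => al2 c u v | 2%nat, 4%nat => be2 c u v
  | 3%nat, 1%nat => - al1 c u v | 3%nat, 2%nat => - al2 c u v | 3%nat, 3%nat => du lam u v | 3%nat, 4%nat => mu1 c u v
  | 4%nat, 1%nat => be1 c u v | 4%nat, 2%nat => be2 c u v | 4%nat, 3%nat => mu1 c u v | 4%nat, 4%nat => du lam u v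
  | _, _ => 0
  end.

Definition frame_v (L0 : R) (lam : R -> R -> R) (c : coeffs) (i j : nat) (u v : R) : R :=
  match i, j with
  | 0%nat, 2%nat => 1
  | 1%nat, 1%nat => dv lam u v | 1%nat, 2%nat => du lam u v | 1%nat, 3%nat => al2 c u v | 1%nat, 4%nat => be2 c u v
  | 2%nat, 0%nat => - (L0 * exp (2 * lam u v))
  | 2%nat, 1%nat => - du lam u v | 2%nat, 2%nat => dv lam u v | 2%nat, 3%nat => al3 c u v | 2%nat, 4%nat => be3 c u v
  | 3%nat, 1%nat => - al2 c u v | 3%nat, 2%nat => - al3 c u v | 3%nat, 3%nat => dv lam u v | 3%nat, 4%nat => mu2 c u v
  | 4%nat, 1%nat => be2 c u v | 4%nat, 2%nat => be3 c u v | 4%nat, 3%nat => mu2 c u v | 4%nat, 4%nat => dv lam u v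
  | _, _ => 0
  end.

Record smooth_coeffs (O : R * R -> Prop) (c : coeffs) : Prop := {
  sal1 : smooth O (al1 c); sal2 : smooth O (al2 c); sal3 : smooth O (al3 c);
  sbe1 : smooth O (be1 c); sbe2 : smooth O (be2 c); sbe3 : smooth O (be3 c);
  smu1 : smooth O (mu1 c); smu2 : smooth O (mu2 c) }.

(** Unfolding the frame matrices leaves eta-expanded coefficients, which the
    arithmetic tactics take for new atoms. *)
Ltac eta_coeffs lam c :=
  change (fun u v => du lam u v) with (du lam) in *;
  change (fun u v => dv lam u v) with (dv lam) in *;
  change (fun u v => al1 c u v) with (al1 c) in *;
  change (fun u v => al2 c u v) with (al2 c) in *;
  change (fun u v => al3 c u v) with (al3 c) in *;
  change (fun u v => be1 c u v) with (be1 c) in *;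
  change (fun u v => be2 c u v) with (be2 c) in *;
  change (fun u v => be3 c u v) with (be3 c) in *;
  change (fun u v => mu1 c u v) with (mu1 c) in *;
  change (fun u v => mu2 c u v) with (mu2 c) in *.

Section FrameMatrices.

Variables (L0 : R) (O : R * R -> Prop) (oO : open O) (lam : R -> R -> R) (c : coeffs).
Hypothesis sl : smooth O lam.
Hypothesis sc : smooth_coeffs O c.

Lemma smooth_E : smooth O (fun u v => exp (2 * lam u v)).
Proof. by apply: smooth_exp => //; apply: smooth_mult => //; exact: smooth_const. Qed.

Lemma du_E u v : O (u, v) ->
  du (fun u v => exp (2 * lam u v)) u v = 2 * du lam u v * exp (2 * lam u v).
Proof.
move=> o; rewrite (du_comp O exp (exp (2 * lam u v)) (fun u v => 2 * lam u v)) //.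
- by rewrite (du_mult O) // ?du_const; [ring|exact: smooth_const].
- by apply: smooth_mult => //; exact: smooth_const.
- exact: is_derive_exp.
Qed.

Lemma dv_E u v : O (u, v) ->
  dv (fun u v => exp (2 * lam u v)) u v = 2 * dv lam u v * exp (2 * lam u v).
Proof.
move=> o; rewrite (dv_comp O exp (exp (2 * lam u v)) (fun u v => 2 * lam u v)) //.
- by rewrite (dv_mult O) // ?dv_const; [ring|exact: smooth_const].
- by apply: smooth_mult => //; exact: smooth_const.
- exact: is_derive_exp.
Qed.

Let slu : smooth O (du lam) := smooth_du O lam sl.
Let slv : smooth O (dv lam) := smooth_dv O lam sl.

Lemma frame_u_smooth : smooth_matrix 4 O (frame_u L0 lam c).
Proof.
have [] := sc => *; move=> [|[|[|[|[|i]]]]] [|[|[|[|[|j]]]]] hi hj; try lia;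
  rewrite /frame_u; try exact: smooth_const; try done; apply: smooth_opp => //.
by apply: smooth_mult => //; [exact: smooth_const|exact: smooth_E].
Qed.

Lemma frame_v_smooth : smooth_matrix 4 O (frame_v L0 lam c).
Proof.
have [] := sc => *; move=> [|[|[|[|[|i]]]]] [|[|[|[|[|j]]]]] hi hj; try lia;
  rewrite /frame_v; try exact: smooth_const; try done; apply: smooth_opp => //.
by apply: smooth_mult => //; [exact: smooth_const|exact: smooth_E].
Qed.

(** The remaining entries of the curvature vanish identically.  In the presence
    of [cond_i] the equation of Gauss reduces to the vanishing of the quadratic
    contribution of the second fundamental form. *)
Lemma frame_flat :
  (forall u v, O (u, v) ->
     cond_i L0 lam u v /\
     al1 c u v * al3 c u v - al2 c u v * al2 c u v =
       be1 c u v * be3 c u v - be2 c u v * be2 c u v /\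
     al1 c u v * be2 c u v - al2 c u v * be1 c u v +
       al2 c u v * be3 c u v - al3 c u v * be2 c u v = 0 /\
     dv (mu1 c) u v = du (mu2 c) u v /\
     curv 4 (frame_u L0 lam c) (frame_v L0 lam c) 1 3 u v = 0 /\
     curv 4 (frame_u L0 lam c) (frame_v L0 lam c) 1 4 u v = 0 /\
     curv 4 (frame_u L0 lam c) (frame_v L0 lam c) 2 3 u v = 0 /\
     curv 4 (frame_u L0 lam c) (frame_v L0 lam c) 2 4 u v = 0) ->
  flat 4 O (frame_u L0 lam c) (frame_v L0 lam c).
Proof.
move=> H u v o i j hi hj; have [h1 [h2 [h3 [h4 [h5 [h6 [h7 h8]]]]]]] := H u v o.
have hE : dv (fun u v => - (L0 * exp (2 * lam u v))) u v =
    - (L0 * (2 * dv lam u v * exp (2 * lam u v))).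
  rewrite dv_opp (dv_mult O) //; [|exact: smooth_const|exact: smooth_E].
  by rewrite dv_const dv_E //; ring.
have hE' : du (fun u v => - (L0 * exp (2 * lam u v))) u v =
    - (L0 * (2 * du lam u v * exp (2 * lam u v))).
  rewrite du_opp (du_mult O) //; [|exact: smooth_const|exact: smooth_E].
  by rewrite du_const du_E //; ring.
have hl := du_dv O oO lam u v sl o.
move: h1 h5 h6 h7 h8; rewrite /cond_i.
move: i j hi hj => [|[|[|[|[|i]]]]] [|[|[|[|[|j]]]]] hi hj; try lia;
  rewrite /curv /= /frame_u /frame_v ?dv_const ?du_const ?hE ?hE' ?dv_opp ?du_opp => h1 h5 h6 h7 h8;
  eta_coeffs lam c;
  lra.
Qed.

Section Codazzi.

Variables k s f : R -> R -> C.
Hypothesis sk : Csmooth O k.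
Hypothesis ssm : Csmooth O s.
Hypothesis sf : Csmooth O f.
Hypothesis s0 : forall u v, O (u, v) -> s u v <> 0%C.
Hypothesis ss : forall u v, O (u, v) -> (s u v * s u v = k u v * k u v - 1)%C.
Hypothesis eX : forall u v, O (u, v) -> fX c u v = (Ci * Cdv f u v / s u v)%C.
Hypothesis eY : forall u v, O (u, v) -> fY c u v = (Cdu f u v / s u v)%C.
Hypothesis eW : forall u v, O (u, v) -> fW c u v = (k u v * fY c u v)%C.
Hypothesis eZ : forall u v, O (u, v) -> fZ c u v = (k u v * fX c u v)%C.

Definition codazzi_defect (u v : R) : C :=
  (Cdu f u v * (Cdv k u v / (k u v * k u v - 1) - mu2 c u v - Ci * du lam u v) -
   Cdv f u v * (Cdu k u v / (k u v * k u v - 1) - mu1 c u v + Ci * dv lam u v))%C.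

Lemma Csmooth_div g h : Csmooth O g -> Csmooth O h -> (forall u v, O (u, v) -> h u v <> 0%C) ->
  Csmooth O (fun u v => g u v / h u v)%C.
Proof. by move=> sg sh nz; apply: Csmooth_mult => //; exact: Csmooth_inv. Qed.

Lemma Cdu_div g h u v : Csmooth O g -> Csmooth O h ->
  (forall u v, O (u, v) -> h u v <> 0%C) -> O (u, v) ->
  Cdu (fun u v => g u v / h u v)%C u v =
  ((Cdu g u v * h u v - g u v * Cdu h u v) / (h u v * h u v))%C.
Proof.
move=> sg sh nz o; have nz' := nz u v o.
have sq := Csmooth_div g h sg sh nz.
have e : Cdu g u v = (Cdu (fun u v => g u v / h u v)%C u v * h u v +
    g u v / h u v * Cdu h u v)%C.
  rewrite -(Cdu_mult O oO) //; apply: (Cdu_agree O oO) => // x y h'.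
  by field; exact: nz.
by rewrite e; field.
Qed.

Lemma Cdv_div g h u v : Csmooth O g -> Csmooth O h ->
  (forall u v, O (u, v) -> h u v <> 0%C) -> O (u, v) ->
  Cdv (fun u v => g u v / h u v)%C u v =
  ((Cdv g u v * h u v - g u v * Cdv h u v) / (h u v * h u v))%C.
Proof.
move=> sg sh nz o; have nz' := nz u v o.
have sq := Csmooth_div g h sg sh nz.
have e : Cdv g u v = (Cdv (fun u v => g u v / h u v)%C u v * h u v +
    g u v / h u v * Cdv h u v)%C.
  rewrite -(Cdv_mult O oO) //; apply: (Cdv_agree O oO) => // x y h'.
  by field; exact: nz.
by rewrite e; field.
Qed.

(** In complex form the four equations of Codazzi are two, and in terms of
    [f] and [k] both say the same. *)
Lemma codazzi_curv u v : O (u, v) ->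
  (curv 4 (frame_u L0 lam c) (frame_v L0 lam c) 1 3 u v,
   curv 4 (frame_u L0 lam c) (frame_v L0 lam c) 2 4 u v) =
    (- (Ci * (k u v / s u v) * codazzi_defect u v))%C /\
  (curv 4 (frame_u L0 lam c) (frame_v L0 lam c) 1 4 u v,
   curv 4 (frame_u L0 lam c) (frame_v L0 lam c) 2 3 u v) =
    (- (Ci / s u v * codazzi_defect u v))%C.
Proof.
move=> o; have nz := s0 u v o.
have sfu := Csmooth_Cdu O _ sf; have sfv := Csmooth_Cdv O _ sf.
have siv : Csmooth O (fun u v => Ci * Cdv f u v)%C.
  by apply: Csmooth_mult => //; exact: Csmooth_const.
have e1 : Cdu (fun u v => Ci * Cdv f u v)%C u v = (Ci * Cdv (Cdu f) u v)%C.
  rewrite (Cdu_mult O) // ?Cdu_const ?(Cdu_Cdv O) //; last exact: Csmooth_const.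
  ring.
have ks : (s u v * Cdu s u v = k u v * Cdu k u v)%C.
  have := Cdu_agree O oO (fun u v => s u v * s u v)%C (fun u v => k u v * k u v - 1)%C u v ss o.
  rewrite (Cdu_mult O) // (Cdu_minus O) // ?Cdu_const ?(Cdu_mult O) //; last first.
  - exact: Csmooth_const.
  - exact: Csmooth_mult.
  move=> e; apply: (Cmult_cancel (1 + 1)).
    by rewrite -RtoC_plus => /RtoC_inj; lra.
  have -> : ((1 + 1) * (s u v * Cdu s u v) = Cdu s u v * s u v + s u v * Cdu s u v)%C by ring.
  by rewrite e; ring.
have ks' : (s u v * Cdv s u v = k u v * Cdv k u v)%C.
  have := Cdv_agree O oO (fun u v => s u v * s u v)%C (fun u v => k u v * k u v - 1)%C u v ss o.
  rewrite (Cdv_mult O) // (Cdv_minus O) // ?Cdv_const ?(Cdv_mult O) //; last first.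
  - exact: Csmooth_const.
  - exact: Csmooth_mult.
  move=> e; apply: (Cmult_cancel (1 + 1)).
    by rewrite -RtoC_plus => /RtoC_inj; lra.
  have -> : ((1 + 1) * (s u v * Cdv s u v) = Cdv s u v * s u v + s u v * Cdv s u v)%C by ring.
  by rewrite e; ring.
have eXu : Cdu (fX c) u v = (Ci * (Cdv (Cdu f) u v / s u v -
    Cdv f u v * (k u v * Cdu k u v) / (s u v * s u v * s u v)))%C.
  rewrite (Cdu_agree O oO _ _ u v eX o) Cdu_div // e1 -ks.
  by field.
have eYv : Cdv (fY c) u v = (Cdv (Cdu f) u v / s u v -
    Cdu f u v * (k u v * Cdv k u v) / (s u v * s u v * s u v))%C.
  rewrite (Cdv_agree O oO _ _ u v eY o) Cdv_div // -ks'.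
  by field.
have sX : Csmooth O (fX c).
  apply: (Csmooth_agree O oO (fun u v => Ci * Cdv f u v / s u v)%C).
    by move=> x y h; rewrite eX.
  exact: Csmooth_div.
have sY : Csmooth O (fY c).
  apply: (Csmooth_agree O oO (fun u v => Cdu f u v / s u v)%C).
    by move=> x y h; rewrite eY.
  exact: Csmooth_div.
have eZu : Cdu (fZ c) u v = (Cdu k u v * (Ci * Cdv f u v / s u v) + k u v * Cdu (fX c) u v)%C.
  by rewrite (Cdu_agree O oO _ _ u v eZ o) (Cdu_mult O) // -eX.
have eWv : Cdv (fW c) u v = (Cdv k u v * (Cdu f u v / s u v) + k u v * Cdv (fY c) u v)%C.
  by rewrite (Cdv_agree O oO _ _ u v eW o) (Cdv_mult O) // -eY.
have K1 : (curv 4 (frame_u L0 lam c) (frame_v L0 lam c) 1 3 u v,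
   curv 4 (frame_u L0 lam c) (frame_v L0 lam c) 2 4 u v) =
    (- (Cdu (fX c) u v - Ci * Cdv (fY c) u v + (du lam u v - Ci * mu2 c u v) * fW c u v +
      (mu1 c u v - Ci * dv lam u v) * fZ c u v))%C.
  apply: injective_projections; rewrite /curv /= /frame_u /frame_v ?dv_opp ?du_opp; eta_coeffs lam c; ring.
have K2 : (curv 4 (frame_u L0 lam c) (frame_v L0 lam c) 1 4 u v,
   curv 4 (frame_u L0 lam c) (frame_v L0 lam c) 2 3 u v) =
    (- (Cdu (fZ c) u v - Ci * Cdv (fW c) u v + (du lam u v - Ci * mu2 c u v) * fY c u v +
      (mu1 c u v - Ci * dv lam u v) * fX c u v))%C.
  apply: injective_projections; rewrite /curv /= /frame_u /frame_v ?dv_opp ?du_opp; eta_coeffs lam c; ring.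
have D : codazzi_defect u v =
    ((Cdu f u v * Cdv k u v - Cdv f u v * Cdu k u v) / (s u v * s u v) +
     Cdu f u v * (- mu2 c u v - Ci * du lam u v) +
     Cdv f u v * (mu1 c u v - Ci * dv lam u v))%C.
  by rewrite /codazzi_defect -ss //; field.
split.
- rewrite K1 D eW // eZ // eXu eYv eX // eY //.
  match goal with |- @eq _ ?x ?y => change (@eq C x y) end.
  by field [Ci2].
- rewrite K2 D eZu eWv eXu eYv eX // eY //.
  have -> : (Cdu k u v * (Ci * Cdv f u v / s u v) +
      k u v * (Ci * (Cdv (Cdu f) u v / s u v - Cdv f u v * (k u v * Cdu k u v) /
        (s u v * s u v * s u v))) -
      Ci * (Cdv k u v * (Cdu f u v / s u v) + k u v * (Cdv (Cdu f) u v / s u v -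
        Cdu f u v * (k u v * Cdv k u v) / (s u v * s u v * s u v))) =
      Ci / s u v * ((s u v * s u v - k u v * k u v) *
        (Cdv f u v * Cdu k u v - Cdu f u v * Cdv k u v) / (s u v * s u v)))%C by field.
  have -> : (s u v * s u v - k u v * k u v = - (1))%C by rewrite ss //; ring.
  match goal with |- @eq _ ?x ?y => change (@eq C x y) end.
  by field [Ci2].
Qed.

End Codazzi.

End FrameMatrices.

(** * Curvature of a conformal metric *)

Section ConformalMetric.

Variables (O : R * R -> Prop) (oO : open O) (lam : R -> R -> R) (g : metric).
Hypothesis sl : smooth O lam.
Hypothesis g_diag : forall i u v, O (u, v) -> g i i u v = exp (2 * lam u v).
Hypothesis g_off : forall i j u v, O (u, v) -> i <> j -> g i j u v = 0.

Lemma pd_diag l i u v : O (u, v) -> pd l (g i i) u v = 2 * pd l lam u v * exp (2 * lam u v).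
Proof.
move=> o; case: l => /=.
- by rewrite (agree_dv O oO (g i i) (fun u v => exp (2 * lam u v))) ?(dv_E O oO) // => x y h; exact: g_diag.
- by rewrite (agree_du O oO (g i i) (fun u v => exp (2 * lam u v))) ?(du_E O oO) // => x y h; exact: g_diag.
Qed.

Lemma pd_off l i j u v : O (u, v) -> i <> j -> pd l (g i j) u v = 0.
Proof.
move=> o ij; case: l => /=.
- by rewrite (agree_dv O oO (g i j) (fun _ _ => 0)) ?dv_const // => x y h; exact: g_off.
- by rewrite (agree_du O oO (g i j) (fun _ _ => 0)) ?du_const // => x y h; exact: g_off.
Qed.

Lemma Gamma_conformal m i j u v : O (u, v) ->
  Gamma g m i j u v =
    (if Bool.eqb m j then pd i lam u v else 0) + (if Bool.eqb m i then pd j lam u v else 0)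
    - (if Bool.eqb i j then pd m lam u v else 0).
Proof.
move=> o; have := exp_pos (2 * lam u v) => E0.
have /= a1 := pd_diag false false u v o; have /= a2 := pd_diag false true u v o.
have /= a3 := pd_diag true false u v o; have /= a4 := pd_diag true true u v o.
have /= b1 := pd_off false false true u v o ltac:(done).
have /= b2 := pd_off false true false u v o ltac:(done).
have /= b3 := pd_off true false true u v o ltac:(done).
have /= b4 := pd_off true true false u v o ltac:(done).
have e00 := g_diag false u v o; have e11 := g_diag true u v o.
have e01 := g_off false true u v o ltac:(done).
have e10 := g_off true false u v o ltac:(done).
rewrite /Gamma /bsum /minv /mdet.
by case: m; case: i; case: j => /=; rewrite ?e00 ?e11 ?e01 ?e10 ?a1 ?a2 ?a3 ?a4
  ?b1 ?b2 ?b3 ?b4; field; lra.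
Qed.

Lemma gauss_curvature_conformal u v : O (u, v) ->
  gauss_curvature g u v = - (du (du lam) u v + dv (dv lam) u v) / exp (2 * lam u v).
Proof.
move=> o; have := exp_pos (2 * lam u v) => E0.
have E : Riem g false u v = - (du (du lam) u v + dv (dv lam) u v).
  rewrite /Riem /bsum.
  rewrite (agree_du O oO (Gamma g false true true) (fun u v => - du lam u v)) //; last first.
    by move=> x y h; rewrite Gamma_conformal //=; ring.
  rewrite (agree_dv O oO (Gamma g false false true) (dv lam)) //; last first.
    by move=> x y h; rewrite Gamma_conformal //=; ring.
  by rewrite !Gamma_conformal //= du_opp; ring.
rewrite /gauss_curvature /bsum /mdet E !g_diag // (g_off true false) // (g_off false true) //.
by field; lra.
Qed.

End ConformalMetric.

(** * Structure equations of an adapted frame *)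

Section Structure.

Variables (L0 : R) (O : R * R -> Prop) (oO : open O).
Variables (F N1 N2 : vfield L0) (lam : R -> R -> R) (c : coeffs).
Hypothesis imm : spacelike_conformal_immersion O F.
Hypothesis ad : adapted O F N1 N2 lam c.

Let sF : vsmooth O F := imm_smooth imm.
Let s1 : vsmooth O (T1 F) := vsmooth_vdu L0 O F sF.
Let s2 : vsmooth O (T2 F) := vsmooth_vdv L0 O F sF.
Let sl : smooth O lam := ad_lam ad.
Let sN1 : vsmooth O N1 := proj1 (ad_N1 ad).
Let sN2 : vsmooth O N2 := proj1 (ad_N2 ad).
Let E u v := exp (2 * lam u v).

Lemma T1_v_T2_u u v : O (u, v) -> vdv (T1 F) u v = vdu (T2 F) u v.
Proof.
move=> o; apply: functional_extensionality => i.
by symmetry; exact: (du_dv O oO (fun x y => F x y i) u v (sF i) o).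
Qed.

Lemma sp_du (V W : vfield L0) (h : R -> R -> R) u v : vsmooth O V -> vsmooth O W -> O (u, v) ->
  (forall u v, O (u, v) -> sp (V u v) (W u v) = h u v) ->
  sp (vdu V u v) (W u v) + sp (V u v) (vdu W u v) = du h u v.
Proof. by move=> sV sW o e; rewrite -(du_sp _ O oO) //; exact: (agree_du O oO). Qed.

Lemma sp_dv (V W : vfield L0) (h : R -> R -> R) u v : vsmooth O V -> vsmooth O W -> O (u, v) ->
  (forall u v, O (u, v) -> sp (V u v) (W u v) = h u v) ->
  sp (vdv V u v) (W u v) + sp (V u v) (vdv W u v) = dv h u v.
Proof. by move=> sV sW o e; rewrite -(dv_sp _ O oO) //; exact: (agree_dv O oO). Qed.

(** The factor [L0] makes this and the next statements hold for [L0 = 0] too,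
    where the position vector is not normalised. *)
Lemma sp_F_du (V : vfield L0) (a : R) u v : vsmooth O V -> O (u, v) ->
  (forall u v, O (u, v) -> L0 * sp (V u v) (F u v) = a) ->
  L0 * sp (vdu V u v) (F u v) = - (L0 * sp (V u v) (T1 F u v)).
Proof.
move=> sV o e.
have H : du (fun u v => L0 * sp (V u v) (F u v)) u v = 0.
  by rewrite (agree_du O oO _ (fun _ _ => a)) ?du_const.
rewrite (du_mult O) // ?du_const in H; [|exact: smooth_const|exact: smooth_sp].
rewrite (du_sp _ O oO) // -/(T1 F) in H; lra.
Qed.

Lemma sp_F_dv (V : vfield L0) (a : R) u v : vsmooth O V -> O (u, v) ->
  (forall u v, O (u, v) -> L0 * sp (V u v) (F u v) = a) ->
  L0 * sp (vdv V u v) (F u v) = - (L0 * sp (V u v) (T2 F u v)).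
Proof.
move=> sV o e.
have H : dv (fun u v => L0 * sp (V u v) (F u v)) u v = 0.
  by rewrite (agree_dv O oO _ (fun _ _ => a)) ?dv_const.
rewrite (dv_mult O) // ?dv_const in H; [|exact: smooth_const|exact: smooth_sp].
rewrite (dv_sp _ O oO) // -/(T2 F) in H; lra.
Qed.

Lemma sp_F_F u v : O (u, v) -> L0 * sp (F u v) (F u v) = if Req_EM_T L0 0 is left _ then 0 else 1.
Proof.
move=> o; case: Req_EM_T => h; first by rewrite {1}h; ring.
by rewrite (imm_in_N imm o h); field.
Qed.

Lemma sp_T_F u v : O (u, v) -> L0 * sp (T1 F u v) (F u v) = 0 /\ L0 * sp (T2 F u v) (F u v) = 0.
Proof.
move=> o; have h1 := sp_F_du F _ u v sF o sp_F_F; have h2 := sp_F_dv F _ u v sF o sp_F_F.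
rewrite -/(T1 F) (sp_sym _ (F u v)) in h1; rewrite -/(T2 F) (sp_sym _ (F u v)) in h2.
lra.
Qed.

Lemma sp_N_F u v : O (u, v) -> L0 * sp (N1 u v) (F u v) = 0 /\ L0 * sp (N2 u v) (F u v) = 0.
Proof.
move=> o; have [_ [_ h1]] := proj2 (ad_N1 ad) u v o; have [_ [_ h2]] := proj2 (ad_N2 ad) u v o.
by case: (Req_EM_T L0 0) => h; [rewrite {1 3}h; split; ring|rewrite h1 // h2 //; split; ring].
Qed.

Lemma sp_T u v : O (u, v) -> sp (T1 F u v) (T1 F u v) = E u v /\
  sp (T2 F u v) (T2 F u v) = E u v /\ sp (T1 F u v) (T2 F u v) = 0.
Proof.
move=> o; have e := ad_metric ad o; have [e1 e2] := imm_conformal imm o.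
by rewrite -e1 e.
Qed.

Lemma gauss_formula_u (V : vfield L0) u v i : O (u, v) ->
  vdu V u v i = L0 * sp (vdu V u v) (F u v) * F u v i
    + sp (vdu V u v) (T1 F u v) / E u v * T1 F u v i
    + sp (vdu V u v) (T2 F u v) / E u v * T2 F u v i
    + normal_part F (nabla_u F V) u v i.
Proof.
move=> o; have [e1 [e2 e3]] := sp_T u v o; have [f1 f2] := sp_T_F u v o.
have E0 : E u v <> 0 by have := exp_pos (2 * lam u v); rewrite -/(E u v); lra.
have t W : L0 * sp W (F u v) = 0 -> sp (nabla_u F V u v) W = sp (vdu V u v) W.
  move=> h; rewrite (sp_ext _ _ (fun i => 1 * vdu V u v i +
    (- (L0 * sp (vdu V u v) (F u v))) * F u v i)).
    rewrite sp_comb2 (sp_sym _ (F u v) W).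
    have -> : - (L0 * sp (vdu V u v) (F u v)) * sp W (F u v) =
      - sp (vdu V u v) (F u v) * (L0 * sp W (F u v)) by ring.
    by rewrite h; ring.
  by move=> j; rewrite /nabla_u; ring.
rewrite /normal_part !t // e1 e2 /nabla_u; field; exact: E0.
Qed.

Lemma gauss_formula_v (V : vfield L0) u v i : O (u, v) ->
  vdv V u v i = L0 * sp (vdv V u v) (F u v) * F u v i
    + sp (vdv V u v) (T1 F u v) / E u v * T1 F u v i
    + sp (vdv V u v) (T2 F u v) / E u v * T2 F u v i
    + normal_part F (nabla_v F V) u v i.
Proof.
move=> o; have [e1 [e2 e3]] := sp_T u v o; have [f1 f2] := sp_T_F u v o.
have E0 : E u v <> 0 by have := exp_pos (2 * lam u v); rewrite -/(E u v); lra.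
have t W : L0 * sp W (F u v) = 0 -> sp (nabla_v F V u v) W = sp (vdv V u v) W.
  move=> h; rewrite (sp_ext _ _ (fun i => 1 * vdv V u v i +
    (- (L0 * sp (vdv V u v) (F u v))) * F u v i)).
    rewrite sp_comb2 (sp_sym _ (F u v) W).
    have -> : - (L0 * sp (vdv V u v) (F u v)) * sp W (F u v) =
      - sp (vdv V u v) (F u v) * (L0 * sp W (F u v)) by ring.
    by rewrite h; ring.
  by move=> j; rewrite /nabla_v; ring.
rewrite /normal_part !t // e1 e2 /nabla_v; field; exact: E0.
Qed.

Definition frame (a : 'I_(adim L0)) (j : nat) (u v : R) : R :=
  match j with
  | 0%nat => F u v a
  | 1%nat => T1 F u v a
  | 2%nat => T2 F u v a
  | 3%nat => N1 u v a
  | _ => N2 u v a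
  end.

Lemma frame_smooth a j : smooth O (frame a j).
Proof.
case: j => [|[|[|[|j]]]].
- exact: sF.
- exact: s1.
- exact: s2.
- exact: sN1.
- exact: sN2.
Qed.

Lemma structure_T u v i : O (u, v) ->
  vdu (T1 F) u v i = - (L0 * E u v) * F u v i + du lam u v * T1 F u v i
     + - dv lam u v * T2 F u v i + al1 c u v * N1 u v i + be1 c u v * N2 u v i /\
  vdu (T2 F) u v i = 0 * F u v i + dv lam u v * T1 F u v i
     + du lam u v * T2 F u v i + al2 c u v * N1 u v i + be2 c u v * N2 u v i /\
  vdv (T2 F) u v i = - (L0 * E u v) * F u v i + - du lam u v * T1 F u v i
     + dv lam u v * T2 F u v i + al3 c u v * N1 u v i + be3 c u v * N2 u v i.
Proof.
move=> o; have [g1 [g2 g3]] := sp_T u v o.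
have E0 : E u v <> 0 by have := exp_pos (2 * lam u v); rewrite -/(E u v); lra.
have h11 := fun u v o => proj1 (sp_T u v o).
have h22 := fun u v o => proj1 (proj2 (sp_T u v o)).
have h12 := fun u v o => proj2 (proj2 (sp_T u v o)).
have dE := du_E O oO lam sl u v o; have dE' := dv_E O oO lam sl u v o.
have a1 := sp_du _ _ _ u v s1 s1 o h11; have a2 := sp_dv _ _ _ u v s1 s1 o h11.
have a3 := sp_du _ _ _ u v s2 s2 o h22; have a4 := sp_dv _ _ _ u v s2 s2 o h22.
have a5 := sp_du _ _ (fun _ _ => 0) u v s1 s2 o h12.
have a6 := sp_dv _ _ (fun _ _ => 0) u v s1 s2 o h12.
rewrite du_const in a5; rewrite dv_const in a6.
rewrite /E dE -/(E u v) in a1 a3; rewrite /E dE' -/(E u v) in a2 a4.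
have sw := T1_v_T2_u u v o.
rewrite sw in a2 a6.
rewrite (sp_sym _ (T1 F u v)) in a1; rewrite (sp_sym _ (T1 F u v)) in a2.
rewrite (sp_sym _ (T2 F u v)) in a3; rewrite (sp_sym _ (T2 F u v)) in a4.
rewrite (sp_sym _ (T1 F u v)) in a5; rewrite (sp_sym _ (T1 F u v)) in a6.
have hT1 := fun u v o => proj1 (sp_T_F u v o).
have hT2 := fun u v o => proj2 (sp_T_F u v o).
have b1 := sp_F_du _ _ u v s1 o hT1; have b2 := sp_F_du _ _ u v s2 o hT2.
have b3 := sp_F_dv _ _ u v s2 o hT2.
rewrite g1 in b1; rewrite (sp_sym _ (T2 F u v)) g3 in b2; rewrite g2 in b3.
have [d1 [d2 d3]] := ad_sff ad o i.
rewrite (gauss_formula_u (T1 F)) // (gauss_formula_u (T2 F)) // (gauss_formula_v (T2 F)) //.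
rewrite d1 d2 d3 b1 b2 b3 /comb.
have -> : sp (vdu (T1 F) u v) (T1 F u v) = du lam u v * E u v by lra.
have -> : sp (vdu (T2 F) u v) (T1 F u v) = dv lam u v * E u v by lra.
have -> : sp (vdu (T2 F) u v) (T2 F u v) = du lam u v * E u v by lra.
have -> : sp (vdv (T2 F) u v) (T2 F u v) = dv lam u v * E u v by lra.
have -> : sp (vdu (T1 F) u v) (T2 F u v) = - dv lam u v * E u v by lra.
have -> : sp (vdv (T2 F) u v) (T1 F u v) = - du lam u v * E u v by lra.
by split; [|split]; field.
Qed.

Lemma structure_N u v i : O (u, v) ->
  (vdu N1 u v i = 0 * F u v i + - al1 c u v * T1 F u v i
     + - al2 c u v * T2 F u v i + du lam u v * N1 u v i + mu1 c u v * N2 u v i /\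
   vdv N1 u v i = 0 * F u v i + - al2 c u v * T1 F u v i
     + - al3 c u v * T2 F u v i + dv lam u v * N1 u v i + mu2 c u v * N2 u v i) /\
  (vdu N2 u v i = 0 * F u v i + be1 c u v * T1 F u v i
     + be2 c u v * T2 F u v i + mu1 c u v * N1 u v i + du lam u v * N2 u v i /\
   vdv N2 u v i = 0 * F u v i + be2 c u v * T1 F u v i
     + be3 c u v * T2 F u v i + mu2 c u v * N1 u v i + dv lam u v * N2 u v i).
Proof.
move=> o; have [g1 [g2 g3]] := sp_T u v o.
have E0 : E u v <> 0 by have := exp_pos (2 * lam u v); rewrite -/(E u v); lra.
have st := fun i => structure_T u v i o.
have n1 := fun u v o => proj1 (proj2 (ad_N1 ad) u v o).
have n2 := fun u v o => proj1 (proj2 (proj2 (ad_N1 ad) u v o)).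
have m1 := fun u v o => proj1 (proj2 (ad_N2 ad) u v o).
have m2 := fun u v o => proj1 (proj2 (proj2 (ad_N2 ad) u v o)).
have [q1 [q2 q3]] := ad_norm ad o; rewrite -/(E u v) in q1 q2.
have [f1 f2] := sp_N_F u v o.
have S1 : sp (vdu (T1 F) u v) (N1 u v) = al1 c u v * E u v /\
    sp (vdu (T1 F) u v) (N2 u v) = - be1 c u v * E u v.
  rewrite !(sp_ext _ (vdu (T1 F) u v) _ _ (fun i => proj1 (st i))) !sp_comb5.
  rewrite q1 q2 q3 (sp_sym _ (N2 u v) (N1 u v)) q3 !(sp_sym _ _ (N1 u v)) !(sp_sym _ _ (N2 u v)).
  rewrite !(sp_sym _ _ (T1 F u v)) !(sp_sym _ _ (T2 F u v)).
  rewrite !(sp_sym _ (T1 F u v)) !(sp_sym _ (T2 F u v)) n1 // n2 // m1 // m2 //.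
  have r1 : - (L0 * E u v) * sp (N1 u v) (F u v) = - E u v * (L0 * sp (N1 u v) (F u v)) by ring.
  have r2 : - (L0 * E u v) * sp (N2 u v) (F u v) = - E u v * (L0 * sp (N2 u v) (F u v)) by ring.
  by rewrite r1 r2 f1 f2; split; ring.
have S2 : sp (vdu (T2 F) u v) (N1 u v) = al2 c u v * E u v /\
    sp (vdu (T2 F) u v) (N2 u v) = - be2 c u v * E u v.
  rewrite !(sp_ext _ (vdu (T2 F) u v) _ _ (fun i => proj1 (proj2 (st i)))) !sp_comb5.
  rewrite q1 q2 q3 (sp_sym _ (N2 u v) (N1 u v)) q3.
  rewrite !(sp_sym _ (T1 F u v)) !(sp_sym _ (T2 F u v)) n1 // n2 // m1 // m2 //.
  by split; ring.
have S3 : sp (vdv (T2 F) u v) (N1 u v) = al3 c u v * E u v /\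
    sp (vdv (T2 F) u v) (N2 u v) = - be3 c u v * E u v.
  rewrite !(sp_ext _ (vdv (T2 F) u v) _ _ (fun i => proj2 (proj2 (st i)))) !sp_comb5.
  rewrite q1 q2 q3 (sp_sym _ (N2 u v) (N1 u v)) q3.
  rewrite !(sp_sym _ (T1 F u v)) !(sp_sym _ (T2 F u v)) n1 // n2 // m1 // m2 //.
  rewrite !(sp_sym _ (F u v)).
  have r1 : - (L0 * E u v) * sp (N1 u v) (F u v) = - E u v * (L0 * sp (N1 u v) (F u v)) by ring.
  have r2 : - (L0 * E u v) * sp (N2 u v) (F u v) = - E u v * (L0 * sp (N2 u v) (F u v)) by ring.
  by rewrite r1 r2 f1 f2; split; ring.
have sw := T1_v_T2_u u v o.
have a1 := sp_du _ _ (fun _ _ => 0) u v sN1 s1 o n1.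
have a2 := sp_du _ _ (fun _ _ => 0) u v sN1 s2 o n2.
have a3 := sp_dv _ _ (fun _ _ => 0) u v sN1 s1 o n1.
have a4 := sp_dv _ _ (fun _ _ => 0) u v sN1 s2 o n2.
have b1 := sp_du _ _ (fun _ _ => 0) u v sN2 s1 o m1.
have b2 := sp_du _ _ (fun _ _ => 0) u v sN2 s2 o m2.
have b3 := sp_dv _ _ (fun _ _ => 0) u v sN2 s1 o m1.
have b4 := sp_dv _ _ (fun _ _ => 0) u v sN2 s2 o m2.
rewrite sw in a3 b3.
rewrite !du_const !(sp_sym _ (N1 u v)) in a1 a2; rewrite !dv_const !(sp_sym _ (N1 u v)) in a3 a4.
rewrite !du_const !(sp_sym _ (N2 u v)) in b1 b2; rewrite !dv_const !(sp_sym _ (N2 u v)) in b3 b4.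
have c1 := sp_F_du _ _ u v sN1 o (fun u v o => proj1 (sp_N_F u v o)).
have c2 := sp_F_dv _ _ u v sN1 o (fun u v o => proj1 (sp_N_F u v o)).
have c3 := sp_F_du _ _ u v sN2 o (fun u v o => proj2 (sp_N_F u v o)).
have c4 := sp_F_dv _ _ u v sN2 o (fun u v o => proj2 (sp_N_F u v o)).
rewrite n1 // in c1; rewrite n2 // in c2; rewrite m1 // in c3; rewrite m2 // in c4.
have [d1 [d2 [d3 d4]]] := ad_nperp ad o i; rewrite /nperp_u /nperp_v in d1 d2 d3 d4.
rewrite (gauss_formula_u N1) // (gauss_formula_u N2) // (gauss_formula_v N1) // (gauss_formula_v N2) //.
rewrite d1 d2 d3 d4 c1 c2 c3 c4 /comb.
case: S1 => S11 S12; case: S2 => S21 S22; case: S3 => S31 S32.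
have -> : sp (vdu N1 u v) (T1 F u v) = - al1 c u v * E u v by lra.
have -> : sp (vdu N1 u v) (T2 F u v) = - al2 c u v * E u v by lra.
have -> : sp (vdv N1 u v) (T1 F u v) = - al2 c u v * E u v by lra.
have -> : sp (vdv N1 u v) (T2 F u v) = - al3 c u v * E u v by lra.
have -> : sp (vdu N2 u v) (T1 F u v) = be1 c u v * E u v by lra.
have -> : sp (vdu N2 u v) (T2 F u v) = be2 c u v * E u v by lra.
have -> : sp (vdv N2 u v) (T1 F u v) = be2 c u v * E u v by lra.
have -> : sp (vdv N2 u v) (T2 F u v) = be3 c u v * E u v by lra.
by split; split; field.
Qed.

Theorem frame_is_sol a : is_sol 4 (frame_u L0 lam c) (frame_v L0 lam c) O (frame a).
Proof.
apply: smooth_is_sol => [i _|u v i o hi]; first exact: frame_smooth.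
have [t1 [t2 t3]] := structure_T u v a o; have [[n1 n2] [n3 n4]] := structure_N u v a o.
have t4 := f_equal (fun x => x a) (T1_v_T2_u u v o).
rewrite /= t2 in t4.
move: i hi => [|[|[|[|[|i]]]]] hi; try lia; rewrite /act /=; split.
- by transitivity (T1 F u v a) => //; ring.
- by transitivity (T2 F u v a) => //; ring.
- by rewrite [LHS]t1.
- by rewrite [LHS]t4.
- by rewrite [LHS]t2.
- by rewrite [LHS]t3.
- by rewrite [LHS]n1.
- by rewrite [LHS]n2.
- by rewrite [LHS]n3.
- by rewrite [LHS]n4.
Qed.

Lemma frame_curvature u v : O (u, v) ->
  gauss_curvature (induced_metric F) u v =
  - (du (du lam) u v + dv (dv lam) u v) / exp (2 * lam u v).
Proof.
apply: (gauss_curvature_conformal O oO) => // [i x y o|i j x y o].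
  by have [e1 [e2 _]] := sp_T x y o; case: i.
have [_ [_ e]] := sp_T x y o.
by case: i; case: j => //= _; rewrite /induced_metric // sp_sym.
Qed.

(** The equations of Codazzi: the curvature of the frame system annihilates the
    frame, whose normal vectors are independent. *)
Lemma frame_codazzi u v : smooth_coeffs O c -> O (u, v) ->
  curv 4 (frame_u L0 lam c) (frame_v L0 lam c) 1 3 u v = 0 /\
  curv 4 (frame_u L0 lam c) (frame_v L0 lam c) 1 4 u v = 0 /\
  curv 4 (frame_u L0 lam c) (frame_v L0 lam c) 2 3 u v = 0 /\
  curv 4 (frame_u L0 lam c) (frame_v L0 lam c) 2 4 u v = 0.
Proof.
move=> sc o.
have E0 : E u v <> 0 by have := exp_pos (2 * lam u v); rewrite -/(E u v); lra.
set cu := curv 4 (frame_u L0 lam c) (frame_v L0 lam c).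
have H i : (i <= 4)%nat -> cu i 0%nat u v = 0 -> cu i 3%nat u v = 0 /\ cu i 4%nat u v = 0.
  move=> hi z.
  have K a : cu i 0%nat u v * F u v a + cu i 1%nat u v * T1 F u v a +
      cu i 2%nat u v * T2 F u v a + cu i 3%nat u v * N1 u v a + cu i 4%nat u v * N2 u v a = 0.
    have := is_sol_curv O oO 4 _ _ (frame a) i u v
      (frame_u_smooth L0 O oO lam c sl sc) (frame_v_smooth L0 O oO lam c sl sc)
      (frame_is_sol a) hi o.
    by rewrite /= -/cu.
  have Z W : cu i 0%nat u v * sp (F u v) W + cu i 1%nat u v * sp (T1 F u v) W +
      cu i 2%nat u v * sp (T2 F u v) W + cu i 3%nat u v * sp (N1 u v) W +
      cu i 4%nat u v * sp (N2 u v) W = 0.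
    rewrite -sp_comb5 (sp_ext _ _ (fun a => 0 * F u v a)); first by rewrite sp_scal; ring.
    by move=> a; rewrite K; ring.
  have [q1 [q2 q3]] := ad_norm ad o; rewrite -/(E u v) in q1 q2.
  have [n1 [n2 _]] := proj2 (ad_N1 ad) u v o; have [m1 [m2 _]] := proj2 (ad_N2 ad) u v o.
  have := Z (N1 u v); have := Z (N2 u v).
  rewrite (sp_sym _ (N2 u v) (N1 u v)) q1 q2 q3 !(sp_sym _ (T1 F u v)) !(sp_sym _ (T2 F u v)).
  rewrite n1 n2 m1 m2 z => k1 k2.
  by split; apply: (Rmult_eq_reg_r (E u v)) => //; lra.
have hE : dv (fun u v => - (L0 * exp (2 * lam u v))) u v =
    - (L0 * (2 * dv lam u v * exp (2 * lam u v))).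
  rewrite dv_opp (dv_mult O) //; [|exact: smooth_const|exact: smooth_E].
  by rewrite dv_const (dv_E O) //; ring.
have hE' : du (fun u v => - (L0 * exp (2 * lam u v))) u v =
    - (L0 * (2 * du lam u v * exp (2 * lam u v))).
  rewrite du_opp (du_mult O) //; [|exact: smooth_const|exact: smooth_E].
  by rewrite du_const (du_E O) //; ring.
have z1 : cu 1%nat 0%nat u v = 0.
  by rewrite /cu /curv /= /frame_u /frame_v ?dv_const ?du_const hE; ring.
have z2 : cu 2%nat 0%nat u v = 0.
  by rewrite /cu /curv /= /frame_u /frame_v ?dv_const ?du_const hE'; ring.
have [? ?] := H 1%nat ltac:(lia) z1; have [? ?] := H 2%nat ltac:(lia) z2.
by [].
Qed.

End Structure.

(** * The conditions on the potentials at a point *)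

Section Pointwise.

Variables (f k : R -> R -> C) (u v : R).
Let p := Cdu f u v.
Let q := Cdv f u v.

Lemma RtoC_fA : RtoC (fA f u v) = cA p q.
Proof. by rewrite /fA RtoC_2Re /fufv /cA Cmult_conj Cconj_conj. Qed.

Lemma RtoC_fA' : RtoC (fA' f u v) = (- Ci * cJ p q)%C.
Proof. by rewrite /fA' RtoC_2Im /fufv /cJ Cmult_conj Cconj_conj. Qed.

Lemma RtoC_fB : RtoC (fB f u v) = cB p q.
Proof. by rewrite /fB RtoC_minus !Cmod2_conj. Qed.

Lemma cond_iii_iff : cond_iii f u v <-> cA p q <> 0%C /\ cJ p q <> 0%C.
Proof.
rewrite -RtoC_fA /cond_iii /fA.
have e : Im (fufv f u v) = 0 <-> cJ p q = 0%C.
  split=> h; last first.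
    by have := RtoC_fA'; rewrite h Cmult_0_r /fA' => /RtoC_inj; lra.
  have := RtoC_fA'; rewrite /fA' h Rmult_0_r => e.
  by apply: (Cmult_eq0 (- Ci)); [rewrite -e|apply: Copp_neq0; exact: Ci_nz].
split=> [h|[h1 h2] /Rmult_integral [h|h]].
- split; first by move=> /RtoC_inj z; apply: h; nra.
  by move/e => z; apply: h; rewrite z; ring.
- by apply: h1; rewrite h; congr RtoC; ring.
- by apply: h2; apply/e.
Qed.

Lemma cond_ii_iff : cond_ii f u v <-> cr p q = Cconj (cr p q).
Proof.
rewrite -Im_eq0_iff /cond_ii -/p -/q /cr; case: p => a b; case: q => c d /=; lra.
Qed.

Lemma cond_iv_iff : cond_iv k f u v <->
  (cA p q * k u v + Ci * cB p q <> 0)%C /\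
  (Cconj (k u v) = (Ci * cB p q * k u v + cA p q) / (cA p q * k u v + Ci * cB p q))%C.
Proof. by rewrite /cond_iv RtoC_fA RtoC_fB. Qed.

Lemma cond_vi_iff lam gam psi : cJ p q <> 0%C ->
  cond_vi lam gam k psi f u v <->
  (RtoC (du gam u v) = Cdu k u v / (k u v * k u v - 1) -
    Ci * ((Cconj p * dv psi u v - Cconj q * du psi u v) / cJ p q) * p
    - Ci / cJ p q * ((1 + 1) * (p * Cconj p) * du lam u v + cA p q * dv lam u v))%C /\
  (RtoC (dv gam u v) = Cdv k u v / (k u v * k u v - 1) -
    Ci * ((Cconj p * dv psi u v - Cconj q * du psi u v) / cJ p q) * q
    - Ci / cJ p q * (cA p q * du lam u v + (1 + 1) * (q * Cconj q) * dv lam u v))%C.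
Proof.
move=> J0; rewrite /cond_vi /jac /conjf Cdu_RtoC Cdv_RtoC Cdu_conj Cdv_conj -/p -/q.
have -> : (p * Cconj q - q * Cconj p = cJ p q)%C by rewrite /cJ; ring.
have A0 : fA' f u v <> 0.
  move=> e; have := RtoC_fA'; rewrite e => e'; apply: J0.
  by apply: (Cmult_eq0 (- Ci)); [rewrite -e'|apply: Copp_neq0; exact: Ci_nz].
have e1 : RtoC (1 / fA' f u v * (2 * Cmod p ^ 2 * du lam u v + fA f u v * dv lam u v)) =
    (Ci / cJ p q * ((1 + 1) * (p * Cconj p) * du lam u v + cA p q * dv lam u v))%C.
  rewrite RtoC_mult RtoC_div // RtoC_plus (RtoC_mult (2 * _)) (RtoC_mult 2)
    (RtoC_mult (fA f u v)) -Cmod2_conj -RtoC_fA RtoC_fA'.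
  have -> : RtoC 2 = (1 + 1)%C by rewrite -RtoC_plus.
  have n : (- Ci * cJ p q <> 0)%C.
    by apply: Cmult_neq_0 => //; apply: Copp_neq0; exact: Ci_nz.
  by field [Ci2]; split=> //; exact: Ci_nz.
have e2 : RtoC (1 / fA' f u v * (fA f u v * du lam u v + 2 * Cmod q ^ 2 * dv lam u v)) =
    (Ci / cJ p q * (cA p q * du lam u v + (1 + 1) * (q * Cconj q) * dv lam u v))%C.
  rewrite RtoC_mult RtoC_div // RtoC_plus (RtoC_mult (2 * _)) (RtoC_mult 2)
    (RtoC_mult (fA f u v)) -Cmod2_conj -RtoC_fA RtoC_fA'.
  have -> : RtoC 2 = (1 + 1)%C by rewrite -RtoC_plus.
  have n : (- Ci * cJ p q <> 0)%C.
    by apply: Cmult_neq_0 => //; apply: Copp_neq0; exact: Ci_nz.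
  by field [Ci2]; split=> //; exact: Ci_nz.
rewrite e1 e2.
have t (x z w y : C) : (1 / x * y - z - w = y / x - z - w)%C.
  by congr (_ - _ - _)%C; rewrite /Cdiv; ring.
by rewrite !t.
Qed.

(** The left-hand side is [A] times [i A'], up to the factor [|s|^4]. *)
Lemma nonreal_iff (s : C) : s <> 0%C ->
  (Ci * q / s * (Ci * q / s) * (Cconj (p / s) * Cconj (p / s)) -
   Cconj (Ci * q / s) * Cconj (Ci * q / s) * (p / s * (p / s)) <> 0)%C <->
  cond_iii f u v.
Proof.
move=> s0; have sb0 := Cconj_neq0 _ s0; rewrite cond_iii_iff.
have -> : (Ci * q / s * (Ci * q / s) * (Cconj (p / s) * Cconj (p / s)) -
   Cconj (Ci * q / s) * Cconj (Ci * q / s) * (p / s * (p / s)) =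
   cA p q * cJ p q / (s * Cconj s * (s * Cconj s)))%C.
  by rewrite !Cdiv_conj // Cmult_conj Cconj_Ci /cA /cJ; field [Ci2].
split=> [h|[h1 h2]].
- by split=> e; apply: h; rewrite e /Cdiv; ring.
- apply: (Cmult_neq0_l _ (s * Cconj s * (s * Cconj s))).
  have -> : (cA p q * cJ p q / (s * Cconj s * (s * Cconj s)) * (s * Cconj s * (s * Cconj s)) =
    cA p q * cJ p q)%C by field; split.
  exact: Cmult_neq_0.
Qed.

End Pointwise.

Lemma k2_neq1 (k : C) : k <> 1%C -> k <> (-1)%C -> (k * k - 1 <> 0)%C.
Proof.
move=> h1 h2.
have -> : (k * k - 1 = (k - 1) * (k - -1))%C by apply: injective_projections => /=; ring.
apply: Cmult_neq_0 => e; [apply: h1|apply: h2].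
- by transitivity (k - 1 + 1)%C; [ring|rewrite e; ring].
- by transitivity (k - -1 + -1)%C; [ring|rewrite e; ring].
Qed.

(** * From the surface to the conditions *)

Section Forward.

Variables (L0 : R) (O : R * R -> Prop).
Hypothesis oO : open O.
Hypothesis sc : simply_connected O.
Variables (c : coeffs) (lam gam : R -> R -> R) (k f : R -> R -> C).
Hypothesis po : potentials O c gam k f.

Variable s : R -> R -> C.
Hypothesis sb : sqrt_branch O k s.
Hypothesis XY : forall u v, O (u, v) ->
  fX c u v = (Ci * Cdv f u v / s u v)%C /\ fY c u v = (Cdu f u v / s u v)%C.

Let sk : Csmooth O k := po_k po.
Let sf : Csmooth O f := po_f po.
Let ssm : Csmooth O s := proj1 sb.
Let ss : forall u v, O (u, v) -> (s u v * s u v = k u v * k u v - 1)%C := proj2 sb.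
Let eX u v o := proj1 (XY u v o).
Let eY u v o := proj2 (XY u v o).
Let eW u v o := proj1 (po_WZ po (u := u) (v := v) o).
Let eZ u v o := proj2 (po_WZ po (u := u) (v := v) o).

Lemma branch_neq0 u v : O (u, v) -> s u v <> 0%C.
Proof.
move=> o e; have [_ [h1 h2]] := po_k_value po o.
by apply: (k2_neq1 _ h1 h2); rewrite -ss // e; ring.
Qed.

Lemma potentials_smooth_coeffs : smooth_coeffs O c.
Proof.
have nz := branch_neq0.
have sfu := Csmooth_Cdu O _ sf; have sfv := Csmooth_Cdv O _ sf.
have sX : Csmooth O (fX c).
  apply: (Csmooth_agree O oO (fun u v => Ci * Cdv f u v / s u v)%C).
    by move=> x y h; rewrite eX.
  apply: Csmooth_div => //; apply: Csmooth_mult => //; exact: Csmooth_const.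
have sY : Csmooth O (fY c).
  apply: (Csmooth_agree O oO (fun u v => Cdu f u v / s u v)%C).
    by move=> x y h; rewrite eY.
  exact: Csmooth_div.
have sW : Csmooth O (fW c).
  apply: (Csmooth_agree O oO (fun u v => k u v * fY c u v)%C).
    by move=> x y h; rewrite eW.
  exact: Csmooth_mult.
have sZ : Csmooth O (fZ c).
  apply: (Csmooth_agree O oO (fun u v => k u v * fX c u v)%C).
    by move=> x y h; rewrite eZ.
  exact: Csmooth_mult.
have op (g : R -> R -> R) : smooth O (fun u v => - g u v) -> smooth O g.
  move=> h; apply: (smooth_agree O oO (fun u v => - - g u v)); last exact: smooth_opp.
  by move=> x y _; ring.
split.
- by apply: op; case: sY.
- by case: sX.
- by case: sZ.
- by apply: op; case: sW.
- by case: sY.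
- by case: sX.
- apply: (smooth_agree O oO (du gam)); last exact: smooth_du (po_gam po).
  by move=> x y h; have [] := po_mu po h.
- apply: (smooth_agree O oO (dv gam)); last exact: smooth_dv (po_gam po).
  by move=> x y h; have [] := po_mu po h.
Qed.

Lemma potentials_cons u v : O (u, v) -> cons (Cdu f u v) (Cdv f u v) (k u v) (s u v).
Proof.
by move=> o; split; rewrite -eX // -eY // -?eW // -?eZ.
Qed.

Hypothesis iii : forall u v, O (u, v) -> cond_iii f u v.

Let A0 u v (o : O (u, v)) : cA (Cdu f u v) (Cdv f u v) <> 0%C :=
  proj1 (proj1 (cond_iii_iff f u v) (iii u v o)).
Let J0 u v (o : O (u, v)) : cJ (Cdu f u v) (Cdv f u v) <> 0%C :=
  proj2 (proj1 (cond_iii_iff f u v) (iii u v o)).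

Lemma potentials_real u v : O (u, v) ->
  cr (Cdu f u v) (Cdv f u v) = Cconj (cr (Cdu f u v) (Cdv f u v)).
Proof.
move=> o; apply: (solved_cr_real _ _ (k u v) (s u v)).
- exact: branch_neq0.
- exact: ss.
- exact: A0.
- by apply: cons_solved; [exact: branch_neq0|exact: potentials_cons].
Qed.

Lemma potentials_solved u v : O (u, v) ->
  (cA (Cdu f u v) (Cdv f u v) * k u v + Ci * cB (Cdu f u v) (Cdv f u v) =
   - Ci * (cr (Cdu f u v) (Cdv f u v) * (s u v / Cconj (s u v))))%C.
Proof.
move=> o; rewrite potentials_real //.
by apply: cons_solved; [exact: branch_neq0|exact: potentials_cons].
Qed.

Lemma potentials_iv u v : O (u, v) -> cond_iv k f u v.
Proof.
move=> o; apply/cond_iv_iff; apply: (solved_iv _ _ _ (s u v)).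
- exact: branch_neq0.
- exact: A0.
- exact: potentials_real.
- exact: potentials_solved.
Qed.

(** The angle [psi]: the cosine and the sine are the quotients of [A] and [-B]
    by the real number [f_u^2 + f_v^2]. *)
Lemma potentials_angle : exists psi, smooth O psi /\ forall u v, O (u, v) ->
  (cA (Cdu f u v) (Cdv f u v) = cr (Cdu f u v) (Cdv f u v) * cos (psi u v))%C /\
  (cB (Cdu f u v) (Cdv f u v) = - (cr (Cdu f u v) (Cdv f u v) * sin (psi u v)))%C.
Proof.
pose r u v := Re (cr (Cdu f u v) (Cdv f u v)).
have er u v : O (u, v) -> cr (Cdu f u v) (Cdv f u v) = RtoC (r u v).
  by move=> o; apply: real_eq; exact: potentials_real.
have r0 u v : O (u, v) -> r u v <> 0.
  by move=> o e; apply: (cr_neq0 _ _ (A0 u v o)); rewrite er // e.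
have sfu := Csmooth_Cdu O _ sf; have sfv := Csmooth_Cdv O _ sf.
have sr : smooth O r.
  by have [h _] := Csmooth_plus O oO _ _ (Csmooth_mult O oO _ _ sfu sfu) (Csmooth_mult O oO _ _ sfv sfv).
have sri : smooth O (fun u v => / r u v) by exact: smooth_inv.
have scj := Csmooth_conj O oO.
have sA : smooth O (fA f).
  apply: smooth_mult => //; first exact: smooth_const.
  by have [h _] := Csmooth_mult O oO _ _ sfu (scj _ sfv).
have sB : smooth O (fB f).
  have h := Csmooth_minus O oO _ _ (Csmooth_mult O oO _ _ sfu (scj _ sfu))
    (Csmooth_mult O oO _ _ sfv (scj _ sfv)).
  apply: (smooth_agree O oO _ _ _ (proj1 h)) => x y o /=.
  by have := RtoC_fB f x y; rewrite /cB => e; rewrite -[RHS]/(Re (RtoC (fB f x y))) e.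
have AB u v : O (u, v) -> fA f u v * fA f u v + fB f u v * fB f u v = r u v * r u v.
  move=> o; apply: RtoC_inj; rewrite RtoC_plus (RtoC_mult (fA f u v)) (RtoC_mult (fB f u v)).
  rewrite (RtoC_mult (r u v)) RtoC_fA RtoC_fB cA2_cB2.
  by rewrite -potentials_real // er.
have unit u v : O (u, v) -> fA f u v * / r u v * (fA f u v * / r u v) +
    - (fB f u v * / r u v) * - (fB f u v * / r u v) = 1.
  move=> o; have n := r0 u v o.
  transitivity ((fA f u v * fA f u v + fB f u v * fB f u v) / (r u v * r u v)).
    by field.
  by rewrite AB //; field.
have [psi [sp Hp]] := angle_lift O oO sc (fun u v => fA f u v * / r u v)
  (fun u v => - (fB f u v * / r u v)) (smooth_mult O oO _ _ sA sri)
  (smooth_opp O oO _ (smooth_mult O oO _ _ sB sri)) unit.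
exists psi; split=> // u v o; have [-> ->] := Hp u v o.
have n := r0 u v o.
rewrite -RtoC_fA -RtoC_fB er // -!RtoC_mult -RtoC_opp; split; congr RtoC; field; exact: n.
Qed.

(** Relation (iv) takes the form [cos psi (|k|^2 - 1) = 2 sin psi Im k]; its
    derivatives feed [log_derivative_imag]. *)
Lemma angle_conditions psi : smooth O psi ->
  (forall u v, O (u, v) ->
    (cA (Cdu f u v) (Cdv f u v) = cr (Cdu f u v) (Cdv f u v) * cos (psi u v))%C /\
    (cB (Cdu f u v) (Cdv f u v) = - (cr (Cdu f u v) (Cdv f u v) * sin (psi u v)))%C) ->
  forall u v, O (u, v) -> codazzi_defect lam c k f u v = 0%C ->
  cond_v psi f u v /\ cond_vi lam gam k psi f u v.
Proof.
move=> sp Hp u v o cod.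
have r0 x y (h : O (x, y)) := cr_neq0 _ _ (A0 x y h).
split.
  have [a b] := Hp u v o; rewrite /cond_v /conjf Cdu_conj Cdv_conj.
  split; apply: (Cmult_cancel _ _ _ (r0 u v o)).
  - by rewrite cr_rotation_u a b; ring.
  - by rewrite cr_rotation_v a b; ring.
have [scos ssin] := smooth_cos_sin O oO psi sp.
have g x y : O (x, y) ->
    (cos (psi x y) * k x y - Ci * sin (psi x y) = - Ci * (s x y / Cconj (s x y)))%C.
  move=> h; have [a b] := Hp x y h; apply: (Cmult_cancel _ _ _ (r0 x y h)).
  have e := potentials_solved x y h; rewrite a b in e.
  have -> : (forall r t : C, r * (- Ci * t) = - Ci * (r * t))%C by move=> *; ring.
  by rewrite -e; ring.
have D x y : O (x, y) -> (cos (psi x y) * (k x y * Cconj (k x y) - 1) +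
    Ci * sin (psi x y) * (k x y - Cconj (k x y)) = 0)%C.
  move=> h; have [a b] := Hp x y h; have /cond_iv_iff [n e] := potentials_iv x y h.
  apply: (Cmult_eq0 _ _ _ (r0 x y h)).
  rewrite a b in n e.
  have e' : (Cconj (k x y) * (cr (Cdu f x y) (Cdv f x y) * cos (psi x y) * k x y +
      Ci * - (cr (Cdu f x y) (Cdv f x y) * sin (psi x y))) =
      Ci * - (cr (Cdu f x y) (Cdv f x y) * sin (psi x y)) * k x y +
      cr (Cdu f x y) (Cdv f x y) * cos (psi x y))%C.
    by rewrite e; field.
  apply: (Cmult_cancel 1); first by move/RtoC_inj; lra.
  transitivity (Cconj (k x y) * (cr (Cdu f x y) (Cdv f x y) * cos (psi x y) * k x y +
      Ci * - (cr (Cdu f x y) (Cdv f x y) * sin (psi x y))) -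
      (Ci * - (cr (Cdu f x y) (Cdv f x y) * sin (psi x y)) * k x y +
      cr (Cdu f x y) (Cdv f x y) * cos (psi x y)))%C; first by ring.
  by rewrite e'; ring.
have sck := Csmooth_conj O oO k sk.
have s1 : Csmooth O (fun x y => RtoC (cos (psi x y))) by exact: Csmooth_RtoC.
have s2 : Csmooth O (fun x y => k x y * Cconj (k x y) - 1)%C.
  by apply: Csmooth_minus => //; [exact: Csmooth_mult|exact: Csmooth_const].
have s3 : Csmooth O (fun x y => Ci * RtoC (sin (psi x y)))%C.
  by apply: Csmooth_mult => //; [exact: Csmooth_const|exact: Csmooth_RtoC].
have s3' : Csmooth O (fun x y => RtoC (sin (psi x y))) by exact: Csmooth_RtoC.
have s4 : Csmooth O (fun x y => k x y - Cconj (k x y))%C by exact: Csmooth_minus.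
have s5 := Csmooth_mult O oO _ _ s1 s2; have s6 := Csmooth_mult O oO _ _ s3 s4.
have s7 : Csmooth O (fun x y => - (Ci * RtoC (sin (psi x y)) * (k x y - Cconj (k x y))))%C
  by exact: Csmooth_opp.
have Du : (du psi u v * (- (sin (psi u v) * (k u v * Cconj (k u v) - 1)) +
      Ci * cos (psi u v) * (k u v - Cconj (k u v))) +
    cos (psi u v) * (Cdu k u v * Cconj (k u v) + k u v * Cconj (Cdu k u v)) +
    Ci * sin (psi u v) * (Cdu k u v - Cconj (Cdu k u v)) = 0)%C.
  have := Cdu_agree O oO (fun x y => cos (psi x y) * (k x y * Cconj (k x y) - 1))%C
    (fun x y => - (Ci * sin (psi x y) * (k x y - Cconj (k x y))))%C u v _ o.
  move=> /(_ (fun x y h => ltac:(have e := D x y h;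
    transitivity (cos (psi x y) * (k x y * Cconj (k x y) - 1) +
    Ci * sin (psi x y) * (k x y - Cconj (k x y)) -
    Ci * sin (psi x y) * (k x y - Cconj (k x y)))%C; [ring|rewrite e; ring]))).
  have -> : Cdu (fun x y => - (Ci * sin (psi x y) * (k x y - Cconj (k x y))))%C u v =
    (- Cdu (fun x y => (Ci * sin (psi x y) * (k x y - Cconj (k x y)))%C) u v)%C.
    by congr pair; exact: du_opp.
  rewrite (Cdu_mult O oO _ _ _ _ s1 s2 o) (Cdu_mult O oO _ _ _ _ s3 s4 o).
  rewrite (Cdu_mult O oO (fun _ _ => Ci) _ _ _ (Csmooth_const O Ci) s3' o).
  rewrite (Cdu_minus O _ _ _ _ (Csmooth_mult O oO _ _ sk sck) (Csmooth_const O _) o).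
  rewrite (Cdu_minus O _ _ _ _ sk sck o) (Cdu_mult O oO _ _ _ _ sk sck o).
  rewrite !Cdu_const !Cdu_RtoC Cdu_conj (du_cos O) // (du_sin O) // => E.
  rewrite !RtoC_mult RtoC_opp in E.
  transitivity ((- RtoC (sin (psi u v)) * du psi u v * (k u v * Cconj (k u v) - 1) +
    cos (psi u v) * (Cdu k u v * Cconj (k u v) + k u v * Cconj (Cdu k u v) - 0)) +
    ((0 * sin (psi u v) + Ci * (cos (psi u v) * du psi u v)) * (k u v - Cconj (k u v)) +
     Ci * sin (psi u v) * (Cdu k u v - Cconj (Cdu k u v))))%C; first by ring.
  by rewrite E; ring.
have Dv : (dv psi u v * (- (sin (psi u v) * (k u v * Cconj (k u v) - 1)) +
      Ci * cos (psi u v) * (k u v - Cconj (k u v))) +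
    cos (psi u v) * (Cdv k u v * Cconj (k u v) + k u v * Cconj (Cdv k u v)) +
    Ci * sin (psi u v) * (Cdv k u v - Cconj (Cdv k u v)) = 0)%C.
  have := Cdv_agree O oO (fun x y => cos (psi x y) * (k x y * Cconj (k x y) - 1))%C
    (fun x y => - (Ci * sin (psi x y) * (k x y - Cconj (k x y))))%C u v _ o.
  move=> /(_ (fun x y h => ltac:(have e := D x y h;
    transitivity (cos (psi x y) * (k x y * Cconj (k x y) - 1) +
    Ci * sin (psi x y) * (k x y - Cconj (k x y)) -
    Ci * sin (psi x y) * (k x y - Cconj (k x y)))%C; [ring|rewrite e; ring]))).
  have -> : Cdv (fun x y => - (Ci * sin (psi x y) * (k x y - Cconj (k x y))))%C u v =
    (- Cdv (fun x y => (Ci * sin (psi x y) * (k x y - Cconj (k x y)))%C) u v)%C.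
    by congr pair; exact: dv_opp.
  rewrite (Cdv_mult O oO _ _ _ _ s1 s2 o) (Cdv_mult O oO _ _ _ _ s3 s4 o).
  rewrite (Cdv_mult O oO (fun _ _ => Ci) _ _ _ (Csmooth_const O Ci) s3' o).
  rewrite (Cdv_minus O _ _ _ _ (Csmooth_mult O oO _ _ sk sck) (Csmooth_const O _) o).
  rewrite (Cdv_minus O _ _ _ _ sk sck o) (Cdv_mult O oO _ _ _ _ sk sck o).
  rewrite !Cdv_const !Cdv_RtoC Cdv_conj (dv_cos O) // (dv_sin O) // => E.
  rewrite !RtoC_mult RtoC_opp in E.
  transitivity ((- RtoC (sin (psi u v)) * dv psi u v * (k u v * Cconj (k u v) - 1) +
    cos (psi u v) * (Cdv k u v * Cconj (k u v) + k u v * Cconj (Cdv k u v) - 0)) +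
    ((0 * sin (psi u v) + Ci * (cos (psi u v) * dv psi u v)) * (k u v - Cconj (k u v)) +
     Ci * sin (psi u v) * (Cdv k u v - Cconj (Cdv k u v))))%C; first by ring.
  by rewrite E; ring.
have s0 := branch_neq0 u v o.
have ea := log_derivative_imag _ _ s0 (ss u v o) _ _ _ _ (g u v o) (D u v o) Du.
have eb := log_derivative_imag _ _ s0 (ss u v o) _ _ _ _ (g u v o) (D u v o) Dv.
apply/cond_vi_iff; first exact: J0.
have [-> ->] := po_mu po o.
apply: codazzi_vi => //; first exact: J0.
rewrite /codazzi; apply: (Cmult_cancel 1); first by move/RtoC_inj; lra.
transitivity (codazzi_defect lam c k f u v +
  Cdv f u v * (Cdu k u v / (k u v * k u v - 1) - mu1 c u v + Ci * dv lam u v))%C.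
  by rewrite /codazzi_defect; ring.
by rewrite cod; ring.
Qed.

End Forward.

(** * The square root and the choice of the factor *)

Section Branch.

Variables (O : R * R -> Prop).
Hypothesis oO : open O.
Hypothesis sc : simply_connected O.

Lemma smooth_ln f : smooth O f -> (forall u v, O (u, v) -> 0 < f u v) ->
  smooth O (fun u v => ln (f u v)).
Proof.
move=> sf pos.
have H := smooth_comp O oO (fun h => h = ln \/ h = Rinv) f sf.
apply: (H _ ln); last by left.
move=> h [->|->].
- exists Rinv; split; first by move=> u v o; apply: is_derive_ln; exact: pos.
  by apply: alg_gen; exists Rinv; split; [right|].
- exists (fun x => -1 * (/ x * / x)); split=> [u v o|].
    by have := pos u v o => h0; auto_derive; [lra|field; lra].
  apply: (alg_mult _ _ (fun _ _ => -1)); first by apply: alg_smooth; exact: smooth_const.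
  by apply: alg_mult; apply: alg_gen; exists Rinv; split; [right| |right|].
Qed.

(** Halve the logarithm of the modulus and the angle. *)
Lemma complex_sqrt m : Csmooth O m -> (forall u v, O (u, v) -> m u v <> 0%C) ->
  exists s, Csmooth O s /\ forall u v, O (u, v) -> (s u v * s u v = m u v)%C.
Proof.
move=> [s1 s2] nz.
pose n u v := Re (m u v) * Re (m u v) + Im (m u v) * Im (m u v).
have n0 u v : O (u, v) -> 0 < n u v.
  by move=> o; have := norm2_neq0 _ (nz u v o); rewrite /n; nra.
have sn : smooth O n by apply: smooth_plus => //; exact: smooth_mult.
have sL := smooth_ln n sn n0.
have half (x : R) g : smooth O g -> smooth O (fun u v => x * g u v).
  by move=> sg; apply: smooth_mult => //; exact: smooth_const.
have sE := smooth_exp O oO _ (half (- / 2) _ sL).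
have EE u v : O (u, v) -> n u v * (exp (- / 2 * ln (n u v)) * exp (- / 2 * ln (n u v))) = 1.
  move=> o; rewrite -exp_plus.
  have -> : - / 2 * ln (n u v) + - / 2 * ln (n u v) = - ln (n u v) by lra.
  by rewrite exp_Ropp exp_ln; [field; have := n0 u v o; lra|exact: n0].
have unit u v : O (u, v) ->
    Re (m u v) * exp (- / 2 * ln (n u v)) * (Re (m u v) * exp (- / 2 * ln (n u v))) +
    Im (m u v) * exp (- / 2 * ln (n u v)) * (Im (m u v) * exp (- / 2 * ln (n u v))) = 1.
  by move=> o; rewrite -(EE u v o) /n; ring.
have [psi [sp Hp]] := angle_lift O oO sc _ _ (smooth_mult O oO _ _ s1 sE)
  (smooth_mult O oO _ _ s2 sE) unit.
have [scs ssn] := smooth_cos_sin O oO _ (half (/ 2) _ sp).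
have sQ := smooth_exp O oO _ (half (/ 4) _ sL).
exists (fun u v => (exp (/ 4 * ln (n u v)) * cos (/ 2 * psi u v),
               exp (/ 4 * ln (n u v)) * sin (/ 2 * psi u v))).
split; first by split; exact: smooth_mult.
move=> u v o; have [c s] := Hp u v o.
have QQ : exp (/ 4 * ln (n u v)) * exp (/ 4 * ln (n u v)) * exp (- / 2 * ln (n u v)) = 1.
  rewrite -!exp_plus -exp_0; congr exp; lra.
have c2 := cos_2a (/ 2 * psi u v); have s2' := sin_2a (/ 2 * psi u v).
have e : 2 * (/ 2 * psi u v) = psi u v by lra.
rewrite e in c2 s2'.
apply: injective_projections => /=.
- transitivity (exp (/ 4 * ln (n u v)) * exp (/ 4 * ln (n u v)) * cos (psi u v)).
    by rewrite c2; ring.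
  rewrite c; transitivity (Re (m u v) * (exp (/ 4 * ln (n u v)) * exp (/ 4 * ln (n u v)) *
    exp (- / 2 * ln (n u v)))); first by ring.
  by rewrite QQ Rmult_1_r.
- transitivity (exp (/ 4 * ln (n u v)) * exp (/ 4 * ln (n u v)) * sin (psi u v)).
    by rewrite s2'; ring.
  rewrite s; transitivity (Im (m u v) * (exp (/ 4 * ln (n u v)) * exp (/ 4 * ln (n u v)) *
    exp (- / 2 * ln (n u v)))); first by ring.
  by rewrite QQ Rmult_1_r.
Qed.

Variables (k f : R -> R -> C).
Hypothesis sk : Csmooth O k.
Hypothesis sf : Csmooth O f.
Hypothesis kv : forall u v, O (u, v) ->
  k u v <> 0%C /\ k u v <> 1%C /\ k u v <> (-1)%C.

Lemma sqrt_branch_exists : exists s, sqrt_branch O k s.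
Proof.
apply: (complex_sqrt (fun u v => k u v * k u v - 1)%C).
  by apply: Csmooth_minus => //; [exact: Csmooth_mult|exact: Csmooth_const].
by move=> u v o; have [_ [h1 h2]] := kv u v o; exact: k2_neq1.
Qed.

Lemma sqrt_branch_neq0 s u v : sqrt_branch O k s -> O (u, v) -> s u v <> 0%C.
Proof.
move=> [_ ss] o e; have [_ [h1 h2]] := kv u v o.
by apply: (k2_neq1 _ h1 h2); rewrite -ss // e; ring.
Qed.

Lemma sqrt_branch_pm s s' u v : sqrt_branch O k s -> sqrt_branch O k s' -> O (u, v) ->
  s' u v = s u v \/ s' u v = (- s u v)%C.
Proof.
move=> [_ h] [_ h'] o.
have : ((s' u v - s u v) * (s' u v + s u v) = 0)%C.
  transitivity (s' u v * s' u v - s u v * s u v)%C; first by ring.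
  by rewrite h // h' //; ring.
case: (classic (s' u v - s u v = 0)%C) => [e _|n /Cmult_eq0 e].
  left; transitivity (s' u v - s u v + s u v)%C; first by ring.
  by rewrite e; ring.
right; transitivity (s' u v + s u v - s u v)%C; first by ring.
by rewrite (e n); ring.
Qed.

Hypothesis ii : forall u v, O (u, v) -> cond_ii f u v.
Hypothesis iii : forall u v, O (u, v) -> cond_iii f u v.
Hypothesis iv : forall u v, O (u, v) -> cond_iv k f u v.

(** Passing from [f] to [i f] changes the sign of [cr] and leaves [cA] and [cB]
    unchanged. *)
Lemma cons_scaled (e : C) s : sqrt_branch O k s -> (e = 1%C \/ e = Ci) ->
  (forall u v, O (u, v) ->
    (Ci * (cA (Cdu f u v) (Cdv f u v) * k u v + Ci * cB (Cdu f u v) (Cdv f u v)) *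
      (Cconj (s u v) / s u v) = e * e * cr (Cdu f u v) (Cdv f u v))%C) ->
  forall u v, O (u, v) -> cons (e * Cdu f u v) (e * Cdv f u v) (k u v) (s u v).
Proof.
move=> sb he H u v o; have s0 := sqrt_branch_neq0 _ _ _ sb o.
have /cond_iii_iff [A0 _] := iii u v o; have /cond_ii_iff rr := ii u v o.
have ee : (e * Cconj e = 1)%C.
  by case: he => ->; [rewrite Cconj_RtoC|rewrite Cconj_Ci]; ring [Ci2].
have ee2 : (Cconj (e * e) = e * e)%C.
  by case: he => ->; rewrite Cmult_conj ?Cconj_RtoC ?Cconj_Ci; ring.
set p := Cdu f u v in A0 rr *; set q := Cdv f u v in A0 rr *.
have eA : cA (e * p) (e * q) = cA p q.
  rewrite /cA !Cmult_conj; transitivity (e * Cconj e * cA p q)%C; first by rewrite /cA; ring.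
  by rewrite ee /cA; ring.
have eB : cB (e * p) (e * q) = cB p q.
  rewrite /cB !Cmult_conj; transitivity (e * Cconj e * cB p q)%C; first by rewrite /cB; ring.
  by rewrite ee /cB; ring.
have er : cr (e * p) (e * q) = (e * e * cr p q)%C by rewrite /cr; ring.
apply: solved_cons => //; rewrite ?eA ?er //.
  by rewrite Cmult_conj ee2 -rr.
rewrite eB; apply: sign_solved => //; exact: H.
Qed.

(** Exactly one of [f] and [i f] makes the two formulas for [alpha_2] and the
    two formulas for [beta_2] agree: both sides of the sign alternative left by
    (ii) and (iv) are open, and the domain is connected. *)
Lemma factor_choice s : sqrt_branch O k s -> exists e : C,
  (e = 1%C \/ (e = Ci /\ ~ formulas_consistent O k f)) /\
  forall u v, O (u, v) -> cons (e * Cdu f u v) (e * Cdv f u v) (k u v) (s u v).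
Proof.
move=> sb; have [ssm ss] := sb.
have [[[u0 v0] o0] _] := sc.
pose A u v := cA (Cdu f u v) (Cdv f u v).
pose r u v := cr (Cdu f u v) (Cdv f u v).
pose H u v := (Ci * (A u v * k u v + Ci * cB (Cdu f u v) (Cdv f u v)) *
  (Cconj (s u v) / s u v))%C.
have A0 u v (o : O (u, v)) : A u v <> 0%C by have /cond_iii_iff [] := iii u v o.
have rr u v (o : O (u, v)) : r u v = Cconj (r u v) by have /cond_ii_iff := ii u v o.
have r0 u v (o : O (u, v)) : r u v <> 0%C := cr_neq0 _ _ (A0 u v o).
have er u v (o : O (u, v)) : r u v = RtoC (Re (r u v)) := real_eq _ (rr u v o).
have rn u v (o : O (u, v)) : Re (r u v) <> 0.
  by move=> z; apply: (r0 u v o); rewrite er // z.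
have alt u v (o : O (u, v)) : H u v = r u v \/ H u v = (- r u v)%C.
  have /cond_iv_iff [n e] := iv u v o.
  by apply: iv_sign => //; [exact: sqrt_branch_neq0|exact: ss|exact: A0|exact: rr].
have sfu := Csmooth_Cdu O _ sf; have sfv := Csmooth_Cdv O _ sf.
have scj := Csmooth_conj O oO; have sm := Csmooth_mult O oO; have sp := Csmooth_plus O oO.
have sCi := Csmooth_const O Ci.
have sr : Csmooth O r := sp _ _ (sm _ _ sfu sfu) (sm _ _ sfv sfv).
have sA : Csmooth O A := sp _ _ (sm _ _ sfu (scj _ sfv)) (sm _ _ (scj _ sfu) sfv).
have sB : Csmooth O (fun u v => cB (Cdu f u v) (Cdv f u v)) :=
  Csmooth_minus O oO _ _ (sm _ _ sfu (scj _ sfu)) (sm _ _ sfv (scj _ sfv)).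
have sH : Csmooth O H.
  apply: (sm _ _); last by apply: Csmooth_div => //; [exact: scj|move=> *; exact: sqrt_branch_neq0].
  by apply: (sm _ _ sCi); apply: (sp _ _); [exact: sm|exact: sm].
pose h u v := Re (H u v) * Re (r u v).
have sh : smooth O h by apply: smooth_mult => //; [case: sH|case: sr].
have hval u v (o : O (u, v)) : (H u v = r u v /\ 0 < h u v) \/ (H u v = (- r u v)%C /\ h u v < 0).
  have n := rn u v o.
  have pos : 0 < Re (r u v) * Re (r u v) by nra.
  by case: (alt u v o) => e; [left|right]; split=> //; rewrite /h e ?re_opp; lra.
have hn u v (o : O (u, v)) : h u v <> 0 by case: (hval u v o) => [] [_]; lra.
have hn' u v (o : O (u, v)) : - h u v <> 0 by have := hn u v o; lra.
case: (hval u0 v0 o0) => [] [e0 p0].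
- exists 1%C; split; first by left.
  apply: cons_scaled => //; first by left.
  move=> u v o; rewrite -/(A u v) -/(r u v) -/(H u v).
  have := nonzero_constant_sign O sc h u0 v0 u v sh hn o0 o p0.
  by case: (hval u v o) => [] [-> hp] hp'; [ring|lra].
- exists Ci; split.
    right; split=> //; case=> s' [sb' cn].
    have [c1 c2] := cn u0 v0 o0.
    have s0' := sqrt_branch_neq0 _ _ _ sb' o0; have s0 := sqrt_branch_neq0 _ _ _ sb o0.
    have e1 := cons_solved _ _ _ _ s0' (conj c1 c2).
    have e2 : (Ci * (A u0 v0 * k u0 v0 + Ci * cB (Cdu f u0 v0) (Cdv f u0 v0)) *
        (Cconj (s' u0 v0) / s' u0 v0) = r u0 v0)%C.
      by apply: solved_sign => //; rewrite rr.
    have e3 : H u0 v0 = r u0 v0.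
      rewrite -e2 /H; congr (_ * _)%C.
      case: (sqrt_branch_pm s s' u0 v0 sb sb' o0) => -> //.
      by rewrite Copp_conj; field.
    apply: (r0 u0 v0 o0).
    have e4 : r u0 v0 = (- r u0 v0)%C by rewrite -{1}e3.
    rewrite er // in e4 *; congr RtoC.
    by rewrite -RtoC_opp in e4; move/RtoC_inj: e4; lra.
  apply: cons_scaled => //; first by right.
  move=> u v o; rewrite -/(A u v) -/(r u v) -/(H u v).
  have := nonzero_constant_sign O sc (fun u v => - h u v) u0 v0 u v (smooth_opp O oO _ sh) hn' o0 o
    ltac:(lra).
  by case: (hval u v o) => [] [-> hp] hp'; [lra|ring [Ci2]].
Qed.

End Branch.

(** * An initial frame *)

Section Initial.

Variables (L0 e0 : R).
Hypothesis he0 : 0 < e0.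

(** The negative coordinate axes are the last one or two: the position vector
    takes one of them when [L0 < 0], and [N2] always does.  For [L0 = 0] the
    index 4 is out of range, the surface starting at the origin. *)
Definition axis (i : nat) : nat :=
  if Rlt_dec 0 L0 is left _ then
    match i with 0%nat => 3%nat | 1%nat => 0%nat | 2%nat => 1%nat | 3%nat => 2%nat | _ => 4%nat end
  else
    match i with 0%nat => 4%nat | 1%nat => 0%nat | 2%nat => 1%nat | 3%nat => 2%nat | _ => 3%nat end.

Definition axis_length (i : nat) : R :=
  match i with
  | 0%nat => if Req_EM_T L0 0 is left _ then 0 else / sqrt (Rabs L0)
  | _ => e0
  end.

Definition init (i a : nat) : R := if Nat.eqb a (axis i) then axis_length i else 0.

(** The signature of the ambient space. *)
Definition eta (a : nat) : R := if ssrnat.leq (S a) (ssrnat.subn (adim L0) (aind L0)) then 1 else -1.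

(** The inverse of the Gram matrix of the frame, as a bilinear form on the
    components of two solutions. *)
Definition pairing (E : R) (y z : nat -> R) : R :=
  L0 * (y 0%nat * z 0%nat) +
  (y 1%nat * z 1%nat + y 2%nat * z 2%nat + y 3%nat * z 3%nat - y 4%nat * z 4%nat) / E.

Lemma axis_length0 : L0 * (axis_length 0 * axis_length 0) =
  if Rlt_dec 0 L0 is left _ then 1 else if Rlt_dec L0 0 is left _ then -1 else 0.
Proof.
rewrite /axis_length; case: Req_EM_T => [->|n0].
  by case: Rlt_dec => [|_]; [lra|ring].
have ra : 0 < Rabs L0 by exact: Rabs_pos_lt.
have s0 : sqrt (Rabs L0) <> 0 by have := sqrt_lt_R0 _ ra; lra.
have e : / sqrt (Rabs L0) * / sqrt (Rabs L0) = / Rabs L0.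
  by rewrite -Rinv_mult sqrt_sqrt //; lra.
rewrite e; case: Rlt_dec => [p|n]; first by rewrite Rabs_pos_eq; [field|lra].
case: Rlt_dec => [p|n']; last lra.
by rewrite Rabs_left //; field.
Qed.

Lemma init_complete a b : ssrnat.leq (S a) (adim L0) -> ssrnat.leq (S b) (adim L0) ->
  pairing (e0 * e0) (fun i => init i a) (fun i => init i b) =
  if Nat.eqb a b then eta a else 0.
Proof.
have := axis_length0; rewrite /pairing /init /eta /adim /aind /axis.
have e1 : axis_length 1 = e0 by [].
case: (Req_EM_T L0 0) => h1; case: (Rlt_dec L0 0) => h2; case: (Rlt_dec 0 L0) => h3; try lra;
  move: a b => [|[|[|[|[|a]]]]] [|[|[|[|[|b]]]]] //= E _ _; rewrite ?E; try (field; lra); nra.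
Qed.

Lemma init_gram :
  (forall i j : nat, (i <= 4)%nat -> (j <= 4)%nat -> i <> j ->
    @sp L0 (fun a => init i (nat_of_ord a)) (fun a => init j (nat_of_ord a)) = 0) /\
  (forall i : nat, (1 <= i)%nat -> (i <= 3)%nat ->
    @sp L0 (fun a => init i (nat_of_ord a)) (fun a => init i (nat_of_ord a)) = e0 * e0) /\
  @sp L0 (fun a => init 4 (nat_of_ord a)) (fun a => init 4 (nat_of_ord a)) = - (e0 * e0) /\
  L0 * (L0 * @sp L0 (fun a => init 0 (nat_of_ord a)) (fun a => init 0 (nat_of_ord a))) = L0.
Proof.
have := axis_length0; rewrite /sp /eform /init /adim /aind /axis.
case: (Req_EM_T L0 0) => h1; case: (Rlt_dec L0 0) => h2; case: (Rlt_dec 0 L0) => h3; try lra; move=> E.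
- split; [|split; [|split]].
  + move=> [|[|[|[|[|i]]]]] [|[|[|[|[|j]]]]] hi hj ij; try lia;
    rewrite !big_ord_recl big_ord0 /=; ring.
  + move=> [|[|[|[|i]]]] hi hi2; try lia; rewrite !big_ord_recl big_ord0 /=; ring.
  + rewrite !big_ord_recl big_ord0 /=; ring.
  + by transitivity 0; [rewrite {1}h1; ring|rewrite h1].
- split; [|split; [|split]].
  + move=> [|[|[|[|[|i]]]]] [|[|[|[|[|j]]]]] hi hj ij; try lia;
    rewrite !big_ord_recl big_ord0 /=; ring.
  + move=> [|[|[|[|i]]]] hi hi2; try lia; rewrite !big_ord_recl big_ord0 /=; ring.
  + rewrite !big_ord_recl big_ord0 /=; ring.
  + rewrite !big_ord_recl big_ord0; cbn [Nat.eqb nat_of_ord]; simpl.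
    transitivity (- (L0 * (L0 * (axis_length 0 * axis_length 0)))); [rewrite /=; ring|rewrite E; ring].
- split; [|split; [|split]].
  + move=> [|[|[|[|[|i]]]]] [|[|[|[|[|j]]]]] hi hj ij; try lia;
    rewrite !big_ord_recl big_ord0 /=; ring.
  + move=> [|[|[|[|i]]]] hi hi2; try lia; rewrite !big_ord_recl big_ord0 /=; ring.
  + rewrite !big_ord_recl big_ord0 /=; ring.
  + rewrite !big_ord_recl big_ord0; simpl.
    transitivity (L0 * (L0 * (axis_length 0 * axis_length 0))); [rewrite /=; ring|rewrite E; ring].
Qed.

End Initial.

(** * The surface with given coefficients *)

Lemma RplusA : forall x y z, x + (y + z) = x + y + z.
Proof. by move=> x y z; ring. Qed.

HB.instance Definition _ := Monoid.isComLaw.Build R 0 Rplus RplusA Rplus_comm Rplus_0_l.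

Lemma bigR_single n (a : 'I_n) (g : 'I_n -> R) :
  \big[Rplus/0]_(b < n) (if Nat.eqb (nat_of_ord a) (nat_of_ord b) then g b else 0) = g a.
Proof.
rewrite (bigD1 a) //= Nat.eqb_refl big1 ?Rplus_0_r // => b ba.
case: Nat.eqb_spec => // e; case/negP: ba; apply/eqP; exact: val_inj.
Qed.

Section Construct.

Variables (L0 : R) (O : R * R -> Prop).
Hypothesis oO : open O.
Hypothesis sc : simply_connected O.
Variables (lam : R -> R -> R) (c : coeffs).
Hypothesis sl : smooth O lam.
Hypothesis scf : smooth_coeffs O c.
Let P := frame_u L0 lam c.
Let Q := frame_v L0 lam c.
Hypothesis fl : flat 4 O P Q.
Variables u0 v0 : R.
Hypothesis o0 : O (u0, v0).

Let sP : smooth_matrix 4 O P := frame_u_smooth L0 O oO lam c sl scf.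
Let sQ : smooth_matrix 4 O Q := frame_v_smooth L0 O oO lam c sl scf.
Let E u v := exp (2 * lam u v).

Let E_neq0 u v : E u v <> 0.
Proof. by have := exp_pos (2 * lam u v); rewrite /E; lra. Qed.

(** The frame system is skew with respect to the form [pairing], up to the
    growth of [E]. *)
Lemma pairing_constant y z : is_sol 4 P Q O y -> is_sol 4 P Q O z ->
  forall u v u' v', O (u, v) -> O (u', v') ->
  pairing L0 (E u v) (fun i => y i u v) (fun i => z i u v) =
  pairing L0 (E u' v') (fun i => y i u' v') (fun i => z i u' v').
Proof.
move=> Hy Hz u v u' v' o o'.
have sy i : (i <= 4)%nat -> smooth O (y i) by exact: is_sol_smooth sP sQ Hy.
have sz i : (i <= 4)%nat -> smooth O (z i) by exact: is_sol_smooth sP sQ Hz.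
have sE := smooth_E O oO lam sl.
have siE := smooth_inv O oO _ sE (fun u v _ => E_neq0 u v).
have sm := smooth_mult O oO; have sp := smooth_plus O oO; have sn := smooth_minus O oO.
have s0 := sm _ _ (sy 0%nat ltac:(lia)) (sz 0%nat ltac:(lia)).
have s1 := sm _ _ (sy 1%nat ltac:(lia)) (sz 1%nat ltac:(lia)).
have s2 := sm _ _ (sy 2%nat ltac:(lia)) (sz 2%nat ltac:(lia)).
have s3 := sm _ _ (sy 3%nat ltac:(lia)) (sz 3%nat ltac:(lia)).
have s4 := sm _ _ (sy 4%nat ltac:(lia)) (sz 4%nat ltac:(lia)).
have s5 := sm _ _ (smooth_const O L0) s0.
have s6 := sp _ _ s1 s2; have s7 := sp _ _ s6 s3; have s8 := sn _ _ s7 s4.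
have s9 := sm _ _ s8 siE; have s10 := sp _ _ s5 s9.
apply: (zero_derivative_constant O oO sc _ s10) => // {o o' u' v'} {}u {}v o.
have dy i (hi : (i <= 4)%nat) := is_sol_du O 4 P Q y i u v Hy hi o.
have dz i (hi : (i <= 4)%nat) := is_sol_du O 4 P Q z i u v Hz hi o.
have ey i (hi : (i <= 4)%nat) := is_sol_dv O 4 P Q y i u v Hy hi o.
have ez i (hi : (i <= 4)%nat) := is_sol_dv O 4 P Q z i u v Hz hi o.
have m i (hi : (i <= 4)%nat) : du (fun u v => y i u v * z i u v) u v =
    act 4 P y i u v * z i u v + y i u v * act 4 P z i u v.
  by rewrite (du_mult O) ?dy ?dz //; [exact: sy|exact: sz].
have m' i (hi : (i <= 4)%nat) : dv (fun u v => y i u v * z i u v) u v =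
    act 4 Q y i u v * z i u v + y i u v * act 4 Q z i u v.
  by rewrite (dv_mult O) ?ey ?ez //; [exact: sy|exact: sz].
have n0 := E_neq0 u v.
split.
- rewrite (du_plus O _ _ _ _ s5 s9 o) (du_mult O _ _ _ _ (smooth_const O L0) s0 o).
  rewrite (du_mult O _ _ _ _ s8 siE o) (du_minus O _ _ _ _ s7 s4 o).
  rewrite (du_plus O _ _ _ _ s6 s3 o) (du_plus O _ _ _ _ s1 s2 o) du_const.
  rewrite (du_inv O _ _ _ sE o n0) (du_E O oO) // !m; try lia.
  rewrite /act /= /P /frame_u -/(E u v); field; exact: n0.
- rewrite (dv_plus O _ _ _ _ s5 s9 o) (dv_mult O _ _ _ _ (smooth_const O L0) s0 o).
  rewrite (dv_mult O _ _ _ _ s8 siE o) (dv_minus O _ _ _ _ s7 s4 o).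
  rewrite (dv_plus O _ _ _ _ s6 s3 o) (dv_plus O _ _ _ _ s1 s2 o) dv_const.
  rewrite (dv_inv O _ _ _ sE o n0) (dv_E O oO) // !m'; try lia.
  rewrite /act /= /Q /frame_v -/(E u v); field; exact: n0.
Qed.

Let e0 := exp (lam u0 v0).
Let he0 : 0 < e0 := exp_pos _.

Let E0 : E u0 v0 = e0 * e0.
Proof. by rewrite /E /e0 -exp_plus; congr exp; ring. Qed.

(** [Y a] is the family of the coordinates [a] of the frame vectors. *)
Variable Y : 'I_(adim L0) -> nat -> R -> R -> R.
Hypothesis HY : forall a, is_sol 4 P Q O (Y a).
Hypothesis Y0 : forall a i, (i <= 4)%nat -> Y a i u0 v0 = init L0 e0 i (nat_of_ord a).

Definition vec_at (i : nat) (u v : R) : avec L0 := fun a => Y a i u v.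

Lemma Y_complete a b u v : O (u, v) ->
  pairing L0 (E u v) (fun i => Y a i u v) (fun i => Y b i u v) =
  if Nat.eqb (nat_of_ord a) (nat_of_ord b) then eta L0 (nat_of_ord a) else 0.
Proof.
move=> o; rewrite (pairing_constant _ _ (HY a) (HY b) u v u0 v0 o o0) E0.
rewrite -(init_complete L0 e0 he0 _ _ (ltn_ord a) (ltn_ord b)) /pairing !Y0 //; lia.
Qed.

(** Completeness of the frame spreads from the base point, because it is a
    statement about the pairing of two coordinates. *)
Lemma vec_complete (x : avec L0) a u v : O (u, v) ->
  x a = L0 * sp (vec_at 0 u v) x * vec_at 0 u v a +
   (sp (vec_at 1 u v) x * vec_at 1 u v a + sp (vec_at 2 u v) x * vec_at 2 u v a +
    sp (vec_at 3 u v) x * vec_at 3 u v a - sp (vec_at 4 u v) x * vec_at 4 u v a) / E u v.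
Proof.
move=> o.
have ee : eta L0 (nat_of_ord a) * eta L0 (nat_of_ord a) = 1 by rewrite /eta; case: ssrnat.leq; ring.
transitivity (\big[Rplus/0]_(b < adim L0) (eta L0 (nat_of_ord b) * x b *
    pairing L0 (E u v) (fun i => Y a i u v) (fun i => Y b i u v))).
  rewrite (eq_bigr (fun b : 'I_(adim L0) => if Nat.eqb (nat_of_ord a) (nat_of_ord b) then
    eta L0 (nat_of_ord b) * x b * eta L0 (nat_of_ord a) else 0)); last first.
    by move=> b _; rewrite Y_complete //; case: Nat.eqb; ring.
  rewrite bigR_single; transitivity (eta L0 (nat_of_ord a) * eta L0 (nat_of_ord a) * x a).
    by rewrite ee; ring.
  by ring.
have n0 := E_neq0 u v.
pose w i := \big[Rplus/0]_(b < adim L0) (eta L0 (nat_of_ord b) * x b * Y b i u v).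
have ew i : sp (vec_at i u v) x = w i.
  by rewrite /sp /eform /w; apply: eq_bigr => b _; rewrite /vec_at /eta; ring.
rewrite !ew /vec_at.
transitivity ((L0 * Y a 0%nat u v) * w 0%nat + ((Y a 1%nat u v / E u v) * w 1%nat +
  ((Y a 2%nat u v / E u v) * w 2%nat + ((Y a 3%nat u v / E u v) * w 3%nat +
   (- (Y a 4%nat u v) / E u v) * w 4%nat)))).
  rewrite /w -!bigR_scal -!bigR_plus; apply: eq_bigr => b _.
  by rewrite /pairing; field.
by field.
Qed.

(** The Gram matrix of the frame follows from the invariance of the pairing:
    the solutions with unit values at a point express the frame there in terms
    of the frame at the base point. *)
Lemma Y_gram u v : O (u, v) ->
  (forall i j : nat, (1 <= i)%nat -> (i <= 4)%nat -> (1 <= j)%nat -> (j <= 4)%nat ->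
    sp (vec_at i u v) (vec_at j u v) =
    if Nat.eqb i j then (if Nat.eqb i 4 then - E u v else E u v) else 0) /\
  (forall j : nat, (1 <= j)%nat -> (j <= 4)%nat ->
    L0 * sp (vec_at j u v) (vec_at 0 u v) = 0) /\
  (L0 <> 0 -> sp (vec_at 0 u v) (vec_at 0 u v) = 1 / L0).
Proof.
move=> o; have n0 := E_neq0 u v; have m0 := E_neq0 u0 v0.
pose w (x : R) (i : nat) := match i with 0%nat => L0 | 4%nat => - / x | _ => / x end.
have exz k : exists z, is_sol 4 P Q O z /\
    forall i, (i <= 4)%nat -> z i u v = if Nat.eqb i k then 1 else 0.
  have [z [Hz ez]] := flat_global_existence 4 O P Q oO sP sQ fl sc (u, v)
    (fun i => if Nat.eqb i k then 1 else 0) o.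
  by exists z; split=> // i hi; exact: (ez i hi).
have [g1 [g2 [g3 g4]]] := init_gram L0 e0.
set D00 := @sp L0 (fun a => init L0 e0 0 (nat_of_ord a)) (fun a => init L0 e0 0 (nat_of_ord a)).
have D i j : (i <= 4)%nat -> (j <= 4)%nat ->
    @sp L0 (fun a => init L0 e0 i (nat_of_ord a)) (fun a => init L0 e0 j (nat_of_ord a)) =
    if Nat.eqb i j then (match i with 0%nat => D00 | 4%nat => - (e0 * e0) | _ => e0 * e0 end)
    else 0.
  move=> hi hj; case: Nat.eqb_spec => [<-|ij]; last exact: g1.
  by move: i hi => [|[|[|[|[|i]]]]] hi //; [apply: g2; lia..|lia].
have key k l : (k <= 4)%nat -> (l <= 4)%nat ->
    w (E u v) k * (w (E u v) l * sp (vec_at k u v) (vec_at l u v)) =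
    if Nat.eqb k l then w (E u v) k else 0.
  move=> hk hl; have [y [Hy ey]] := exz k; have [z [Hz ez]] := exz l.
  have K : pairing L0 (E u v) (fun i => y i u v) (fun i => z i u v) =
      if Nat.eqb k l then w (E u v) k else 0.
    rewrite /pairing !ey ?ez; try lia.
    by move: k l hk hl {Hy Hz ey ez} => [|[|[|[|[|k]]]]] [|[|[|[|[|l]]]]] hk hl; try lia;
      rewrite /=; field.
  rewrite (pairing_constant _ _ Hy Hz u v u0 v0 o o0) in K.
  have ex t m : is_sol 4 P Q O t -> (m <= 4)%nat ->
      (forall i, (i <= 4)%nat -> t i u v = if Nat.eqb i m then 1 else 0) ->
      forall a, w (E u v) m * vec_at m u v a =
      (L0 * t 0%nat u0 v0) * init L0 e0 0 (nat_of_ord a) +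
      (t 1%nat u0 v0 / E u0 v0) * init L0 e0 1 (nat_of_ord a) +
      (t 2%nat u0 v0 / E u0 v0) * init L0 e0 2 (nat_of_ord a) +
      (t 3%nat u0 v0 / E u0 v0) * init L0 e0 3 (nat_of_ord a) +
      (- t 4%nat u0 v0 / E u0 v0) * init L0 e0 4 (nat_of_ord a).
    move=> Ht hm et a.
    have := pairing_constant _ _ Ht (HY a) u v u0 v0 o o0.
    rewrite /pairing !et ?(Y0 a); try lia; move=> e.
    transitivity (L0 * ((if Nat.eqb 0 m then 1 else 0) * Y a 0%nat u v) +
      ((if Nat.eqb 1 m then 1 else 0) * Y a 1%nat u v +
       (if Nat.eqb 2 m then 1 else 0) * Y a 2%nat u v +
       (if Nat.eqb 3 m then 1 else 0) * Y a 3%nat u v -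
       (if Nat.eqb 4 m then 1 else 0) * Y a 4%nat u v) / E u v).
      move: m hm {et e} => [|[|[|[|[|m]]]]] hm; try lia; rewrite /= /vec_at; field; exact: n0.
    by rewrite e; field.
  rewrite -K.
  transitivity (sp (fun a => w (E u v) k * vec_at k u v a) (fun a => w (E u v) l * vec_at l u v a)).
    symmetry; rewrite sp_scal (sp_sym _ (vec_at k u v)) sp_scal (sp_sym _ (vec_at l u v)).
    ring.
  rewrite (sp_ext _ _ _ _ (ex y k Hy hk ey)) sp_sym (sp_ext _ _ _ _ (ex z l Hz hl ez)).
  rewrite sp_comb5 !(sp_sym _ (fun a => init _ _ _ (nat_of_ord a))) !sp_comb5.
  rewrite !D; try lia; rewrite /= E0.
  have ne : e0 <> 0 by lra.
  transitivity (L0 * (L0 * D00) * (z 0%nat u0 v0 * y 0%nat u0 v0) +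
    (z 1%nat u0 v0 * y 1%nat u0 v0 + z 2%nat u0 v0 * y 2%nat u0 v0 + z 3%nat u0 v0 * y 3%nat u0 v0
     - z 4%nat u0 v0 * y 4%nat u0 v0) / (e0 * e0)); first by field.
  by rewrite g4 /pairing; field.
have pos : 0 < / E u v by apply: Rinv_0_lt_compat; exact: exp_pos.
split; [|split].
- move=> i j h1 h2 h3 h4; have := key i j h2 h4.
  have wn m : (1 <= m)%nat -> (m <= 4)%nat -> w (E u v) m <> 0 /\
      / w (E u v) m = if Nat.eqb m 4 then - E u v else E u v.
    by move: m => [|[|[|[|[|m]]]]] a1 a2; try lia; rewrite /w /=; split; try lra; field.
  have [w1 w1'] := wn i h1 h2; have [w2 w2'] := wn j h3 h4.
  move=> k1.
  have -> : sp (vec_at i u v) (vec_at j u v) = / w (E u v) i * / w (E u v) j *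
    (w (E u v) i * (w (E u v) j * sp (vec_at i u v) (vec_at j u v))) by field.
  rewrite k1; case: Nat.eqb_spec => [<-|_]; last by ring.
  by rewrite -w1'; field.
- move=> j h1 h2; have := key j 0%nat h2 ltac:(lia).
  have -> : Nat.eqb j 0 = false by apply/Nat.eqb_neq; lia.
  have wn : w (E u v) j <> 0.
    by move: j h1 h2 => [|[|[|[|[|j]]]]] a1 a2; try lia; rewrite /w /=; lra.
  by case/Rmult_integral.
- move=> hL; have := key 0%nat 0%nat ltac:(lia) ltac:(lia); rewrite /= => e.
  have -> : sp (vec_at 0 u v) (vec_at 0 u v) =
    (L0 * (L0 * sp (vec_at 0 u v) (vec_at 0 u v))) / (L0 * L0) by field.
  by rewrite e; field.
Qed.

Let F : vfield L0 := vec_at 0.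
Let N1 : vfield L0 := vec_at 3.
Let N2 : vfield L0 := vec_at 4.

Lemma vec_smooth i : (i <= 4)%nat -> vsmooth O (vec_at i).
Proof. by move=> hi a; exact: is_sol_smooth sP sQ (HY a) hi. Qed.

Lemma vdu_vec i u v a : (i <= 4)%nat -> O (u, v) ->
  vdu (vec_at i) u v a = act 4 P (Y a) i u v.
Proof. by move=> hi o; exact: (is_sol_du _ _ _ _ _ _ _ _ (HY a) hi o). Qed.

Lemma vdv_vec i u v a : (i <= 4)%nat -> O (u, v) ->
  vdv (vec_at i) u v a = act 4 Q (Y a) i u v.
Proof. by move=> hi o; exact: (is_sol_dv _ _ _ _ _ _ _ _ (HY a) hi o). Qed.

Lemma T1_vec u v : O (u, v) -> T1 F u v = vec_at 1 u v.
Proof.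
move=> o; apply: functional_extensionality => a.
rewrite /T1 vdu_vec //; last lia.
by rewrite /act /= /P /frame_u /vec_at; ring.
Qed.

Lemma T2_vec u v : O (u, v) -> T2 F u v = vec_at 2 u v.
Proof.
move=> o; apply: functional_extensionality => a.
rewrite /T2 vdv_vec //; last lia.
by rewrite /act /= /Q /frame_v /vec_at; ring.
Qed.

Lemma vdu_agree (V W : vfield L0) u v : (forall u v, O (u, v) -> V u v = W u v) -> O (u, v) ->
  vdu V u v = vdu W u v.
Proof.
move=> e o; apply: functional_extensionality => a; apply: (agree_du O oO) => // x y h.
by rewrite e.
Qed.

Lemma vdv_agree (V W : vfield L0) u v : (forall u v, O (u, v) -> V u v = W u v) -> O (u, v) ->
  vdv V u v = vdv W u v.
Proof.
move=> e o; apply: functional_extensionality => a; apply: (agree_dv O oO) => // x y h.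
by rewrite e.
Qed.

(** The two projections remove the terms along the position vector and along the
    tangent vectors. *)
Lemma normal_part_expansion (D : avec L0) b0 b1 b2 b3 b4 u v i : O (u, v) ->
  (forall a, D a = (L0 * b0) * F u v a + b1 * vec_at 1 u v a + b2 * vec_at 2 u v a +
    b3 * N1 u v a + b4 * N2 u v a) ->
  normal_part F (fun u v a => D a - L0 * sp D (F u v) * F u v a) u v i =
  b3 * N1 u v i + b4 * N2 u v i.
Proof.
move=> o HD; have n0 := E_neq0 u v; have [g1 [g2 g3]] := Y_gram u v o.
rewrite /normal_part T1_vec // T2_vec //.
have G i' j' := g1 i' j'.
have e : L0 * sp D (F u v) = L0 * b0.
  rewrite (sp_ext _ _ _ _ HD) sp_comb5.
  transitivity (b0 * L0 * (L0 * sp (F u v) (F u v)) + b1 * (L0 * sp (vec_at 1 u v) (F u v)) +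
    b2 * (L0 * sp (vec_at 2 u v) (F u v)) + b3 * (L0 * sp (N1 u v) (F u v)) +
    b4 * (L0 * sp (N2 u v) (F u v))); first by ring.
  rewrite (g2 1%nat) ?(g2 2%nat) ?(g2 3%nat) ?(g2 4%nat); try lia.
  case: (Req_dec L0 0) => h.
    by transitivity 0; [rewrite {1}h; ring|rewrite h; ring].
  by rewrite /F g3 //; field.
have H a : D a - L0 * sp D (F u v) * F u v a = 0 * F u v a + b1 * vec_at 1 u v a +
    b2 * vec_at 2 u v a + b3 * N1 u v a + b4 * N2 u v a by rewrite e HD; ring.
rewrite !(sp_ext _ _ _ _ H) !sp_comb5 H.
set f1 := sp (F u v) (vec_at 1 u v); set f2 := sp (F u v) (vec_at 2 u v).
rewrite /N1 /N2 !G /=; try lia.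
by field.
Qed.

Lemma nperp_u_expansion (V : vfield L0) b0 b1 b2 b3 b4 u v i : O (u, v) ->
  (forall a, vdu V u v a = (L0 * b0) * F u v a + b1 * vec_at 1 u v a + b2 * vec_at 2 u v a +
    b3 * N1 u v a + b4 * N2 u v a) ->
  normal_part F (nabla_u F V) u v i = b3 * N1 u v i + b4 * N2 u v i.
Proof. by move=> o H; exact: (normal_part_expansion (vdu V u v) b0 b1 b2 b3 b4). Qed.

Lemma nperp_v_expansion (V : vfield L0) b0 b1 b2 b3 b4 u v i : O (u, v) ->
  (forall a, vdv V u v a = (L0 * b0) * F u v a + b1 * vec_at 1 u v a + b2 * vec_at 2 u v a +
    b3 * N1 u v a + b4 * N2 u v a) ->
  normal_part F (nabla_v F V) u v i = b3 * N1 u v i + b4 * N2 u v i.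
Proof. by move=> o H; exact: (normal_part_expansion (vdv V u v) b0 b1 b2 b3 b4). Qed.

Lemma constructed_immersion : spacelike_conformal_immersion O F.
Proof.
split.
- by apply: vec_smooth; lia.
- by move=> u v o hL; have [_ [_ g]] := Y_gram u v o; exact: g.
- move=> u v o; have [g _] := Y_gram u v o; rewrite T1_vec // g /=; try lia.
  exact: exp_pos.
- move=> u v o; have [g _] := Y_gram u v o; rewrite T1_vec // T2_vec // !g /=; try lia.
  by [].
Qed.

Lemma constructed_normal i : i = 3%nat \/ i = 4%nat -> normal_field O F (vec_at i).
Proof.
move=> hi; split; first by apply: vec_smooth; lia.
move=> u v o; have [g [g0 _]] := Y_gram u v o.
rewrite T1_vec // T2_vec //; case: hi => ->.
- rewrite (g 3%nat 1%nat) ?(g 3%nat 2%nat) /=; try lia.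
  by split=> //; split=> // hL; have := g0 3%nat ltac:(lia) ltac:(lia); case/Rmult_integral.
- rewrite (g 4%nat 1%nat) ?(g 4%nat 2%nat) /=; try lia.
  by split=> //; split=> // hL; have := g0 4%nat ltac:(lia) ltac:(lia); case/Rmult_integral.
Qed.

Lemma constructed_adapted : adapted O F N1 N2 lam c.
Proof.
split.
- exact: sl.
- by move=> u v o; have [g _] := Y_gram u v o; rewrite T1_vec // g /=; try lia.
- by apply: constructed_normal; left.
- by apply: constructed_normal; right.
- move=> u v o; have [g _] := Y_gram u v o; rewrite /N1 /N2 !g /=; try lia.
  by [].
- move=> u v o i; split; [|split].
  + apply: (nperp_u_expansion _ (- E u v) (du lam u v) (- dv lam u v)) => // a.
    rewrite (vdu_agree _ (vec_at 1)) //; last exact: T1_vec.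
    rewrite vdu_vec //; last lia.
    by rewrite /act /= /P /frame_u /vec_at /F /N1 /N2 /vec_at -/(E u v); ring.
  + apply: (nperp_u_expansion _ 0 (dv lam u v) (du lam u v)) => // a.
    rewrite (vdu_agree _ (vec_at 2)) //; last exact: T2_vec.
    rewrite vdu_vec //; last lia.
    by rewrite /act /= /P /frame_u /vec_at /F /N1 /N2 /vec_at; ring.
  + apply: (nperp_v_expansion _ (- E u v) (- du lam u v) (dv lam u v)) => // a.
    rewrite (vdv_agree _ (vec_at 2)) //; last exact: T2_vec.
    rewrite vdv_vec //; last lia.
    by rewrite /act /= /Q /frame_v /vec_at /F /N1 /N2 /vec_at -/(E u v); ring.
- move=> u v o i; split; [|split; [|split]].
  + apply: (nperp_u_expansion _ 0 (- al1 c u v) (- al2 c u v)) => // a.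
    rewrite /N1 vdu_vec; [|lia|done].
    by rewrite /act /= /P /frame_u /F /N2 /vec_at; ring.
  + apply: (nperp_u_expansion _ 0 (be1 c u v) (be2 c u v)) => // a.
    rewrite /N2 vdu_vec; [|lia|done].
    by rewrite /act /= /P /frame_u /F /N1 /vec_at; ring.
  + apply: (nperp_v_expansion _ 0 (- al2 c u v) (- al3 c u v)) => // a.
    rewrite /N1 vdv_vec; [|lia|done].
    by rewrite /act /= /Q /frame_v /F /N2 /vec_at; ring.
  + apply: (nperp_v_expansion _ 0 (be2 c u v) (be3 c u v)) => // a.
    rewrite /N2 vdv_vec; [|lia|done].
    by rewrite /act /= /Q /frame_v /F /N1 /vec_at; ring.
Qed.

Lemma nperp_u_comb (V : vfield L0) (x y : R -> R -> R) u v i : smooth O x -> smooth O y ->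
  (forall u v, O (u, v) -> V u v = comb (x u v) (y u v) (N1 u v) (N2 u v)) -> O (u, v) ->
  nperp_u F V u v i =
  (du x u v + x u v * du lam u v + y u v * mu1 c u v) * N1 u v i +
  (du y u v + x u v * mu1 c u v + y u v * du lam u v) * N2 u v i.
Proof.
move=> sx sy e o.
apply: (nperp_u_expansion _ 0 (- x u v * al1 c u v + y u v * be1 c u v)
  (- x u v * al2 c u v + y u v * be2 c u v)) => // a.
rewrite (vdu_agree _ _ _ _ e o) /vdu /comb.
have s3 : smooth O (Y a 3%nat) by exact: (vec_smooth 3 ltac:(lia) a).
have s4 : smooth O (Y a 4%nat) by exact: (vec_smooth 4 ltac:(lia) a).
rewrite (du_plus O _ _ _ _ (smooth_mult O oO _ _ sx s3) (smooth_mult O oO _ _ sy s4) o).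
rewrite (du_mult O _ _ _ _ sx s3 o) (du_mult O _ _ _ _ sy s4 o).
have e3 := vdu_vec 3 u v a ltac:(lia) o; have e4 := vdu_vec 4 u v a ltac:(lia) o.
rewrite /vdu /act /= /P /frame_u /vec_at in e3 e4.
change (fun x0 y0 : R => Y a 3%nat x0 y0) with (Y a 3%nat) in e3.
change (fun x0 y0 : R => Y a 4%nat x0 y0) with (Y a 4%nat) in e4.
by rewrite e3 e4 /F /N1 /N2 /vec_at; ring.
Qed.

Lemma nperp_v_comb (V : vfield L0) (x y : R -> R -> R) u v i : smooth O x -> smooth O y ->
  (forall u v, O (u, v) -> V u v = comb (x u v) (y u v) (N1 u v) (N2 u v)) -> O (u, v) ->
  nperp_v F V u v i =
  (dv x u v + x u v * dv lam u v + y u v * mu2 c u v) * N1 u v i +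
  (dv y u v + x u v * mu2 c u v + y u v * dv lam u v) * N2 u v i.
Proof.
move=> sx sy e o.
apply: (nperp_v_expansion _ 0 (- x u v * al2 c u v + y u v * be2 c u v)
  (- x u v * al3 c u v + y u v * be3 c u v)) => // a.
rewrite (vdv_agree _ _ _ _ e o) /vdv /comb.
have s3 : smooth O (Y a 3%nat) by exact: (vec_smooth 3 ltac:(lia) a).
have s4 : smooth O (Y a 4%nat) by exact: (vec_smooth 4 ltac:(lia) a).
rewrite (dv_plus O _ _ _ _ (smooth_mult O oO _ _ sx s3) (smooth_mult O oO _ _ sy s4) o).
rewrite (dv_mult O _ _ _ _ sx s3 o) (dv_mult O _ _ _ _ sy s4 o).
have e3 := vdv_vec 3 u v a ltac:(lia) o; have e4 := vdv_vec 4 u v a ltac:(lia) o.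
rewrite /vdv /act /= /Q /frame_v /vec_at in e3 e4.
change (fun x0 y0 : R => Y a 3%nat x0 y0) with (Y a 3%nat) in e3.
change (fun x0 y0 : R => Y a 4%nat x0 y0) with (Y a 4%nat) in e4.
by rewrite e3 e4 /F /N1 /N2 /vec_at; ring.
Qed.

(** The normal connection of the frame N1, N2 has the connection form given by
    [mu_1], [mu_2], and its curvature is the differential of this form. *)
Lemma constructed_Rperp : (forall u v, O (u, v) -> dv (mu1 c) u v = du (mu2 c) u v) ->
  Rperp_zero O F.
Proof.
move=> hmu xi [sxi Hxi] u v o i.
have sE := smooth_E O oO lam sl.
have siE := smooth_inv O oO _ sE (fun u v _ => E_neq0 u v).
have v3 : vsmooth O N1 by apply: vec_smooth; lia.
have v4 : vsmooth O N2 by apply: vec_smooth; lia.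
pose x u v := sp (N1 u v) (xi u v) * / E u v.
pose y u v := - (sp (N2 u v) (xi u v) * / E u v).
have sx : smooth O x by apply: smooth_mult => //; exact: smooth_sp.
have sy : smooth O y by apply: smooth_opp => //; apply: smooth_mult => //; exact: smooth_sp.
have exi u' v' : O (u', v') -> xi u' v' = comb (x u' v') (y u' v') (N1 u' v') (N2 u' v').
  move=> o'; apply: functional_extensionality => a; have n0 := E_neq0 u' v'.
  have [h1 [h2 h3]] := Hxi u' v' o'.
  rewrite (vec_complete (xi u' v') a u' v' o') /comb.
  rewrite T1_vec // in h1; rewrite T2_vec // in h2.
  rewrite (sp_sym _ (vec_at 1 u' v')) h1 (sp_sym _ (vec_at 2 u' v')) h2.
  have -> : L0 * sp (vec_at 0 u' v') (xi u' v') = 0.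
    case: (Req_dec L0 0) => hL; first by rewrite {1}hL; ring.
    by rewrite sp_sym h3 //; ring.
  by rewrite /x /y /N1 /N2; field.
have [q1 q2 q3 q4 q5 q6 m1 m2] := scf.
have lu := smooth_du O _ sl; have lv := smooth_dv O _ sl.
have sm := smooth_mult O oO; have spl := smooth_plus O oO.
have xu := smooth_du O _ sx; have xv := smooth_dv O _ sx.
have yu := smooth_du O _ sy; have yv := smooth_dv O _ sy.
have p1 := sm _ _ sx lu; have p2 := sm _ _ sy m1; have p3 := sm _ _ sx m1; have p4 := sm _ _ sy lu.
have p1' := sm _ _ sx lv; have p2' := sm _ _ sy m2; have p3' := sm _ _ sx m2; have p4' := sm _ _ sy lv.
have r1 := spl _ _ xu p1; have r2 := spl _ _ yu p3.
have r1' := spl _ _ xv p1'; have r2' := spl _ _ yv p3'.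
have t1 := spl _ _ r1 p2; have t2 := spl _ _ r2 p4.
have t1' := spl _ _ r1' p2'; have t2' := spl _ _ r2' p4'.
rewrite /Rperp.
rewrite (nperp_u_comb (nperp_v F xi) _ _ u v i t1' t2') //; last first.
  move=> u' v' o'; apply: functional_extensionality => a; exact: (nperp_v_comb xi x y).
rewrite (nperp_v_comb (nperp_u F xi) _ _ u v i t1 t2) //; last first.
  move=> u' v' o'; apply: functional_extensionality => a; exact: (nperp_u_comb xi x y).
rewrite (du_plus O _ _ _ _ r1' p2' o) (du_plus O _ _ _ _ xv p1' o).
rewrite (du_plus O _ _ _ _ r2' p4' o) (du_plus O _ _ _ _ yv p3' o).
rewrite (dv_plus O _ _ _ _ r1 p2 o) (dv_plus O _ _ _ _ xu p1 o).
rewrite (dv_plus O _ _ _ _ r2 p4 o) (dv_plus O _ _ _ _ yu p3 o).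
rewrite (du_mult O _ _ _ _ sx lv o) (du_mult O _ _ _ _ sy m2 o) (du_mult O _ _ _ _ sx m2 o)
  (du_mult O _ _ _ _ sy lv o) (dv_mult O _ _ _ _ sx lu o) (dv_mult O _ _ _ _ sy m1 o)
  (dv_mult O _ _ _ _ sx m1 o) (dv_mult O _ _ _ _ sy lu o).
rewrite (du_dv O oO x u v sx o) (du_dv O oO y u v sy o) (du_dv O oO lam u v sl o) hmu //.
ring.
Qed.

Lemma constructed_K : (forall u v, O (u, v) -> cond_i L0 lam u v) -> K_equals O F.
Proof.
move=> H u v o.
rewrite (frame_curvature L0 O oO F N1 N2 lam c constructed_immersion constructed_adapted u v o).
have := H u v o; rewrite /cond_i => e; have n0 := E_neq0 u v.
have -> : du (du lam) u v + dv (dv lam) u v = - (L0 * exp (2 * lam u v)) by lra.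
by rewrite -/(E u v); field.
Qed.

(** The affine map taking the constructed frame at the base point to the values
    of [G] there is an isometry, since both have the same Gram matrix; it takes
    the constructed frame to a solution of the same system, which is [G]. *)
Lemma construct_rigid (G : 'I_(adim L0) -> nat -> R -> R -> R) :
  (forall a, is_sol 4 P Q O (G a)) ->
  let g i : avec L0 := fun a => G a i u0 v0 in
  (forall i j : nat, (1 <= i)%nat -> (i <= 4)%nat -> (1 <= j)%nat -> (j <= 4)%nat ->
    sp (g i) (g j) =
    if Nat.eqb i j then (if Nat.eqb i 4 then - E u0 v0 else E u0 v0) else 0) ->
  (forall j : nat, (1 <= j)%nat -> (j <= 4)%nat -> L0 * sp (g j) (g 0%nat) = 0) ->
  (L0 <> 0 -> sp (g 0%nat) (g 0%nat) = 1 / L0) ->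
  exists Phi : avec L0 -> avec L0, isometry_N Phi /\
    forall u v, O (u, v) -> forall a, G a 0%nat u v = Phi (F u v) a.
Proof.
move=> HG g g1 g2 g3; have n0 := E_neq0 u0 v0.
have [h1 [h2 h3]] := Y_gram u0 v0 o0.
pose A (a b : 'I_(adim L0)) := eta L0 (nat_of_ord b) *
  pairing L0 (E u0 v0) (fun k => g k a) (fun k => vec_at k u0 v0 b).
pose lin (x : avec L0) : avec L0 := fun a => \big[Rplus/0]_(b < adim L0) (A a b * x b).
have elin x a : lin x a = (L0 * sp (vec_at 0 u0 v0) x) * g 0%nat a +
    (sp (vec_at 1 u0 v0) x / E u0 v0) * g 1%nat a + (sp (vec_at 2 u0 v0) x / E u0 v0) * g 2%nat a +
    (sp (vec_at 3 u0 v0) x / E u0 v0) * g 3%nat a + (- sp (vec_at 4 u0 v0) x / E u0 v0) * g 4%nat a.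
  pose w i := \big[Rplus/0]_(b < adim L0) (eta L0 (nat_of_ord b) * (vec_at i u0 v0 b * x b)).
  have ew i : sp (vec_at i u0 v0) x = w i by [].
  rewrite !ew.
  transitivity ((L0 * g 0%nat a) * w 0%nat + ((g 1%nat a / E u0 v0) * w 1%nat +
    ((g 2%nat a / E u0 v0) * w 2%nat + ((g 3%nat a / E u0 v0) * w 3%nat +
    (- g 4%nat a / E u0 v0) * w 4%nat)))); last by field.
  rewrite /w -!bigR_scal -!bigR_plus; apply: eq_bigr => b _.
  by rewrite /A /pairing; field.
have spc x y : sp x y = pairing L0 (E u0 v0) (fun k => sp (vec_at k u0 v0) x)
    (fun k => sp (vec_at k u0 v0) y).
  rewrite (sp_ext _ x (fun a => (L0 * sp (vec_at 0 u0 v0) x) * vec_at 0 u0 v0 a +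
    (sp (vec_at 1 u0 v0) x / E u0 v0) * vec_at 1 u0 v0 a +
    (sp (vec_at 2 u0 v0) x / E u0 v0) * vec_at 2 u0 v0 a +
    (sp (vec_at 3 u0 v0) x / E u0 v0) * vec_at 3 u0 v0 a +
    (- sp (vec_at 4 u0 v0) x / E u0 v0) * vec_at 4 u0 v0 a)).
    by rewrite sp_comb5 /pairing; field.
  by move=> a; rewrite (vec_complete x a u0 v0 o0); field.
have iso x y : sp (lin x) (lin y) = sp x y.
  rewrite (spc x y) (sp_ext _ _ _ _ (elin x)) sp_comb5.
  rewrite !(sp_sym _ _ (lin y)) !(sp_ext _ _ _ _ (elin y)) !sp_comb5 /pairing.
  set x0 := sp (vec_at 0 u0 v0) x; set x1 := sp (vec_at 1 u0 v0) x.
  set x2 := sp (vec_at 2 u0 v0) x; set x3 := sp (vec_at 3 u0 v0) x.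
  set x4 := sp (vec_at 4 u0 v0) x.
  set y0 := sp (vec_at 0 u0 v0) y; set y1 := sp (vec_at 1 u0 v0) y.
  set y2 := sp (vec_at 2 u0 v0) y; set y3 := sp (vec_at 3 u0 v0) y.
  set y4 := sp (vec_at 4 u0 v0) y.
  rewrite !(sp_sym _ (g 0%nat) (g 1%nat)) !(sp_sym _ (g 0%nat) (g 2%nat))
    !(sp_sym _ (g 0%nat) (g 3%nat)) !(sp_sym _ (g 0%nat) (g 4%nat)).
  have k1 := g2 1%nat ltac:(lia) ltac:(lia); have k2 := g2 2%nat ltac:(lia) ltac:(lia).
  have k3 := g2 3%nat ltac:(lia) ltac:(lia); have k4 := g2 4%nat ltac:(lia) ltac:(lia).
  have k0 : L0 * (L0 * sp (g 0%nat) (g 0%nat)) = L0.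
    case: (Req_dec L0 0) => hL; last by rewrite g3 //; field.
    by transitivity 0; [rewrite {1}hL; ring|rewrite hL].
  set G00 := sp (g 0%nat) (g 0%nat) in k0 *.
  set G01 := sp (g 1%nat) (g 0%nat) in k1 *; set G02 := sp (g 2%nat) (g 0%nat) in k2 *.
  set G03 := sp (g 3%nat) (g 0%nat) in k3 *; set G04 := sp (g 4%nat) (g 0%nat) in k4 *.
  rewrite !g1 /=; try lia.
  transitivity (L0 * (L0 * G00) * x0 * y0 + (L0 * G01) * (x0 * y1 + x1 * y0) / E u0 v0 +
    (L0 * G02) * (x0 * y2 + x2 * y0) / E u0 v0 + (L0 * G03) * (x0 * y3 + x3 * y0) / E u0 v0 -
    (L0 * G04) * (x0 * y4 + x4 * y0) / E u0 v0 +
    (x1 * y1 + x2 * y2 + x3 * y3 - x4 * y4) / E u0 v0); first by field.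
  by rewrite k0 k1 k2 k3 k4; field.
have lin_vec k a : (1 <= k)%nat -> (k <= 4)%nat -> lin (vec_at k u0 v0) a = g k a.
  move=> hk1 hk2; rewrite elin.
  have q := h2 k hk1 hk2; rewrite sp_sym in q; rewrite q.
  by move: k hk1 hk2 {q} => [|[|[|[|[|k]]]]] hk1 hk2; try lia; rewrite !h1 /=; try lia; field.
pose b : avec L0 := fun a => g 0%nat a - lin (vec_at 0 u0 v0) a.
have b0 a : L0 * b a = 0.
  case: (Req_dec L0 0) => hL; first by rewrite {1}hL; ring.
  rewrite /b elin h3 //.
  have q k : (1 <= k)%nat -> (k <= 4)%nat -> sp (vec_at k u0 v0) (vec_at 0 u0 v0) = 0.
    by move=> a1 a2; have := h2 k a1 a2; case/Rmult_integral.
  by rewrite (q 1%nat) ?(q 2%nat) ?(q 3%nat) ?(q 4%nat); try lia; field.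
exists (fun x a => lin x a + b a); split.
  exists A, b; split=> //; split; first exact: iso.
  move=> x; split=> hx hL; have := hx hL => <-; have ez : (fun a => lin x a + b a) = lin x.
  - apply: functional_extensionality => a.
    by have := b0 a; case/Rmult_integral => // ->; ring.
  - by rewrite ez iso.
  - apply: functional_extensionality => a.
    by have := b0 a; case/Rmult_integral => // ->; ring.
  - by rewrite ez iso.
move=> u v o a.
pose z k u v := lin (vec_at k u v) a + (if Nat.eqb k 0 then b a else 0).
have sz k : (k <= 4)%nat -> smooth O (z k).
  move=> hk; apply: smooth_plus => //; last exact: smooth_const.
  rewrite /lin.
  apply: (smooth_agree O oO (fun u v => \big[Rplus/0]_(j < adim L0) (A a j * Y j k u v))) => //.
  apply: bigR_smooth => // j; apply: smooth_mult => //; first exact: smooth_const.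
  by apply: is_sol_smooth sP sQ (HY j) hk.
have Hz : is_sol 4 P Q O z.
  apply: smooth_is_sol => // u' v' k o' hk.
  have sY j : smooth O (Y j k) by exact: is_sol_smooth sP sQ (HY j) hk.
  have sYA j : smooth O (fun u v => A a j * Y j k u v).
    by apply: smooth_mult => //; exact: smooth_const.
  have ss : smooth O (fun u v => \big[Rplus/0]_(j < adim L0) (A a j * Y j k u v)).
    exact: bigR_smooth.
  have ext T : (forall m, (m <= 4)%nat -> T m 0%nat u' v' * b a = 0) ->
      \big[Rplus/0]_(j < adim L0) (A a j * act 4 T (Y j) k u' v') = act 4 T z k u' v'.
    move=> hT; rewrite /act /= /z /=.
    have t := hT k hk.
    transitivity (T k 0%nat u' v' * lin (vec_at 0 u' v') a + (T k 1%nat u' v' * lin (vec_at 1 u' v') a +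
      (T k 2%nat u' v' * lin (vec_at 2 u' v') a + (T k 3%nat u' v' * lin (vec_at 3 u' v') a +
       T k 4%nat u' v' * lin (vec_at 4 u' v') a)))); last by lra.
    rewrite /lin -!bigR_scal -!bigR_plus; apply: eq_bigr => j _.
    by rewrite /vec_at; ring.
  have P0 m : (m <= 4)%nat -> P m 0%nat u' v' * b a = 0.
    by move: m => [|[|[|[|[|m]]]]] hm; try lia; rewrite /P /frame_u;
      [ring|transitivity (- E u' v' * (L0 * b a)); [rewrite /E; ring|rewrite b0; ring]|ring..].
  have Q0 m : (m <= 4)%nat -> Q m 0%nat u' v' * b a = 0.
    by move: m => [|[|[|[|[|m]]]]] hm; try lia; rewrite /Q /frame_v;
      [ring|ring|transitivity (- E u' v' * (L0 * b a)); [rewrite /E; ring|rewrite b0; ring]|ring..].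
  rewrite -(ext P P0) -(ext Q Q0) /z /lin /vec_at; split.
  - rewrite (du_plus O _ _ _ _ ss (smooth_const O _) o') du_const Rplus_0_r (bigR_du _ _ O) //.
    apply: eq_bigr => j _; rewrite (du_mult O _ _ _ _ (smooth_const O _) (sY j) o') du_const.
    by rewrite (is_sol_du _ _ _ _ _ _ _ _ (HY j) hk o'); ring.
  - rewrite (dv_plus O _ _ _ _ ss (smooth_const O _) o') dv_const Rplus_0_r (bigR_dv _ _ O) //.
    apply: eq_bigr => j _; rewrite (dv_mult O _ _ _ _ (smooth_const O _) (sY j) o') dv_const.
    by rewrite (is_sol_dv _ _ _ _ _ _ _ _ (HY j) hk o'); ring.
have := flat_global_uniqueness 4 O P Q oO sP sQ fl sc (G a) z (u0, v0) (HG a) Hz o0.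
move=> /(_ _ (u, v) o 0%nat (Nat.le_0_l _)); rewrite /at_pt /= /z /=; apply.
move=> k hk; rewrite /at_pt /=.
case: k hk => [|k] hk; first by rewrite /b /g /=; ring.
by rewrite /= lin_vec; [rewrite /g; ring|lia|lia].
Qed.

End Construct.

(** * The two directions and uniqueness *)

(** A linear dependence with hyperbolic coefficients makes [X] times the conjugate
    of [Y] imaginary, in view of [WX = YZ]; a light-like one gives [W = Y] or
    [W = - Y], that is, [k] is 1 or -1. *)
Lemma nonreal_independent (O : R * R -> Prop) c (k : C) u v : O (u, v) ->
  k <> 1%C -> k <> (-1)%C ->
  fW c u v = (k * fY c u v)%C -> fZ c u v = (k * fX c u v)%C ->
  (fX c u v * fX c u v * (Cconj (fY c u v) * Cconj (fY c u v))
   - Cconj (fX c u v) * Cconj (fX c u v) * (fY c u v * fY c u v) <> 0)%C ->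
  ~ linearly_dependent_condition O c.
Proof.
move=> o k1 k2 eW eZ nr.
have WZ : (fW c u v * fX c u v - fY c u v * fZ c u v = 0)%C by rewrite eW eZ; ring.
have g : al2 c u v * al2 c u v + be1 c u v * be3 c u v
    - be2 c u v * be2 c u v - al1 c u v * al3 c u v = 0.
  have := f_equal Re WZ; rewrite /= => <-; ring.
have re : al2 c u v * be2 c u v - al1 c u v * be3 c u v <> 0.
  move=> e; apply: nr; apply: injective_projections => /=; first by ring.
  transitivity (4 * (al2 c u v * be2 c u v - al1 c u v * be3 c u v) *
    (al1 c u v * al2 c u v + be2 c u v * be3 c u v)); first by ring.
  by rewrite e; ring.
have sq (x y t : R) : cosh t * x + sinh t * y = 0 -> x = - (sinh t / cosh t) * y.
  move=> h; have c0 : cosh t <> 0 by have := exp_pos t; have := exp_pos (- t); rewrite /cosh; lra.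
  transitivity ((cosh t * x) / cosh t); first by field.
  have -> : cosh t * x = - (sinh t * y) by lra.
  by field.
have tau (t : R) : (sinh t / cosh t) * (sinh t / cosh t) <> 1.
  have c0 : cosh t <> 0 by have := exp_pos t; have := exp_pos (- t); rewrite /cosh; lra.
  have cs : cosh t * cosh t - sinh t * sinh t = 1.
    rewrite /cosh /sinh; have := exp_plus t (- t); rewrite Rplus_opp_r exp_0 => e.
    lra.
  move=> e; have : sinh t * sinh t = cosh t * cosh t.
    transitivity ((sinh t / cosh t) * (sinh t / cosh t) * (cosh t * cosh t)); first by field.
    by rewrite e; ring.
  lra.
case=> [[t H]|[[t H]|[eps [he H]]]]; have [h1 [h2 h3]] := H u v o.
- have e1 := sq _ _ _ h1; have e2 := sq _ _ _ h2; have e3 := sq _ _ _ h3.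
  have n := tau (t u v); set m := sinh _ / cosh _ in e1 e2 e3 n.
  have : (m * m - 1) * (be2 c u v * be2 c u v - be1 c u v * be3 c u v) = 0.
    by rewrite -[RHS]g e1 e2 e3; ring.
  case/Rmult_integral => z; first by apply: n; lra.
  apply: re; rewrite e1 e2.
  transitivity (- m * (be2 c u v * be2 c u v - be1 c u v * be3 c u v)); first by ring.
  by rewrite z; ring.
- have e1 : be1 c u v = - (sinh (t u v) / cosh (t u v)) * al1 c u v by apply: sq; lra.
  have e2 : be2 c u v = - (sinh (t u v) / cosh (t u v)) * al2 c u v by apply: sq; lra.
  have e3 : be3 c u v = - (sinh (t u v) / cosh (t u v)) * al3 c u v by apply: sq; lra.
  have n := tau (t u v); set m := sinh _ / cosh _ in e1 e2 e3 n.
  have : (1 - m * m) * (al2 c u v * al2 c u v - al1 c u v * al3 c u v) = 0.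
    by rewrite -[RHS]g e1 e2 e3; ring.
  case/Rmult_integral => z; first by apply: n; lra.
  apply: re; rewrite e2 e3.
  transitivity (- m * (al2 c u v * al2 c u v - al1 c u v * al3 c u v)); first by ring.
  by rewrite z; ring.
- have Y0 : fY c u v <> 0%C by move=> z; apply: nr; rewrite z Cconj_RtoC; ring.
  have [e ee] : exists e : R, (e = 1 \/ e = -1) /\ fW c u v = (e * fY c u v)%C.
    case: he => ez; rewrite ez in h1 h2 h3; [exists (-1)|exists 1]; split; auto;
      apply: injective_projections => /=; lra.
  have ke : k = RtoC e.
    apply: (Cmult_cancel (fY c u v)) => //.
    by rewrite ![(fY c u v * _)%C]Cmult_comm -eW; case: ee.
  by case: ee => [[ez|ez] _]; [apply: k1|apply: k2]; rewrite ke ez.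
Qed.

Section Assembly.

Variables (L0 : R) (O : R * R -> Prop).
Hypothesis oO : open O.
Hypothesis sc : simply_connected O.

(** Whatever the branch of the root, the inequality is equivalent to (iii) at every
    point; (iii) in turn gives the angle [psi] and the other conditions. *)
Theorem surface_conditions (F N1 N2 : vfield L0) (c : coeffs)
    (lam gam : R -> R -> R) (k f : R -> R -> C) :
  spacelike_conformal_immersion O F -> K_equals O F ->
  adapted O F N1 N2 lam c -> potentials O c gam k f ->
  ((forall u v : R, O (u, v) ->
     (fX c u v * fX c u v * (Cconj (fY c u v) * Cconj (fY c u v))
      - Cconj (fX c u v) * Cconj (fX c u v) * (fY c u v * fY c u v)
      <> 0)%C)
   <->
   (exists psi : R -> R -> R, smooth O psi /\ conditions L0 O lam gam k psi f)).
Proof.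
move=> imm hK ad po.
have [s [sb XY]] := po_XY po; have [ssm ss] := sb.
have s0 := branch_neq0 O c gam k f po s sb.
have nr u v : O (u, v) -> (fX c u v * fX c u v * (Cconj (fY c u v) * Cconj (fY c u v))
      - Cconj (fX c u v) * Cconj (fX c u v) * (fY c u v * fY c u v)
      <> 0)%C <-> cond_iii f u v.
  by move=> o; have [-> ->] := XY u v o; apply: nonreal_iff; exact: s0.
split; last first.
  by move=> [psi [_ H]] u v o; apply/nr => //; have [_ [_ []]] := H u v o.
move=> H.
have iii u v (o : O (u, v)) : cond_iii f u v by apply/nr => //; exact: H.
have [psi [sp Hp]] := potentials_angle O oO sc c gam k f po s sb XY iii.
exists psi; split=> // u v o.
have i : cond_i L0 lam u v.
  have e := hK u v o; rewrite (frame_curvature L0 O oO F N1 N2 lam c imm ad u v o) in e.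
  rewrite /cond_i -e; field; have := exp_pos (2 * lam u v); lra.
have cod : codazzi_defect lam c k f u v = 0%C.
  have scf := potentials_smooth_coeffs O oO c gam k f po s sb XY.
  have [c13 [c14 [c23 c24]]] := frame_codazzi L0 O oO F N1 N2 lam c imm ad u v scf o.
  have [_ e] := codazzi_curv L0 O oO lam c k s f (po_k po) ssm (po_f po) s0 ss
    (fun u v o => proj1 (XY u v o)) (fun u v o => proj2 (XY u v o))
    (fun u v o => proj1 (po_WZ po o)) (fun u v o => proj2 (po_WZ po o)) u v o.
  rewrite c14 c23 in e.
  apply: (Cmult_eq0 (- (Ci / s u v))); last first.
    apply: Copp_neq0; apply: (Cmult_neq0_l _ (s u v)).
    have -> : (Ci / s u v * s u v = Ci)%C by field; exact: s0.
    exact: Ci_nz.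
  by transitivity (- (Ci / s u v * codazzi_defect lam c k f u v))%C; [ring|rewrite -e].
have [v' vi] := angle_conditions O oO c lam gam k f po s sb XY iii psi sp Hp u v o cod.
split; first exact: i.
split; first by apply/cond_ii_iff; exact: (potentials_real O c gam k f po s sb XY iii).
split; first exact: iii.
split; first exact: (potentials_iv O c gam k f po s sb XY iii).
by [].
Qed.

(** The data of two surfaces with the same potentials differ by the sign of
    the branch of the square root; changing the sign of the normal frame of one
    of them, both frames satisfy the same system. *)
Lemma realizes_frame lam gam k f c (G : vfield L0) u0 v0 : O (u0, v0) ->
  smooth O lam -> potentials O c gam k f -> realizes O lam gam k f G ->
  exists Y : 'I_(adim L0) -> nat -> R -> R -> R,
    (forall a, is_sol 4 (frame_u L0 lam c) (frame_v L0 lam c) O (Y a)) /\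
    (forall a u v, Y a 0%nat u v = G u v a) /\
    let g i : avec L0 := fun a => Y a i u0 v0 in
    (forall i j : nat, (1 <= i)%nat -> (i <= 4)%nat -> (1 <= j)%nat -> (j <= 4)%nat ->
      sp (g i) (g j) =
      if Nat.eqb i j then (if Nat.eqb i 4 then - exp (2 * lam u0 v0) else exp (2 * lam u0 v0)) else 0) /\
    (forall j : nat, (1 <= j)%nat -> (j <= 4)%nat -> L0 * sp (g j) (g 0%nat) = 0) /\
    (L0 <> 0 -> sp (g 0%nat) (g 0%nat) = 1 / L0).
Proof.
move=> o0 sl po [imm [_ [_ [N1 [N2 [c' [ad [po' _]]]]]]]].
have [s [sb XY]] := po_XY po; have [s' [sb' XY']] := po_XY po'.
have s0 := branch_neq0 O c gam k f po s sb.
have [e [he es]] : exists e : R, (e = 1 \/ e = -1) /\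
    forall u v, O (u, v) -> s' u v = (e * s u v)%C.
  pose h u v := Re (s' u v / s u v)%C.
  have sh : smooth O h by have [] := Csmooth_div O oO _ _ (proj1 sb') (proj1 sb) s0.
  have hv u v (o : O (u, v)) : (s' u v = s u v /\ h u v = 1) \/ (s' u v = (- s u v)%C /\ h u v = -1).
    case: (sqrt_branch_pm O k s s' u v sb sb' o) => e; [left|right]; split=> //; rewrite /h e.
    - by have -> : (s u v / s u v = 1)%C by field; exact: s0.
    - by have -> : (- s u v / s u v = - (1))%C by field; exact: s0.
  have hn u v (o : O (u, v)) : h u v <> 0 by case: (hv u v o) => [] [_ ->]; lra.
  have hn' u v (o : O (u, v)) : - h u v <> 0 by case: (hv u v o) => [] [_ ->]; lra.
  case: (hv u0 v0 o0) => [] [_ e0]; [exists 1|exists (-1)]; split; auto=> u v o.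
  - have := nonzero_constant_sign O sc h u0 v0 u v sh hn o0 o ltac:(lra).
    by case: (hv u v o) => [] [-> hh]; [move=> _; ring|lra].
  - have := nonzero_constant_sign O sc (fun u v => - h u v) u0 v0 u v (smooth_opp O oO _ sh) hn' o0 o
      ltac:(lra).
    case: (hv u v o) => [] [-> hh]; first lra.
    by move=> _; apply: injective_projections => /=; ring.
have ee : e * e = 1 by case: he => ->; ring.
have en : RtoC e <> 0%C by case: he => -> /RtoC_inj; lra.
have eC : (RtoC e * RtoC e = 1)%C by rewrite -RtoC_mult ee.
have cX u v (o : O (u, v)) : fX c' u v = (e * fX c u v)%C.
  have [-> _] := XY u v o; have [-> _] := XY' u v o; rewrite es //.
  by field [eC]; split=> //; exact: s0.
have cY u v (o : O (u, v)) : fY c' u v = (e * fY c u v)%C.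
  have [_ ->] := XY u v o; have [_ ->] := XY' u v o; rewrite es //.
  by field [eC]; split=> //; exact: s0.
have cW u v (o : O (u, v)) : fW c' u v = (e * fW c u v)%C.
  have [-> _] := po_WZ po o; have [-> _] := po_WZ po' o; rewrite cY //; ring.
have cZ u v (o : O (u, v)) : fZ c' u v = (e * fZ c u v)%C.
  have [_ ->] := po_WZ po o; have [_ ->] := po_WZ po' o; rewrite cX //; ring.
have co u v (o : O (u, v)) : (al1 c' u v = e * al1 c u v /\ al2 c' u v = e * al2 c u v /\
    al3 c' u v = e * al3 c u v) /\ (be1 c' u v = e * be1 c u v /\ be2 c' u v = e * be2 c u v /\
    be3 c' u v = e * be3 c u v) /\ mu1 c' u v = mu1 c u v /\ mu2 c' u v = mu2 c u v.
  have [x1 x2] : al2 c' u v = e * al2 c u v /\ be3 c' u v = e * be3 c u v.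
    by have := cX u v o; rewrite /fX => [= -> ->]; split; ring.
  have [y1 y2] : be2 c' u v = e * be2 c u v /\ al1 c' u v = e * al1 c u v.
    by have := cY u v o; rewrite /fY => [= -> y]; split; lra.
  have w : be1 c' u v = e * be1 c u v by have := cW u v o; rewrite /fW => [= _ y]; lra.
  have z : al3 c' u v = e * al3 c u v by have := cZ u v o; rewrite /fZ => [= _ y]; lra.
  have [<- <-] := po_mu po o; have [<- <-] := po_mu po' o.
  by [].
have H := frame_is_sol L0 O oO G N1 N2 lam c' imm ad.
pose ep (i : nat) := match i with 3%nat | 4%nat => e | _ => 1 end.
exists (fun a i u v => ep i * frame L0 G N1 N2 a i u v).
have fsm a i : smooth O (frame L0 G N1 N2 a i) by exact: (frame_smooth L0 O G N1 N2 lam c' imm ad).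
split.
  move=> a; apply: smooth_is_sol => // [i _|u v i o hi].
    by apply: smooth_mult => //; exact: smooth_const.
  rewrite (du_mult O _ _ _ _ (smooth_const O _) (fsm a i) o) du_const.
  rewrite (dv_mult O _ _ _ _ (smooth_const O _) (fsm a i) o) dv_const.
  rewrite (is_sol_du _ _ _ _ _ _ _ _ (H a) hi o) (is_sol_dv _ _ _ _ _ _ _ _ (H a) hi o).
  have [[a1 [a2 a3]] [[b1 [b2 b3]] [m1 m2]]] := co u v o.
  by move: i hi => [|[|[|[|[|i]]]]] hi; try lia; rewrite /act /= /ep ?a1 ?a2 ?a3 ?b1 ?b2 ?b3 ?m1 ?m2;
    split; ring [ee].
split; first by move=> a u v; rewrite /ep /=; ring.
have [q1 [q2 q3]] := sp_T L0 O G N1 N2 lam c' imm ad u0 v0 o0.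
have [n1 [n2 n3]] := ad_norm ad o0.
have [r1 [r2 r3]] := proj2 (ad_N1 ad) u0 v0 o0; have [t1 [t2 t3]] := proj2 (ad_N2 ad) u0 v0 o0.
have [f1 f2] := sp_T_F L0 O oO G imm u0 v0 o0.
have [f3 f4] := sp_N_F L0 O G N1 N2 lam c' ad u0 v0 o0.
pose W (i : nat) : avec L0 := fun a => frame L0 G N1 N2 a i u0 v0.
have eW i j : sp (fun a => ep i * frame L0 G N1 N2 a i u0 v0) (fun a => ep j * frame L0 G N1 N2 a j u0 v0) =
    ep i * (ep j * sp (W i) (W j)).
  by rewrite sp_scal (sp_sym _ (fun a => frame L0 G N1 N2 a i u0 v0)) sp_scal (sp_sym _ (W j)).
cbv zeta; split; [|split].
- move=> i j h1 h2 h3 h4; rewrite eW.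
  move: i j h1 h2 h3 h4 => [|[|[|[|[|i]]]]] [|[|[|[|[|j]]]]] h1 h2 h3 h4; try lia;
  rewrite /W /= /ep; change (fun a => T1 G u0 v0 a) with (T1 G u0 v0);
  change (fun a => T2 G u0 v0 a) with (T2 G u0 v0); change (fun a => N1 u0 v0 a) with (N1 u0 v0);
  change (fun a => N2 u0 v0 a) with (N2 u0 v0);
  rewrite ?q1 ?q2 ?q3 ?n1 ?n2 ?n3 ?r1 ?r2 ?t1 ?t2 ?(sp_sym _ (T2 G u0 v0)) ?(sp_sym _ (T1 G u0 v0))
    ?(sp_sym _ (N2 u0 v0) (N1 u0 v0)) ?q1 ?q2 ?n3 ?r1 ?r2 ?t1 ?t2 ?(sp_sym _ (T2 G u0 v0)) ?q3;
  ring [ee].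
- move=> j h1 h2; rewrite eW.
  move: j h1 h2 => [|[|[|[|[|j]]]]] h1 h2; try lia; rewrite /W /= /ep;
  change (fun a => T1 G u0 v0 a) with (T1 G u0 v0);
  change (fun a => T2 G u0 v0 a) with (T2 G u0 v0); change (fun a => N1 u0 v0 a) with (N1 u0 v0);
  change (fun a => N2 u0 v0 a) with (N2 u0 v0); change (fun a => G u0 v0 a) with (G u0 v0).
  + by rewrite !Rmult_1_l.
  + by rewrite !Rmult_1_l.
  + by transitivity (e * (L0 * sp (N1 u0 v0) (G u0 v0))); [ring|rewrite f3; ring].
  + by transitivity (e * (L0 * sp (N2 u0 v0) (G u0 v0))); [ring|rewrite f4; ring].
- by move=> hL; rewrite eW /= !Rmult_1_l; exact: (imm_in_N imm o0 hL).
Qed.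

(** After the choice of the factor the formulas define real coefficients, for
    which the frame system is flat; its solution that starts at an orthogonal
    frame is the surface. *)
Theorem conditions_surface (lam gam psi : R -> R -> R) (k f : R -> R -> C) :
  smooth O lam -> smooth O gam -> smooth O psi -> Csmooth O k -> Csmooth O f ->
  (forall u v : R, O (u, v) -> k u v <> 0%C /\ k u v <> 1%C /\ k u v <> (-1)%C) ->
  conditions L0 O lam gam k psi f ->
  exists e : C,
    (e = 1%C \/ (e = Ci /\ ~ formulas_consistent O k f)) /\
    exists F : vfield L0,
      realizes O lam gam k (fun u v => (e * f u v)%C) F /\
      forall G : vfield L0,
        realizes O lam gam k (fun u v => (e * f u v)%C) G ->
        exists Phi : avec L0 -> avec L0,
          isometry_N Phi /\ forall u v : R, O (u, v) -> forall i, G u v i = Phi (F u v) i.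
Proof.
move=> sl sg sp sk sf kv H.
have [[[u0 v0] o0] _] := sc.
have ci u v (o : O (u, v)) : cond_i L0 lam u v by have [] := H u v o.
have cii u v (o : O (u, v)) : cond_ii f u v by have [_ []] := H u v o.
have ciii u v (o : O (u, v)) : cond_iii f u v by have [_ [_ []]] := H u v o.
have civ u v (o : O (u, v)) : cond_iv k f u v by have [_ [_ [_ []]]] := H u v o.
have cvi u v (o : O (u, v)) : cond_vi lam gam k psi f u v by have [_ [_ [_ [_ []]]]] := H u v o.
have [s sb] := sqrt_branch_exists O oO sc k sk kv; have [ssm ss] := sb.
have s0 u v (o : O (u, v)) := sqrt_branch_neq0 O k kv s u v sb o.
have [e [he cn]] := factor_choice O oO sc k f sk sf kv cii ciii civ s sb.
exists e; split=> //.
have en : (e * Cconj e = 1)%C.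
  by case: he => [->|[-> _]]; [rewrite Cconj_RtoC|rewrite Cconj_Ci]; ring [Ci2].
pose fe u v := (e * f u v)%C.
have sfe : Csmooth O fe by apply: Csmooth_mult => //; exact: Csmooth_const.
have du_fe u v (o : O (u, v)) : Cdu fe u v = (e * Cdu f u v)%C.
  by rewrite /fe (Cdu_mult O oO _ _ _ _ (Csmooth_const O e) sf o) Cdu_const; ring.
have dv_fe u v (o : O (u, v)) : Cdv fe u v = (e * Cdv f u v)%C.
  by rewrite /fe (Cdv_mult O oO _ _ _ _ (Csmooth_const O e) sf o) Cdv_const; ring.
have iiie u v (o : O (u, v)) : cond_iii fe u v.
  have /cond_iii_iff [A0 J0] := ciii u v o.
  apply/cond_iii_iff; rewrite du_fe // dv_fe //; split.
  - have -> : cA (e * Cdu f u v) (e * Cdv f u v) = cA (Cdu f u v) (Cdv f u v) => //.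
    rewrite /cA !Cmult_conj; transitivity (e * Cconj e * cA (Cdu f u v) (Cdv f u v))%C.
      by rewrite /cA; ring.
    by rewrite en /cA; ring.
  - have -> : cJ (e * Cdu f u v) (e * Cdv f u v) = cJ (Cdu f u v) (Cdv f u v) => //.
    rewrite /cJ !Cmult_conj; transitivity (e * Cconj e * cJ (Cdu f u v) (Cdv f u v))%C.
      by rewrite /cJ; ring.
    by rewrite en /cJ; ring.
pose X u v := (Ci * Cdv fe u v / s u v)%C.
pose Y u v := (Cdu fe u v / s u v)%C.
pose c := Coeffs (fun u v => - Im (Y u v)) (fun u v => Re (X u v))
  (fun u v => Im (k u v * X u v)%C) (fun u v => - Im (k u v * Y u v)%C)
  (fun u v => Re (Y u v)) (fun u v => Im (X u v)) (du gam) (dv gam).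
have eta2 (z : C) : (Re z, Im z) = z by case: z.
have eX u v : fX c u v = X u v by rewrite /fX /c /=.
have eY u v : fY c u v = Y u v.
  transitivity (Re (Y u v), - - Im (Y u v)) => //.
  by rewrite Ropp_involutive; exact: eta2.
have eW u v (o : O (u, v)) : fW c u v = (k u v * fY c u v)%C.
  rewrite eY; transitivity (Re (X u v), - - Im (k u v * Y u v)%C) => //.
  have [h _] := cn u v o; rewrite -du_fe // -dv_fe // in h.
  rewrite Ropp_involutive /X -h; exact: eta2.
have eZ u v (o : O (u, v)) : fZ c u v = (k u v * fX c u v)%C.
  rewrite eX; transitivity (Re (Y u v), Im (k u v * X u v)%C) => //.
  have [_ h] := cn u v o; rewrite -du_fe // -dv_fe // in h.
  rewrite /Y -h; exact: eta2.
have XY u v (o : O (u, v)) : fX c u v = (Ci * Cdv fe u v / s u v)%C /\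
    fY c u v = (Cdu fe u v / s u v)%C by rewrite eX eY.
have po : potentials O c gam k fe.
  split=> //; last by exists s.
  by move=> u v o; split; [exact: eW|exact: eZ].
have scf := potentials_smooth_coeffs O oO c gam k fe po s sb XY.
have cod u v (o : O (u, v)) : codazzi_defect lam c k fe u v = 0%C.
  have /cond_iii_iff [_ J0] := ciii u v o.
  have [h1 h2] := proj1 (cond_vi_iff f k u v lam gam psi J0) (cvi u v o).
  have h := vi_codazzi _ _ (k u v) (Cdu k u v) (Cdv k u v) _ (du lam u v) (dv lam u v) _ _ J0 h1 h2.
  rewrite /codazzi_defect du_fe // dv_fe //; rewrite /codazzi in h.
  transitivity (e * (Cdu f u v * (Cdv k u v / (k u v * k u v - 1) - dv gam u v - Ci * du lam u v) -
    Cdv f u v * (Cdu k u v / (k u v * k u v - 1) - du gam u v + Ci * dv lam u v)))%C.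
    by rewrite /c /=; ring.
  by rewrite h; ring.
have hmu u v (o : O (u, v)) : dv (mu1 c) u v = du (mu2 c) u v.
  by rewrite /c /= (du_dv O oO gam u v sg o).
have fl : flat 4 O (frame_u L0 lam c) (frame_v L0 lam c).
  apply: (frame_flat L0 O oO lam c sl) => u v o.
  have WZ : (fW c u v * fX c u v - fY c u v * fZ c u v = 0)%C by rewrite eW // eZ //; ring.
  have r1 := f_equal Re WZ; have r2 := f_equal Im WZ.
  rewrite /fW /fX /fY /fZ [Re _]/= [Im _]/= in r1 r2.
  have [d1 d2] := codazzi_curv L0 O oO lam c k s fe sk ssm sfe s0 ss
    (fun u v o => proj1 (XY u v o)) (fun u v o => proj2 (XY u v o)) eW eZ u v o.
  have z1 : (- (Ci * (k u v / s u v) * codazzi_defect lam c k fe u v) = 0)%C by rewrite cod //; ring.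
  have z2 : (- (Ci / s u v * codazzi_defect lam c k fe u v) = 0)%C by rewrite cod //; ring.
  rewrite z1 in d1; rewrite z2 in d2; case: d1 => d13 d24; case: d2 => d14 d23.
  split; first exact: ci.
  split; first by move: r1; rewrite /Re /Im /=; lra.
  split; first by move: r2; rewrite /Re /Im /=; lra.
  by split; first exact: hmu.
pose e0 := exp (lam u0 v0).
have exY (a : 'I_(adim L0)) : exists y, is_sol 4 (frame_u L0 lam c) (frame_v L0 lam c) O y /\
    forall i, (i <= 4)%nat -> y i u0 v0 = init L0 e0 i (nat_of_ord a).
  have [y [Hy ey]] := flat_global_existence 4 O _ _ oO (frame_u_smooth L0 O oO lam c sl scf)
    (frame_v_smooth L0 O oO lam c sl scf) fl sc (u0, v0) (fun i => init L0 e0 i (nat_of_ord a)) o0.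
  by exists y; split=> // i hi; exact: (ey i hi).
pose Ys a := proj1_sig (constructive_indefinite_description _ (exY a)).
have HY a : is_sol 4 (frame_u L0 lam c) (frame_v L0 lam c) O (Ys a).
  exact: (proj1 (proj2_sig (constructive_indefinite_description _ (exY a)))).
have Y0 a i : (i <= 4)%nat -> Ys a i u0 v0 = init L0 e0 i (nat_of_ord a).
  exact: (proj2 (proj2_sig (constructive_indefinite_description _ (exY a))) i).
exists (vec_at L0 Ys 0); split.
  split; first exact: (constructed_immersion L0 O oO sc lam c sl scf fl u0 v0 o0 Ys HY Y0).
  split; first exact: (constructed_K L0 O oO sc lam c sl scf fl u0 v0 o0 Ys HY Y0 ci).
  split; first exact: (constructed_Rperp L0 O oO sc lam c sl scf fl u0 v0 o0 Ys HY Y0 hmu).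
  exists (vec_at L0 Ys 3), (vec_at L0 Ys 4), c.
  split; first exact: (constructed_adapted L0 O oO sc lam c sl scf fl u0 v0 o0 Ys HY Y0).
  split; first exact: po.
  have [_ [k1 k2]] := kv u0 v0 o0.
  apply: (nonreal_independent O c (k u0 v0) u0 v0 o0 k1 k2 (eW u0 v0 o0) (eZ u0 v0 o0)).
  by have [-> ->] := XY u0 v0 o0; apply/nonreal_iff; [exact: s0|exact: iiie].
move=> G rG.
have [Yg [Hg [g0 [g1 [g2 g3]]]]] := realizes_frame lam gam k fe c G u0 v0 o0 sl po rG.
have [Phi [iso HP]] := construct_rigid L0 O oO sc lam c sl scf fl u0 v0 o0 Ys HY Y0 Yg Hg g1 g2 g3.
by exists Phi; split=> // u v o i; rewrite -g0; exact: HP.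
Qed.

End Assembly.

Theorem theorem5p5 :
  forall (L0 : R) (O : R * R -> Prop),
  open O -> simply_connected O ->
  (forall (F N1 N2 : vfield L0) (c : coeffs)
          (lam gam : R -> R -> R) (k f : R -> R -> C),
     spacelike_conformal_immersion O F ->
     K_equals O F -> Rperp_zero O F ->
     adapted O F N1 N2 lam c -> potentials O c gam k f ->
     ((forall u v : R, O (u, v) ->
         (fX c u v * fX c u v * (Cconj (fY c u v) * Cconj (fY c u v))
          - Cconj (fX c u v) * Cconj (fX c u v) * (fY c u v * fY c u v)
          <> 0)%C)
      <->
      (exists psi : R -> R -> R,
         smooth O psi /\ conditions L0 O lam gam k psi f)))
  /\
  (forall (lam gam psi : R -> R -> R) (k f : R -> R -> C),
     smooth O lam -> smooth O gam -> smooth O psi ->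
     Csmooth O k -> Csmooth O f ->
     (forall u v : R, O (u, v) ->
        k u v <> 0%C /\ k u v <> 1%C /\ k u v <> (-1)%C) ->
     conditions L0 O lam gam k psi f ->
     exists e : C,
       (e = 1%C \/ (e = Ci /\ ~ formulas_consistent O k f)) /\
       exists F : vfield L0,
         realizes O lam gam k (fun u v => (e * f u v)%C) F /\
         forall G : vfield L0,
           realizes O lam gam k (fun u v => (e * f u v)%C) G ->
           exists Phi : avec L0 -> avec L0,
             isometry_N Phi /\
             forall u v : R, O (u, v) ->
             forall i, G u v i = Phi (F u v) i).
Proof.
move=> L0 O oO sc; split.
- move=> F N1 N2 c lam gam k f imm hK _ ad po.
  exact: (surface_conditions L0 O oO sc F N1 N2 c lam gam k f imm hK ad po).
- exact: (conditions_surface L0 O oO sc).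
Qed.
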